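(* Fix a sign $\pm$ (upper signs correspond to upper signs throughout, and lower to lower). Let $\varphi$ be a holomorphic function defined on a boundary neighborhood of $\overline{\mathbb{R}}\pm i0$ and assume that $\varphi$ behaves simply on $\overline{\mathbb{R}}\pm i0$. Let $\phi(z)=-i\varphi\left(i\frac{1-z}{1+z}\right)$ and $\widetilde\varphi(w)=\varphi(-1/w)$. Then the following hold. (i) The inversion $\widetilde\varphi$ shares the property with $\varphi$: it is holomorphic on a boundary neighborhood of $\overline{\mathbb{R}}\pm i0$ and behaves simply on $\overline{\mathbb{R}}\pm i0$. (ii) The limits $\varphi(x\pm i0)=\lim_{y\to\pm0}\varphi(x+iy)$ and $\widetilde\varphi(x\pm i0)=\lim_{y\to\pm0}\widetilde\varphi(x+iy)$ exist as distributions on $\mathbb{R}$. (iii) On $\mathbb{R}^\times=\mathbb{R}\setminus\{0\}$, the distributions $\varphi(x\pm i0)/(1+x^2)$ and $\widetilde\varphi(x\pm i0)/(1+x^2)$ are related by the inversion: for $f\in C_c^\infty(\mathbb{R}^\times)$ and $\widetilde f(x)=f(-1/x)$, $$\int_{\mathbb{R}^\times}f(x)\frac{\varphi(x\pm i0)}{1+x^2}\,dx=\int_{\mathbb{R}^\times}\widetilde f(x)\frac{\widetilde\varphi(x\pm i0)}{1+x^2}\,dx.$$ (iv) The joined distribution on $\overline{\mathbb{R}}$ ensured by (iii), also denoted by $\varphi(x\pm i0)$, is related to the boundary distribution $\phi(e^{it\mp0})$ on $\mathbb{T}$ by $$\oint_{2\pi}f\left(\tan\tfrac t2\right)\phi(e^{it\mp0})\,dt=-i\int_{\overline{\mathbb{R}}}f(s)\,\varphi(s\pm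 i0)\,\frac{2}{1+s^2}\,ds$$ for every $f\in C^\infty(\overline{\mathbb{R}})$ (in particular $f(-\infty)=f(\infty)$), the left integral being over one period.
   Context: $\overline{\mathbb{C}}$ is the Riemann sphere, $\overline{\mathbb{R}}=\mathbb{R}\sqcup\{\infty\}\subset\overline{\mathbb{C}}$ with its smooth structure as a circle (charts $x$ on $\mathbb{R}$ and $-1/x$ on $\overline{\mathbb{R}}\setminus\{0\}$), $\mathbb{C}_\pm$ the open upper/lower half plane, $\mathbb{T}=\{|z|=1\}$. Boundary neighborhood: for $S\subset\overline{\mathbb{R}}$, a boundary neighborhood of $S\pm i0$ is $U\cap\mathbb{C}_\pm$ with $U$ an open neighborhood of $S$ in $\overline{\mathbb{C}}$. Simple behavior: a holomorphic function $\varphi$ on a boundary neighborhood of $s\pm i0$ with $s\in\mathbb{R}$ behaves simply at $s\pm i0$ if $(\operatorname{Im}z)\varphi(z)$ is bounded on $U'\cap\mathbb{C}_\pm$ for some small neighborhood $U'$ of $s$; it behaves simply at $\infty\pm i0$ if $z\mapsto\varphi(-1/z)$ behaves simply at $0\pm i0$. It behaves simply on $S\pm i0$ if it does so at $s\pm i0$ for every $s\in S$. Distributional limits: ''$\varphi(x\pm i0)=\lim_{y\to\pm0}\varphi(x+iy)$ exists as a distribution on an open set $S\subset\mathbb{R}$'' means that $\int_S f(x)\varphi(x\pm i0)\,dx:=\lim_{y\to\pm0}\int_S f(x)\varphi(x+iy)\,dx$ exists for every $f\in C_c^\infty(S)$ and defines a distribution. Similarly $\phi(e^{it\mp0})$ denotes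 the $2\pi$-periodic distribution in $t$ (distribution on $\mathbb{T}$) given by $\lim_{r\to1\mp0}\phi(re^{it})$ (i.e. $r\uparrow1$ for the upper sign, $r\downarrow1$ for the lower), which exists under the stated hypothesis. Joined distribution: for $f\in C^\infty(\overline{\mathbb{R}})$ written as $f=f_1+f_2$ with $f_1,f_2\in C^\infty(\overline{\mathbb{R}})$, $f_1$ supported in a compact subset of $\mathbb{R}$ and $f_2$ supported in a compact subset of $\overline{\mathbb{R}}\setminus\{0\}$, $$\int_{\overline{\mathbb{R}}}f(s)\varphi(s\pm i0)\frac{2}{1+s^2}ds:=\int_{\mathbb{R}}f_1(s)\varphi(s\pm i0)\frac{2}{1+s^2}ds+\int_{\mathbb{R}}f_2(-1/s)\,\widetilde\varphi(s\pm i0)\frac{2}{1+s^2}ds,$$ which by (iii) does not depend on the decomposition. *)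

(* Defs.v *)
From Stdlib Require Export Reals.
From Coquelicot Require Export Coquelicot.
Open Scope C_scope.

(** ** Sphere, circle, half planes *)

(* [None] is the point at infinity, both in [Chat] and in [Rhat]. *)
Definition Chat := option C.
Definition Rhat := option R.
Definition Chat_of_Rhat (s : Rhat) : Chat := option_map RtoC s.

(* The topology of the one-point compactification of [C]. *)
Definition open_Chat (U : Chat -> Prop) : Prop :=
  open (fun z : C => U (Some z)) /\
  (U None -> exists r : R, forall z : C, (r < Cmod z)%R -> U (Some z)).

Definition Rhat_inv (s : Rhat) : Rhat :=
  match s with
  | None => Some 0%R
  | Some x => if Req_EM_T x 0 then None else Some (- / x)%R
  end.

(* The choice of the sign +/-. *)
Inductive side := Upper | Lower.

Definition half_plane (pm : side) (z : C) : Prop :=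
  match pm with
  | Upper => (0 < Im z)%R
  | Lower => (Im z < 0)%R
  end.

(* y -> +0 or y -> -0 *)
Definition to_axis (pm : side) : (R -> Prop) -> Prop :=
  match pm with
  | Upper => at_right 0
  | Lower => at_left 0
  end.

(* r -> 1 - 0 for the upper sign, r -> 1 + 0 for the lower one *)
Definition to_circle (pm : side) : (R -> Prop) -> Prop :=
  match pm with
  | Upper => at_left 1
  | Lower => at_right 1
  end.

(** ** Holomorphic functions near the boundary

    A holomorphic function on an open set [D] is a total function [C -> C] that
    is complex differentiable at the points of [D]; its values elsewhere are
    irrelevant. *)

Definition full : Rhat -> Prop := fun _ => True.

Definition boundary_nbhd (pm : side) (S : Rhat -> Prop) (D : C -> Prop) : Prop :=
  exists U : Chat -> Prop,
    open_Chat U /\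
    (forall s, S s -> U (Chat_of_Rhat s)) /\
    (forall z, D z <-> U (Some z) /\ half_plane pm z).

Definition holomorphic_on (D : C -> Prop) (phi : C -> C) : Prop :=
  forall z : C, D z -> ex_derive phi z.

Definition inversion (phi : C -> C) (w : C) : C := phi (- / w).

Definition behaves_simply_at_real (pm : side) (phi : C -> C) (s : R) : Prop :=
  exists U : C -> Prop,
    open U /\ U (RtoC s) /\
    exists M : R, forall z, U z -> half_plane pm z ->
      (Cmod (RtoC (Im z) * phi z) <= M)%R.

Definition behaves_simply_at (pm : side) (phi : C -> C) (s : Rhat) : Prop :=
  match s with
  | Some x => behaves_simply_at_real pm phi x
  | None => behaves_simply_at_real pm (inversion phi) 0
  end.

Definition behaves_simply_on (pm : side) (phi : C -> C) (S : Rhat -> Prop) : Prop :=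
  forall s, S s -> behaves_simply_at pm phi s.

Definition cayley (phi : C -> C) (z : C) : C :=
  - Ci * phi (Ci * ((1 - z) / (1 + z))).

(** ** Distributions on open subsets of the line *)

Definition smooth (f : R -> C) : Prop :=
  forall (n : nat) (x : R),
    ex_derive_n (fun t => Re (f t)) n x /\ ex_derive_n (fun t => Im (f t)) n x.

Definition Dn (f : R -> C) (n : nat) (x : R) : C :=
  (Derive_n (fun t => Re (f t)) n x, Derive_n (fun t => Im (f t)) n x).

Definition vanishes_off (K : R -> Prop) (f : R -> C) : Prop :=
  forall x, ~ K x -> f x = 0.

(* C_c^oo(S), as functions on the line extended by 0 *)
Definition test_function (S : R -> Prop) (f : R -> C) : Prop :=
  smooth f /\
  exists K, Rtopology.compact K /\ Rtopology.included K S /\ vanishes_off K f.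

Definition linear_on {X : Type} (F : (X -> C) -> Prop) (T : (X -> C) -> C) : Prop :=
  forall (a : C) (f g : X -> C), F f -> F g ->
    T (fun x => a * f x + g x) = a * T f + T g.

(* Continuity: |T f| <= c max_(k <= N) sup |f^(k)| for f supported in K. *)
Definition is_distribution (S : R -> Prop) (T : (R -> C) -> C) : Prop :=
  linear_on (test_function S) T /\
  forall K, Rtopology.compact K -> Rtopology.included K S ->
    exists (N : nat) (c : R), forall (f : R -> C) (M : R),
      smooth f -> vanishes_off K f ->
      (forall k x, (k <= N)%nat -> (Cmod (Dn f k x) <= M)%R) ->
      (Cmod (T f) <= c * M)%R.

(* [T] is the distribution phi(x +/- i0) on [S]. *)
Definition is_boundary_distribution
    (pm : side) (S : R -> Prop) (phi : C -> C) (T : (R -> C) -> C) : Prop :=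
  is_distribution S T /\
  forall f, test_function S f ->
    filterlimi
      (fun (y : R) (l : C) =>
         is_RInt_gen (fun x : R => f x * phi (x, y))
           (Rbar_locally m_infty) (Rbar_locally p_infty) l)
      (to_axis pm) (locally (T f)).

(** ** Distributions on the unit circle *)

Definition periodic_test_function (g : R -> C) : Prop :=
  smooth g /\ forall t : R, g (t + 2 * PI)%R = g t.

Definition is_periodic_distribution (P : (R -> C) -> C) : Prop :=
  linear_on periodic_test_function P /\
  exists (N : nat) (c : R), forall (g : R -> C) (M : R),
    periodic_test_function g ->
    (forall k t, (k <= N)%nat -> (Cmod (Dn g k t) <= M)%R) ->
    (Cmod (P g) <= c * M)%R.

(* [P] is the periodic distribution Phi(e^(it -/+ 0)), paired with periodic test
   functions by integration over one period. *)
Definition is_circle_boundary_distribution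
    (pm : side) (Phi : C -> C) (P : (R -> C) -> C) : Prop :=
  is_periodic_distribution P /\
  forall g, periodic_test_function g ->
    filterlimi
      (fun (r : R) (l : C) =>
         is_RInt (fun t : R => g t * Phi (r * cos t, r * sin t)%R) (- PI) PI l)
      (to_circle pm) (locally (P g)).

(** ** Distributions on the extended line *)

(* The function read in the charts [x] and [u = -1/x]. *)
Definition chart0 (f : Rhat -> C) (x : R) : C := f (Some x).
Definition chart1 (f : Rhat -> C) (u : R) : C := f (Rhat_inv (Some u)).

Definition smooth_Rhat (f : Rhat -> C) : Prop :=
  smooth (chart0 f) /\ smooth (chart1 f).

Definition is_Rhat_distribution (J : (Rhat -> C) -> C) : Prop :=
  linear_on smooth_Rhat J /\
  exists (r : R) (N : nat) (c : R), forall (f : Rhat -> C) (M : R),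
    smooth_Rhat f ->
    (forall k x, (k <= N)%nat -> (Rabs x <= r)%R ->
       (Cmod (Dn (chart0 f) k x) <= M)%R /\ (Cmod (Dn (chart1 f) k x) <= M)%R) ->
    (Cmod (J f) <= c * M)%R.

Definition supported_in_compact_of_R (f : Rhat -> C) : Prop :=
  f None = 0 /\ exists K, Rtopology.compact K /\ vanishes_off K (chart0 f).

(* The involution -1/x exchanges [Rhat \ {0}] and [R], hence also their compact
   subsets. *)
Definition supported_in_compact_off_0 (f : Rhat -> C) : Prop :=
  supported_in_compact_of_R (fun s => f (Rhat_inv s)).

Definition decomposition (f f1 f2 : Rhat -> C) : Prop :=
  (forall s, f s = f1 s + f2 s) /\
  smooth_Rhat f1 /\ smooth_Rhat f2 /\
  supported_in_compact_of_R f1 /\ supported_in_compact_off_0 f2.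

(* [J] is the distribution  f |-> int f(s) phi(s +/- i0) 2/(1+s^2) ds  joined from
   [T] = phi(x +/- i0) and [Tt] = phi~(x +/- i0): decompositions exist, and all of
   them give the same value. *)
Definition is_joined_distribution
    (T Tt : (R -> C) -> C) (J : (Rhat -> C) -> C) : Prop :=
  is_Rhat_distribution J /\
  forall f, smooth_Rhat f ->
    (exists f1 f2, decomposition f f1 f2) /\
    forall f1 f2, decomposition f f1 f2 ->
      J f = T (fun s => chart0 f1 s * RtoC (2 / (1 + s ^ 2))) +
            Tt (fun s => chart1 f2 s * RtoC (2 / (1 + s ^ 2))).

(* tan (t/2), with value infinity at the odd multiples of pi *)
Definition tan_half (t : R) : Rhat :=
  if Req_EM_T (cos (t / 2)) 0 then None else Some (tan (t / 2)).

(* Main.v *)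
(* On a strip {|Re z| < A, 0 < |Im z| < delta} the function phi has, by Goursat's theorem, a double
   primitive Phi2. Since phi is O(1 / |Im z|), the first primitive is O(|Im z|^(-1/2)), so Phi2 is
   bounded and Hoelder continuous of exponent 1/2 up to the axis. Integrating by parts twice, the
   integral of E phi along a path x |-> g(x) close to the axis becomes the integral of
   ((q E)' q)' Phi2(g) with q = 1 / g'. As the path tends to the axis together with its derivatives, this converges to the
   integral of E'' Phi2(x), whatever the paths are. Horizontal lines give the distribution
   phi(x +/- i0); the images under the Cayley transform of the circles |z| = r, parametrized by
   x = tan (t/2), give the pairing of phi(e^(it -/+ 0)) with functions supported off t = pi.
   As cayley phi (-z) = cayley (inversion phi) z, rotating the circle by pi deals in the same way with
   functions supported off t = 0. Everything else follows by comparing with the circle. *)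
Require Import Defs.
From Stdlib Require Import Lra Lia Psatz ClassicalEpsilon FunctionalExtensionality.

Local Ltac bounds_Rmin a b := pose proof (Rmin_l a b); pose proof (Rmin_r a b).
Local Ltac bounds_Rmax a b := pose proof (Rmax_l a b); pose proof (Rmax_r a b).

(** * Complex derivatives, and paths in the plane *)

Notation CR := (prod_NormedModule R_AbsRing R_NormedModule R_NormedModule).
Notation path_derive := (@is_derive R_AbsRing CR).
Notation path_continuous := (@continuous R_UniformSpace CR).
Notation is_CInt := (@is_RInt CR).

(** After one integration the available bound still blows up at the axis; the second integration is
    what gives boundary values, and it costs a second derivative of the test function, so all the
    distributions here are controlled by derivatives up to order two. The horizontal lines and the
    Cayley images of circles are the members [lam = 0] and [lam = 1] of one family of paths, and the
    estimates are uniform in [lam]: the line limit and the circle limit are then the same number by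
    construction. Limits enter as relations and the functionals are picked by [epsilon], so
    identities between them reduce to uniqueness of a limit. In particular both sides of (iii)
    describe one circle limit, and the joined distribution is defined as [Ci] times the circle
    functional: (iv) is then immediate from i * i = -1, and the work lies in showing that every
    decomposition reproduces this value. That decompositions exist requires a smooth cutoff adapted
    to the inversion, built from exp (-1/x). *)

Definition C_differential (f : C -> C) (z l : C) : Prop :=
  forall eps : R, (0 < eps)%R -> exists delta : R, (0 < delta)%R /\
    forall w, (Cmod (w - z) < delta)%R ->
      (Cmod (f w - f z - (w - z) * l) <= eps * Cmod (w - z))%R.

Lemma norm_CR (z : C) : @norm R_AbsRing CR z = Cmod z.
Proof.
  unfold Cmod; destruct z as [x y].
  change (sqrt (Rabs x ^ 2 + Rabs y ^ 2) = sqrt (x ^ 2 + y ^ 2))%R.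
  now rewrite !pow2_abs.
Qed.

(** The plain epsilon-delta form is independent of the normed module structure put on [C], and lets
    estimates be written with [Cmod] throughout. *)
Lemma is_derive_C_differential (f : C -> C) (z l : C) :
  is_derive (K := C_AbsRing) (V := C_NormedModule) f z l <-> C_differential f z l.
Proof.
  split.
  - intros [_ H] eps He.
    destruct (H z (fun P HP => HP) (mkposreal _ He)) as [d Hd].
    exists d; split; [apply cond_pos|].
    intros w Hw. exact (Hd w Hw).
  - intros H. split; [apply is_linear_scal_l|].
    intros x Hx. replace x with z in *.
    2:{ apply (is_filter_lim_locally_unique (K := C_AbsRing) (V := AbsRing_NormedModule C_AbsRing)); auto. }
    intros eps. destruct (H eps (cond_pos eps)) as [d [Hd H1]].
    exists (mkposreal _ Hd). intros w Hw. exact (H1 w Hw).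
Qed.

(* Coquelicot puts two different normed module structures on [C], and its chain rule needs both. *)
Lemma is_derive_C_differential_AbsRing (f : C -> C) (z l : C) :
  is_derive (K := C_AbsRing) (V := AbsRing_NormedModule C_AbsRing) f z l <-> C_differential f z l.
Proof.
  split.
  - intros [_ H] eps He.
    destruct (H z (fun P HP => HP) (mkposreal _ He)) as [d Hd].
    exists d; split; [apply cond_pos|].
    intros w Hw. exact (Hd w Hw).
  - intros H. split; [apply is_linear_scal_l|].
    intros x Hx. replace x with z in *.
    2:{ apply (is_filter_lim_locally_unique (K := C_AbsRing) (V := AbsRing_NormedModule C_AbsRing)); auto. }
    intros eps. destruct (H eps (cond_pos eps)) as [d [Hd H1]].
    exists (mkposreal _ Hd). intros w Hw. exact (H1 w Hw).
Qed.

Lemma C_differential_comp (f g : C -> C) (z l m : C) :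
  C_differential f (g z) l -> C_differential g z m -> C_differential (fun w => f (g w)) z (l * m).
Proof.
  rewrite <- (is_derive_C_differential f), <- is_derive_C_differential_AbsRing.
  intros Hf Hg. apply is_derive_C_differential. rewrite Cmult_comm.
  exact (is_derive_comp (K := C_AbsRing) (V := C_NormedModule) f g z l m Hf Hg).
Qed.

Lemma C_differential_minus (f g : C -> C) (z l m : C) :
  C_differential f z l -> C_differential g z m -> C_differential (fun w => f w - g w) z (l - m).
Proof. rewrite <- !is_derive_C_differential. exact (is_derive_minus (V := C_NormedModule) f g z l m). Qed.

Lemma path_remainder (g : R -> C) (s t : R) (v : C) :
  minus (minus (g s : CR) (g t)) (scal (minus s t : R_AbsRing) (v : CR)) =
  g s - g t - RtoC (s - t) * v.
Proof.
  destruct (g s), (g t), v. unfold minus, plus, opp, scal; simpl.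
  unfold prod_plus, prod_opp, prod_scal; simpl. unfold plus, opp, scal, mult; simpl.
  unfold Cminus, Cplus, Copp, Cmult, RtoC; simpl. unfold mult; simpl. f_equal; ring.
Qed.

Lemma path_derive_eps (g : R -> C) (t : R) (v : C) :
  path_derive g t v <->
  forall eps : R, (0 < eps)%R -> exists delta : R, (0 < delta)%R /\
    forall s, (Rabs (s - t) < delta)%R ->
      (Cmod (g s - g t - RtoC (s - t) * v) <= eps * Rabs (s - t))%R.
Proof.
  split.
  - intros [_ H] eps He.
    destruct (H t (fun P HP => HP) (mkposreal _ He)) as [d Hd].
    exists d; split; [apply cond_pos|].
    intros s Hs. rewrite <- path_remainder, <- norm_CR. exact (Hd s Hs).
  - intros H. split; [apply is_linear_scal_l|].
    intros x Hx. replace x with t in *.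
    2:{ apply is_filter_lim_locally_unique; auto. }
    intros eps. destruct (H eps (cond_pos eps)) as [d [Hd H1]].
    exists (mkposreal _ Hd). intros s Hs.
    eapply Rle_trans; [right; apply norm_CR|].
    specialize (H1 s Hs). rewrite <- path_remainder in H1. exact H1.
Qed.

Lemma Rabs_Re_le_Cmod (z : C) : (Rabs (Re z) <= Cmod z)%R.
Proof. eapply Rle_trans; [apply Rmax_l|apply Rmax_Cmod]. Qed.

Lemma Rabs_Im_le_Cmod (z : C) : (Rabs (Im z) <= Cmod z)%R.
Proof. eapply Rle_trans; [apply Rmax_r|apply Rmax_Cmod]. Qed.

Lemma Cmod_le_abs_sum (z : C) : (Cmod z <= Rabs (Re z) + Rabs (Im z))%R.
Proof.
  destruct z as [x y]; unfold Cmod, Re, Im; simpl fst; simpl snd.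
  apply Rsqr_incr_0_var; [|pose proof (Rabs_pos x); pose proof (Rabs_pos y); lra].
  rewrite Rsqr_sqrt by nra. unfold Rsqr.
  rewrite <- (pow2_abs x), <- (pow2_abs y).
  pose proof (Rabs_pos x); pose proof (Rabs_pos y); nra.
Qed.

Lemma path_derive_components (g : R -> C) (t : R) (v : C) :
  path_derive g t v <->
  is_derive (fun s => Re (g s)) t (Re v) /\ is_derive (fun s => Im (g s)) t (Im v).
Proof.
  split.
  - intros H. split.
    + exact (filterdiff_comp (V := CR) g (fst : CR -> R) _ _ H
               (filterdiff_linear _ (is_linear_fst))).
    + exact (filterdiff_comp (V := CR) g (snd : CR -> R) _ _ H
               (filterdiff_linear _ (is_linear_snd))).
  - intros [[_ H1] [_ H2]]. apply path_derive_eps. intros eps He.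
    assert (He2 : (0 < eps / 2)%R) by lra.
    destruct (H1 t (fun P HP => HP) (mkposreal _ He2)) as [d1 Hd1].
    destruct (H2 t (fun P HP => HP) (mkposreal _ He2)) as [d2 Hd2].
    exists (Rmin d1 d2). split; [apply Rmin_pos; apply cond_pos|].
    intros s Hs.
    specialize (Hd1 s (Rlt_le_trans _ _ _ Hs (Rmin_l _ _))).
    specialize (Hd2 s (Rlt_le_trans _ _ _ Hs (Rmin_r _ _))).
    simpl in Hd1, Hd2.
    eapply Rle_trans; [apply Cmod_le_abs_sum|].
    change (norm (minus s t)) with (Rabs (s - t)) in *.
    change (Rabs (Re (g s) - Re (g t) - (s - t) * Re v) <= eps / 2 * Rabs (s - t))%R in Hd1.
    change (Rabs (Im (g s) - Im (g t) - (s - t) * Im v) <= eps / 2 * Rabs (s - t))%R in Hd2.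
    replace (Re (g s - g t - RtoC (s - t) * v)) with (Re (g s) - Re (g t) - (s - t) * Re v)%R
      by (unfold Re, Im; simpl; ring).
    replace (Im (g s - g t - RtoC (s - t) * v)) with (Im (g s) - Im (g t) - (s - t) * Im v)%R
      by (unfold Re, Im; simpl; ring).
    lra.
Qed.

Lemma path_derive_ext (f g : R -> C) (t : R) (v : C) :
  (forall s, f s = g s) -> path_derive f t v -> path_derive g t v.
Proof. intros H. now apply is_derive_ext. Qed.

Lemma path_derive_mult (f g : R -> C) (t : R) (u v : C) :
  path_derive f t u -> path_derive g t v ->
  path_derive (fun s => f s * g s) t (u * g t + f t * v).
Proof.
  rewrite !path_derive_components. intros [H1 H2] [H3 H4].
  set (a := fun s => Re (f s)) in *; set (b := fun s => Im (f s)) in *.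
  set (c := fun s => Re (g s)) in *; set (d := fun s => Im (g s)) in *.
  split.
  - change (is_derive (fun s => a s * c s - b s * d s)%R t (Re (u * g t + f t * v))).
    replace (Re (u * g t + f t * v)) with ((Re u * c t + a t * Re v) - (Im u * d t + b t * Im v))%R
      by (unfold a, b, c, d, Re, Im; simpl; ring).
    apply (is_derive_minus (V := R_NormedModule) (fun s => a s * c s)%R (fun s => b s * d s)%R);
    apply (is_derive_mult (K := R_AbsRing)); auto; intros; apply Rmult_comm.
  - change (is_derive (fun s => a s * d s + b s * c s)%R t (Im (u * g t + f t * v))).
    replace (Im (u * g t + f t * v)) with ((Re u * d t + a t * Im v) + (Im u * c t + b t * Re v))%R
      by (unfold a, b, c, d, Re, Im; simpl; ring).
    apply (is_derive_plus (V := R_NormedModule) (fun s => a s * d s)%R (fun s => b s * c s)%R);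
    apply (is_derive_mult (K := R_AbsRing)); auto; intros; apply Rmult_comm.
Qed.

Lemma path_derive_plus (f g : R -> C) (t : R) (u v : C) :
  path_derive f t u -> path_derive g t v -> path_derive (fun s => f s + g s) t (u + v).
Proof. intros H1 H2. exact (is_derive_plus (V := CR) f g t u v H1 H2). Qed.

Lemma path_derive_minus (f g : R -> C) (t : R) (u v : C) :
  path_derive f t u -> path_derive g t v -> path_derive (fun s => f s - g s) t (u - v).
Proof. intros H1 H2. exact (is_derive_minus (V := CR) f g t u v H1 H2). Qed.

Lemma path_derive_const (c : C) (t : R) : path_derive (fun _ => c) t (RtoC 0).
Proof. exact (is_derive_const (V := CR) c t). Qed.

Lemma path_derive_continuous (g : R -> C) (t : R) (v : C) :
  path_derive g t v -> path_continuous g t.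
Proof. intros H. apply (ex_derive_continuous (V := CR)). now exists v. Qed.

Lemma locally_Cmod (z : C) (P : C -> Prop) :
  locally (T := CR) z P <->
  exists eps, (0 < eps)%R /\ forall w, (Cmod (w - z) < eps)%R -> P w.
Proof.
  split.
  - intros H. apply (locally_norm_le_locally (V := CR)) in H. destruct H as [e He].
    exists e. split; [apply cond_pos|]. intros w Hw. apply He.
    unfold ball_norm. now rewrite norm_CR.
  - intros [e [He H]]. apply (locally_le_locally_norm (V := CR)).
    exists (mkposreal _ He). intros w Hw. apply H.
    unfold ball_norm in Hw. now rewrite norm_CR in Hw.
Qed.

Lemma continuous_path_eps (g : R -> C) (t : R) :
  path_continuous g t <->
  forall eps : R, (0 < eps)%R -> exists delta : R, (0 < delta)%R /\
    forall s, (Rabs (s - t) < delta)%R -> (Cmod (g s - g t) < eps)%R.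
Proof.
  split.
  - intros H eps He.
    destruct (H (fun z => (Cmod (z - g t) < eps)%R)) as [d Hd]; [apply locally_Cmod; now exists eps|].
    exists d; split; [apply cond_pos|]. intros s Hs. now apply Hd.
  - intros H P HP. apply locally_Cmod in HP. destruct HP as [e [He HP]].
    destruct (H e He) as [d [Hd H1]]. exists (mkposreal _ Hd). intros s Hs. now apply HP, H1.
Qed.

Lemma continuous_path_minus (f g : R -> C) (t : R) :
  path_continuous f t -> path_continuous g t ->
  path_continuous (fun s => f s - g s) t.
Proof. intros Hf Hg. exact (continuous_minus (V := CR) f g t Hf Hg). Qed.

Lemma C_differential_Lipschitz (f : C -> C) (z l : C) :
  C_differential f z l -> exists delta : R, (0 < delta)%R /\
    forall w, (Cmod (w - z) < delta)%R ->
      (Cmod (f w - f z) <= (Cmod l + 1) * Cmod (w - z))%R.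
Proof.
  intros H. destruct (H 1%R Rlt_0_1) as [d [Hd H1]].
  exists d; split; auto. intros w Hw. specialize (H1 w Hw).
  replace (f w - f z) with ((f w - f z - (w - z) * l) + (w - z) * l) by ring.
  eapply Rle_trans; [apply Cmod_triangle|]. rewrite Cmod_mult. lra.
Qed.

Lemma continuous_comp_path (f : C -> C) (g : R -> C) (t : R) (l : C) :
  C_differential f (g t) l -> path_continuous g t ->
  path_continuous (fun s => f (g s)) t.
Proof.
  rewrite !continuous_path_eps. intros Hf Hg eps He.
  destruct (C_differential_Lipschitz _ _ _ Hf) as [d [Hd H1]].
  pose proof (Cmod_ge_0 l).
  assert (Hp : (0 < Rmin d (eps / (Cmod l + 1)))%R).
  { apply Rmin_pos; auto. apply Rdiv_lt_0_compat; lra. }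
  destruct (Hg _ Hp) as [d' [Hd' H2]]. exists d'; split; auto.
  intros s Hs. specialize (H2 s Hs).
  bounds_Rmin d (eps / (Cmod l + 1))%R.
  eapply Rle_lt_trans; [apply H1; lra|].
  apply Rlt_le_trans with ((Cmod l + 1) * (eps / (Cmod l + 1)))%R.
  - apply Rmult_lt_compat_l; lra.
  - right; field; lra.
Qed.

(** A chain rule across two scalar fields: [f] is differentiable over the complex numbers, [g] over
    the reals. The remainder of the composite is the remainder of [f] plus [l] times the remainder
    of [g]. *)
Lemma path_derive_comp (f : C -> C) (g : R -> C) (t : R) (l v : C) :
  C_differential f (g t) l -> path_derive g t v ->
  path_derive (fun s => f (g s)) t (l * v).
Proof.
  intros Hf Hg. apply path_derive_eps. intros eps He.
  pose proof (Cmod_ge_0 v) as Hv. pose proof (Cmod_ge_0 l) as Hl.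
  set (e1 := (eps / (2 * (Cmod v + 1)))%R).
  (* The minimum with 1 bounds the increment of [g] by [(Cmod v + 1) * h], which is the factor that
     [e1] compensates; each remainder then contributes at most [eps / 2 * h]. *)
  set (e2 := Rmin 1 (eps / (2 * (Cmod l + 1)))).
  assert (He1 : (0 < e1)%R) by (apply Rdiv_lt_0_compat; lra).
  assert (He2 : (0 < e2)%R) by (apply Rmin_pos; [lra|apply Rdiv_lt_0_compat; lra]).
  destruct (Hf e1 He1) as [d1 [Hd1 H1]].
  destruct (proj1 (path_derive_eps _ _ _) Hg e2 He2) as [d2 [Hd2 H2]].
  destruct (proj1 (continuous_path_eps _ _) (path_derive_continuous _ _ _ Hg) d1 Hd1)
    as [d3 [Hd3 H3]].
  exists (Rmin d2 d3). split; [now apply Rmin_pos|]. intros s Hs.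
  pose proof (Rmin_l d2 d3); pose proof (Rmin_r d2 d3).
  specialize (H2 s ltac:(lra)). specialize (H3 s ltac:(lra)).
  specialize (H1 _ H3). set (h := Rabs (s - t)) in *.
  assert (Hh : (0 <= h)%R) by apply Rabs_pos.
  assert (Hw : (Cmod (g s - g t) <= (Cmod v + 1) * h)%R).
  { replace (g s - g t) with ((g s - g t - RtoC (s - t) * v) + RtoC (s - t) * v) by ring.
    eapply Rle_trans; [apply Cmod_triangle|]. rewrite Cmod_mult, Cmod_R. fold h.
    assert (e2 <= 1)%R by apply Rmin_l. nra. }
  replace (f (g s) - f (g t) - RtoC (s - t) * (l * v)) with
    ((f (g s) - f (g t) - (g s - g t) * l) + (g s - g t - RtoC (s - t) * v) * l) by ring.
  eapply Rle_trans; [apply Cmod_triangle|]. rewrite Cmod_mult.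
  assert (A1 : (e1 * Cmod (g s - g t) <= eps / 2 * h)%R).
  { apply Rle_trans with (e1 * ((Cmod v + 1) * h))%R; [apply Rmult_le_compat_l; lra|].
    right; unfold e1; field; lra. }
  assert (A2 : (Cmod (g s - g t - RtoC (s - t) * v) * Cmod l <= eps / 2 * h)%R).
  { apply Rle_trans with (e2 * h * Cmod l)%R; [apply Rmult_le_compat_r; lra|].
    assert (e2 * (Cmod l + 1) <= eps / 2)%R.
    { apply Rle_trans with (eps / (2 * (Cmod l + 1)) * (Cmod l + 1))%R.
      - apply Rmult_le_compat_r; [lra|apply Rmin_r].
      - right; field; lra. }
    nra. }
  lra.
Qed.

(** * Integrals of complex valued functions *)

Lemma is_CInt_components (f : R -> C) (a b : R) (l : C) :
  is_CInt f a b l <->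
  is_RInt (fun x => Re (f x)) a b (Re l) /\ is_RInt (fun x => Im (f x)) a b (Im l).
Proof.
  split.
  - intros H. split.
    + exact (is_RInt_fct_extend_fst (U := R_NormedModule) (V := R_NormedModule) f a b l H).
    + exact (is_RInt_fct_extend_snd (U := R_NormedModule) (V := R_NormedModule) f a b l H).
  - intros [H1 H2]. destruct l as [l1 l2].
    exact (is_RInt_fct_extend_pair (U := R_NormedModule) (V := R_NormedModule) f a b l1 l2 H1 H2).
Qed.

Lemma is_CInt_unique (f : R -> C) (a b : R) (l m : C) :
  is_CInt f a b l -> is_CInt f a b m -> l = m.
Proof.
  rewrite !is_CInt_components. intros [H1 H2] [H3 H4].
  apply (is_RInt_unique (V := R_CompleteNormedModule)) in H1, H2, H3, H4.
  destruct l, m; simpl in *; congruence.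
Qed.

Lemma is_CInt_lin (c : C) (f g : R -> C) (a b : R) (l m : C) :
  is_CInt f a b l -> is_CInt g a b m ->
  is_CInt (fun x => c * f x + g x) a b (c * l + m).
Proof.
  rewrite !is_CInt_components. intros [H1 H2] [H3 H4]. split.
  - apply (is_RInt_plus (V := R_NormedModule)
      (fun x => Re c * Re (f x) - Im c * Im (f x))%R (fun x => Re (g x))); auto.
    apply (is_RInt_minus (V := R_NormedModule)
      (fun x => Re c * Re (f x))%R (fun x => Im c * Im (f x))%R);
    now apply (is_RInt_scal (V := R_NormedModule)).
  - apply (is_RInt_plus (V := R_NormedModule)
      (fun x => Re c * Im (f x) + Im c * Re (f x))%R (fun x => Im (g x))); auto.
    apply (is_RInt_plus (V := R_NormedModule)
      (fun x => Re c * Im (f x))%R (fun x => Im c * Re (f x))%R);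
    now apply (is_RInt_scal (V := R_NormedModule)).
Qed.

Lemma is_CInt_zero (a b : R) : is_CInt (fun _ => RtoC 0) a b (RtoC 0).
Proof.
  pose proof (is_RInt_const (V := CR) a b (zero : CR)) as H.
  rewrite (scal_zero_r (V := CR)) in H. exact H.
Qed.

Lemma is_CInt_ext (f g : R -> C) (a b : R) (l : C) :
  (forall x, (Rmin a b < x < Rmax a b)%R -> f x = g x) ->
  is_CInt f a b l -> is_CInt g a b l.
Proof. intros H. exact (is_RInt_ext (V := CR) f g a b l H). Qed.

Lemma is_CInt_scal (c : C) (f : R -> C) (a b : R) (l : C) :
  is_CInt f a b l -> is_CInt (fun x => c * f x) a b (c * l).
Proof.
  intros H. replace (c * l) with (c * l + 0) by ring.
  apply is_CInt_ext with (fun x => c * f x + 0); [intros; ring|].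
  apply (is_CInt_lin c f (fun _ => RtoC 0)); auto. apply is_CInt_zero.
Qed.

Lemma is_CInt_minus (f g : R -> C) (a b : R) (l m : C) :
  is_CInt f a b l -> is_CInt g a b m -> is_CInt (fun x => f x - g x) a b (l - m).
Proof. intros H1 H2. exact (is_RInt_minus (V := CR) f g a b l m H1 H2). Qed.

Lemma is_CInt_Chasles (f : R -> C) (a b c : R) (l m : C) :
  is_CInt f a b l -> is_CInt f b c m -> is_CInt f a c (l + m).
Proof. intros H1 H2. exact (is_RInt_Chasles (V := CR) f a b c l m H1 H2). Qed.

Lemma is_CInt_swap (f : R -> C) (a b : R) (l : C) : is_CInt f b a l -> is_CInt f a b (- l).
Proof. intros H. exact (is_RInt_swap (V := CR) f a b l H). Qed.

Lemma ex_CInt_continuous (f : R -> C) (a b : R) :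
  (forall x, (Rmin a b <= x <= Rmax a b)%R -> path_continuous f x) ->
  exists l : C, is_CInt f a b l.
Proof. intros H. exact (ex_RInt_continuous (V := C_R_CompleteNormedModule) f a b H). Qed.

Lemma is_CInt_derive (f df : R -> C) (a b : R) :
  (forall x, (Rmin a b <= x <= Rmax a b)%R -> path_derive f x (df x)) ->
  (forall x, (Rmin a b <= x <= Rmax a b)%R -> path_continuous df x) ->
  is_CInt df a b (f b - f a).
Proof. intros H1 H2. exact (is_RInt_derive (V := C_R_CompleteNormedModule) f df a b H1 H2). Qed.

Lemma is_CInt_le_RInt (f : R -> C) (g : R -> R) (a b : R) (l : C) (m : R) :
  (a <= b)%R -> (forall x, (a <= x <= b)%R -> (Cmod (f x) <= g x)%R) ->
  is_CInt f a b l -> is_RInt g a b m -> (Cmod l <= m)%R.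
Proof.
  intros Hab H Hf Hg. rewrite <- norm_CR.
  apply (norm_RInt_le (V := CR) f g a b l m); auto.
  intros x Hx. rewrite norm_CR. auto.
Qed.

Lemma is_CInt_le (f : R -> C) (a b : R) (l : C) (M : R) :
  (a <= b)%R -> (forall x, (a <= x <= b)%R -> (Cmod (f x) <= M)%R) ->
  is_CInt f a b l -> (Cmod l <= (b - a) * M)%R.
Proof.
  intros Hab H Hf. apply (is_CInt_le_RInt f (fun _ => M) a b); auto.
  exact (is_RInt_const (V := R_NormedModule) a b M).
Qed.

(** A mean value inequality with a variable majorant. Near the axis the derivatives blow up like a
    power of the height, and only the integral of that power gives a useful bound. *)
Lemma path_increment_le (f df : R -> C) (G dG : R -> R) (a b : R) :
  (a <= b)%R ->
  (forall x, (a <= x <= b)%R -> path_derive f x (df x)) ->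
  (forall x, (a <= x <= b)%R -> path_continuous df x) ->
  (forall x, (a <= x <= b)%R -> is_derive G x (dG x)) ->
  (forall x, (a <= x <= b)%R -> continuous dG x) ->
  (forall x, (a <= x <= b)%R -> (Cmod (df x) <= dG x)%R) ->
  (Cmod (f b - f a) <= G b - G a)%R.
Proof.
  intros Hab H1 H2 H3 H4 H5.
  apply (is_CInt_le_RInt df dG a b); auto.
  - apply is_CInt_derive; rewrite Rmin_left, Rmax_right; auto.
  - apply (is_RInt_derive (V := R_CompleteNormedModule)); rewrite Rmin_left, Rmax_right; auto.
Qed.

Definition CInt (f : R -> C) (a b : R) : C := RInt (V := C_R_CompleteNormedModule) f a b.

(** Intervals without a prescribed order of the end points: contour integrals are also taken over
    rectangles whose sides are traversed backwards. *)
Definition between (a b x : R) : Prop := (Rmin a b <= x <= Rmax a b)%R.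

Lemma CInt_correct (f : R -> C) (a b : R) :
  (forall x, between a b x -> path_continuous f x) -> is_CInt f a b (CInt f a b).
Proof.
  intros H. apply (RInt_correct (V := C_R_CompleteNormedModule)).
  destruct (ex_CInt_continuous f a b H) as [l Hl]. now exists l.
Qed.

Lemma CInt_unique (f : R -> C) (a b : R) (l : C) : is_CInt f a b l -> CInt f a b = l.
Proof. exact (is_RInt_unique (V := C_R_CompleteNormedModule) f a b l). Qed.

Lemma horizontal_derive (y x : R) : path_derive (fun t => (t, y)) x (RtoC 1).
Proof.
  apply path_derive_components; split; simpl.
  - exact (is_derive_id (K := R_AbsRing) x).
  - exact (is_derive_const (K := R_AbsRing) (V := R_NormedModule) y x).
Qed.

Lemma vertical_derive (x y : R) : path_derive (fun s => (x, s)) y Ci.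
Proof.
  apply path_derive_components; split; simpl.
  - exact (is_derive_const (K := R_AbsRing) (V := R_NormedModule) x y).
  - exact (is_derive_id (K := R_AbsRing) y).
Qed.

Lemma horizontal_continuous (f : C -> C) (x y : R) (l : C) :
  C_differential f (x, y) l -> path_continuous (fun t => f (t, y)) x.
Proof.
  intros H. apply (continuous_comp_path f (fun t => (t, y)) x l H).
  exact (path_derive_continuous _ _ _ (horizontal_derive y x)).
Qed.

Lemma vertical_continuous (f : C -> C) (x y : R) (l : C) :
  C_differential f (x, y) l -> path_continuous (fun s => f (x, s)) y.
Proof.
  intros H. apply (continuous_comp_path f (fun s => (x, s)) y l H).
  exact (path_derive_continuous _ _ _ (vertical_derive x y)).
Qed.

(** * Goursat's theorem on rectangles *)

Definition differentiable_on (S : C -> Prop) (f : C -> C) : Prop :=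
  forall z, S z -> exists l, C_differential f z l.

Definition box (a b c d : R) (z : C) : Prop := between a b (Re z) /\ between c d (Im z).

(** The counterclockwise contour integral; the factor [Ci] is dz/dy on the vertical sides. *)
Definition boundary_integral (f : C -> C) (a b c d : R) : C :=
  CInt (fun x => f (x, c)) a b - CInt (fun x => f (x, d)) a b +
  Ci * (CInt (fun y => f (b, y)) c d - CInt (fun y => f (a, y)) c d).

Lemma between_l (a b : R) : between a b a.
Proof. split; [apply Rmin_l|apply Rmax_l]. Qed.

Lemma between_r (a b : R) : between a b b.
Proof. split; [apply Rmin_r|apply Rmax_r]. Qed.

Lemma horizontal_correct (f : C -> C) (a b c d y : R) :
  differentiable_on (box a b c d) f -> between c d y ->
  is_CInt (fun x => f (x, y)) a b (CInt (fun x => f (x, y)) a b).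
Proof.
  intros H Hy. apply CInt_correct. intros x Hx.
  destruct (H (x, y) (conj Hx Hy)) as [l Hl]. now apply horizontal_continuous with l.
Qed.

Lemma vertical_correct (f : C -> C) (a b c d x : R) :
  differentiable_on (box a b c d) f -> between a b x ->
  is_CInt (fun y => f (x, y)) c d (CInt (fun y => f (x, y)) c d).
Proof.
  intros H Hx. apply CInt_correct. intros y Hy.
  destruct (H (x, y) (conj Hx Hy)) as [l Hl]. now apply vertical_continuous with l.
Qed.

Lemma Ci_square : Ci * Ci = - RtoC 1.
Proof. unfold Ci, Cmult, RtoC, Copp; simpl; f_equal; ring. Qed.

(** Each side contributes the difference of [F] at its two corners, and these telescope around the
    rectangle. *)
Lemma boundary_integral_derive (F f : C -> C) (a b c d : R) :
  (forall z, box a b c d z -> C_differential F z (f z)) ->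
  differentiable_on (box a b c d) f -> boundary_integral f a b c d = 0.
Proof.
  intros HF Hf.
  assert (Hh : forall y, between c d y -> CInt (fun x => f (x, y)) a b = F (b, y) - F (a, y)).
  { intros y Hy. apply CInt_unique.
    apply is_CInt_derive with (f := fun x => F (x, y)); intros x Hx.
    - replace (f (x, y)) with (f (x, y) * 1) by ring.
      apply (path_derive_comp F (fun t => (t, y))); [now apply HF; split|apply horizontal_derive].
    - destruct (Hf (x, y) (conj Hx Hy)) as [l Hl]. now apply horizontal_continuous with l. }
  assert (Hv : forall x, between a b x -> Ci * CInt (fun y => f (x, y)) c d = F (x, d) - F (x, c)).
  { intros x Hx.
    replace (F (x, d) - F (x, c)) with (Ci * (- Ci * F (x, d) - - Ci * F (x, c))).
    2:{ transitivity (- (Ci * Ci) * (F (x, d) - F (x, c))); [ring|].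
        rewrite Ci_square; ring. }
    f_equal. apply CInt_unique.
    (* Along a vertical line [F] has derivative [Ci * f], so [- Ci * F] is the primitive of [f]. *)
    apply is_CInt_derive with (f := fun y => - Ci * F (x, y)); intros y Hy.
    - replace (f (x, y)) with (0 * F (x, y) + - Ci * (f (x, y) * Ci)).
      2:{ transitivity (- (Ci * Ci) * f (x, y)); [ring|].
          rewrite Ci_square; ring. }
      apply (path_derive_mult (fun _ => - Ci)); [apply path_derive_const|].
      apply (path_derive_comp F (fun t => (x, t))); [now apply HF; split|apply vertical_derive].
    - destruct (Hf (x, y) (conj Hx Hy)) as [l Hl]. now apply vertical_continuous with l. }
  transitivity (CInt (fun x => f (x, c)) a b - CInt (fun x => f (x, d)) a b +
    (Ci * CInt (fun y => f (b, y)) c d - Ci * CInt (fun y => f (a, y)) c d)).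
  { unfold boundary_integral; ring. }
  rewrite !Hh, !Hv by (apply between_l || apply between_r). ring.
Qed.

Lemma CInt_minus (f g : R -> C) (a b : R) :
  is_CInt f a b (CInt f a b) -> is_CInt g a b (CInt g a b) ->
  CInt (fun x => f x - g x) a b = CInt f a b - CInt g a b.
Proof. intros H1 H2. apply CInt_unique. now apply is_CInt_minus. Qed.

Lemma boundary_integral_minus (f g : C -> C) (a b c d : R) :
  differentiable_on (box a b c d) f -> differentiable_on (box a b c d) g ->
  boundary_integral (fun z => f z - g z) a b c d =
  boundary_integral f a b c d - boundary_integral g a b c d.
Proof.
  intros Hf Hg.
  assert (Hh : forall y, between c d y -> CInt (fun x => f (x, y) - g (x, y)) a b =
    CInt (fun x => f (x, y)) a b - CInt (fun x => g (x, y)) a b).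
  { intros y Hy. apply CInt_minus; now apply horizontal_correct with c d. }
  assert (Hv : forall x, between a b x -> CInt (fun y => f (x, y) - g (x, y)) c d =
    CInt (fun y => f (x, y)) c d - CInt (fun y => g (x, y)) c d).
  { intros x Hx. apply CInt_minus; now apply vertical_correct with a b. }
  unfold boundary_integral.
  rewrite (Hh c (between_l _ _)), (Hh d (between_r _ _)),
    (Hv a (between_l _ _)), (Hv b (between_r _ _)).
  ring.
Qed.

Lemma Cmod_Ci : Cmod Ci = 1%R.
Proof. transitivity (sqrt 1); [unfold Cmod; simpl; f_equal; ring|apply sqrt_1]. Qed.

(** Supplies a primitive of the first-order approximation of a function at [z0], whose boundary
    integral therefore vanishes. *)
Lemma C_differential_square (al l z0 z : C) :
  C_differential (fun w => al * w + l * (w - z0) * (w - z0) / 2) z (al + (z - z0) * l).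
Proof.
  intros eps He. pose proof (Cmod_ge_0 l).
  exists (eps / (Cmod l + 1))%R. split; [apply Rdiv_lt_0_compat; lra|].
  intros w Hw.
  replace (al * w + l * (w - z0) * (w - z0) / 2 - (al * z + l * (z - z0) * (z - z0) / 2) -
    (w - z) * (al + (z - z0) * l)) with ((l * (w - z) / 2) * (w - z)).
  2:{ field. }
  rewrite Cmod_mult. apply Rmult_le_compat_r; [apply Cmod_ge_0|].
  rewrite Cmod_div, Cmod_mult, Cmod_R, Rabs_pos_eq by
    (try (intros E; apply RtoC_inj in E; lra); lra).
  assert (Cmod (w - z) * (Cmod l + 1) <= eps)%R.
  { apply Rle_trans with (eps / (Cmod l + 1) * (Cmod l + 1))%R.
    - apply Rmult_le_compat_r; lra.
    - right; field; lra. }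
  pose proof (Cmod_ge_0 (w - z)). nra.
Qed.

Lemma C_differential_affine (al l z0 z : C) :
  C_differential (fun w => al + (w - z0) * l) z l.
Proof.
  intros eps He. exists 1%R. split; [lra|]. intros w Hw.
  replace (al + (w - z0) * l - (al + (z - z0) * l) - (w - z) * l) with (RtoC 0) by ring.
  rewrite Cmod_0. pose proof (Cmod_ge_0 (w - z)). nra.
Qed.

Lemma boundary_integral_le (f : C -> C) (a b c d M : R) :
  (a <= b)%R -> (c <= d)%R -> differentiable_on (box a b c d) f ->
  (forall z, box a b c d z -> (Cmod (f z) <= M)%R) ->
  (Cmod (boundary_integral f a b c d) <= 2 * ((b - a) + (d - c)) * M)%R.
Proof.
  intros Hab Hcd Hf HM. unfold boundary_integral.
  assert (Hh : forall y, between c d y -> (Cmod (CInt (fun x => f (x, y)) a b) <= (b - a) * M)%R).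
  { intros y Hy. apply is_CInt_le with (fun x => f (x, y)); auto.
    - intros x Hx. apply HM. split; auto. simpl. split; [rewrite Rmin_left|rewrite Rmax_right]; lra.
    - now apply horizontal_correct with c d. }
  assert (Hv : forall x, between a b x -> (Cmod (CInt (fun y => f (x, y)) c d) <= (d - c) * M)%R).
  { intros x Hx. apply is_CInt_le with (fun y => f (x, y)); auto.
    - intros y Hy. apply HM. split; auto. simpl. split; [rewrite Rmin_left|rewrite Rmax_right]; lra.
    - now apply vertical_correct with a b. }
  eapply Rle_trans; [apply Cmod_triangle|]. rewrite Cmod_mult, Cmod_Ci.
  unfold Cminus.
  pose proof (Cmod_triangle (CInt (fun x => f (x, c)) a b) (- CInt (fun x => f (x, d)) a b)) as T1.
  pose proof (Cmod_triangle (CInt (fun y => f (b, y)) c d) (- CInt (fun y => f (a, y)) c d)) as T2.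
  rewrite Cmod_opp in T1, T2.
  pose proof (Hh c (between_l _ _)). pose proof (Hh d (between_r _ _)).
  pose proof (Hv a (between_l _ _)). pose proof (Hv b (between_r _ _)).
  lra.
Qed.

(* Goursat's local estimate: an affine function has a primitive, and the remainder is small
   compared with the size of the box. *)
Lemma boundary_integral_local (f : C -> C) (z0 : C) (eps : R) :
  (exists l, C_differential f z0 l) -> (0 < eps)%R ->
  exists delta, (0 < delta)%R /\ forall a b c d,
    (a <= b)%R -> (c <= d)%R -> differentiable_on (box a b c d) f -> box a b c d z0 ->
    (b - a < delta)%R -> (d - c < delta)%R ->
    (Cmod (boundary_integral f a b c d) <= eps * ((b - a) + (d - c)) ^ 2)%R.
Proof.
  intros [l Hl] He. destruct (Hl (eps / 2)%R ltac:(lra)) as [dl [Hdl H1]].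
  exists (dl / 2)%R. split; [lra|]. intros a b c d Hab Hcd Hf [Hx0 Hy0] Hba Hdc.
  unfold between in Hx0, Hy0. rewrite Rmin_left, Rmax_right in Hx0, Hy0 by assumption.
  set (g := fun w => f z0 + (w - z0) * l).
  assert (Hg : differentiable_on (box a b c d) g).
  { intros z _. exists l. apply C_differential_affine. }
  assert (Hg0 : boundary_integral g a b c d = 0).
  { apply boundary_integral_derive with
      (fun w => f z0 * w + l * (w - z0) * (w - z0) / 2); auto.
    intros z _. apply C_differential_square. }
  replace (boundary_integral f a b c d) with (boundary_integral (fun z => f z - g z) a b c d).
  2:{ rewrite boundary_integral_minus, Hg0 by auto. ring. }
  replace (eps * (b - a + (d - c)) ^ 2)%R with
    (2 * ((b - a) + (d - c)) * (eps / 2 * ((b - a) + (d - c))))%R by field.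
  apply boundary_integral_le; auto.
  - intros z Hz. destruct (Hf z Hz) as [m Hm]. exists (m - l).
    apply C_differential_minus; auto. apply C_differential_affine.
  - intros z [Hx Hy]. unfold between in Hx, Hy.
    rewrite Rmin_left, Rmax_right in Hx, Hy by assumption.
    assert (Hd : (Cmod (z - z0) <= (b - a) + (d - c))%R).
    { eapply Rle_trans; [apply Cmod_le_abs_sum|].
      apply Rplus_le_compat; apply Rabs_le; destruct z, z0; unfold Re, Im in *; simpl in *; lra. }
    unfold g. replace (f z - (f z0 + (z - z0) * l)) with (f z - f z0 - (z - z0) * l) by ring.
    eapply Rle_trans; [apply H1; lra|]. apply Rmult_le_compat_l; lra.
Qed.

(** Every left end point lies below every right end point, so the supremum of the left ones belongs
    to all the intervals. *)
Lemma nested_intervals (a b : nat -> R) :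
  (forall n, (a n <= a (S n))%R) -> (forall n, (b (S n) <= b n)%R) ->
  (forall n, (a n <= b n)%R) -> exists x, forall n, (a n <= x <= b n)%R.
Proof.
  intros Ha Hb Hab.
  assert (Ha' : forall n k, (a n <= a (n + k)%nat)%R).
  { intros n k; induction k; [rewrite Nat.add_0_r; lra|].
    rewrite Nat.add_succ_r. specialize (Ha (n + k)%nat). lra. }
  assert (Hb' : forall n k, (b (n + k)%nat <= b n)%R).
  { intros n k; induction k; [rewrite Nat.add_0_r; lra|].
    rewrite Nat.add_succ_r. specialize (Hb (n + k)%nat). lra. }
  assert (H : forall n m, (a n <= b m)%R).
  { intros n m. specialize (Ha' n m); specialize (Hb' m n); specialize (Hab (n + m)%nat).
    rewrite Nat.add_comm in Hb'. lra. }
  destruct (completeness (fun x => exists n, x = a n)) as [x [H1 H2]].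
  - exists (b O). intros x [n ->]. apply H.
  - now exists (a O), O.
  - exists x. intros n. split; [apply H1; now exists n|].
    apply H2. intros y [m ->]. apply H.
Qed.

Section Bisection.
Local Open Scope R_scope.

Variable P : R -> R -> R -> R -> Prop.
Variables a0 b0 c0 d0 : R.
Hypotheses (Hab0 : a0 <= b0) (Hcd0 : c0 <= d0).

Let sub a b c d := a0 <= a /\ a <= b /\ b <= b0 /\ c0 <= c /\ c <= d /\ d <= d0.

Hypothesis P_split : forall a b c d, sub a b c d ->
  let m := (a + b) / 2 in let n := (c + d) / 2 in
  P a m c n -> P m b c n -> P a m n d -> P m b n d -> P a b c d.

Hypothesis P_local : forall x y, a0 <= x <= b0 -> c0 <= y <= d0 ->
  exists delta, 0 < delta /\ forall a b c d, sub a b c d ->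
    a <= x <= b -> c <= y <= d -> b - a < delta -> d - c < delta -> P a b c d.

Let bad (r : (R * R) * (R * R)) : Prop :=
  sub (fst (fst r)) (snd (fst r)) (fst (snd r)) (snd (snd r)) /\
  ~ P (fst (fst r)) (snd (fst r)) (fst (snd r)) (snd (snd r)).

Let half (i j : R * R) : Prop :=
  fst i <= fst j /\ snd j <= snd i /\ snd j - fst j = (snd i - fst i) / 2.

Lemma bad_quarter r : bad r -> exists r', bad r' /\ half (fst r) (fst r') /\ half (snd r) (snd r').
Proof.
  destruct r as [[a b] [c d]]. intros [Hs HP]. simpl in *.
  set (m := (a + b) / 2). set (n := (c + d) / 2).
  apply NNPP. intros Hn. apply HP. unfold sub in Hs.
  apply P_split; [exact Hs|..]; fold m n; apply NNPP; intros HQ; apply Hn.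
  1: exists ((a, m), (c, n)). 2: exists ((m, b), (c, n)).
  3: exists ((a, m), (n, d)). 4: exists ((m, b), (n, d)).
  all: unfold bad, half, sub, m, n in *; simpl; repeat split; try lra; auto.
Qed.

(** If [P] failed, bad rectangles could be quartered forever; they shrink to a point, where
    [P_local] gives a contradiction. The property is left abstract because the principle serves
    twice: for Goursat's theorem, and on a rectangle of height 0 as the compactness of an
    interval. *)
Lemma bisection : P a0 b0 c0 d0.
Proof.
  apply NNPP. intros HP.
  set (next := fun r => epsilon (inhabits r)
    (fun r' => bad r' /\ half (fst r) (fst r') /\ half (snd r) (snd r'))).
  set (u := fun n : nat => Nat.iter n next ((a0, b0), (c0, d0))).
  assert (Hbad : forall n, bad (u n)).
  { induction n; [unfold bad, sub; simpl; repeat split; auto; lra|].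
    simpl. now destruct (epsilon_spec (inhabits (u n)) _ (bad_quarter _ IHn)). }
  assert (Hnext : forall n, half (fst (u n)) (fst (u (S n))) /\ half (snd (u n)) (snd (u (S n)))).
  { intros n. now destruct (epsilon_spec (inhabits (u n)) _ (bad_quarter _ (Hbad n))). }
  assert (Hw : forall n, snd (fst (u n)) - fst (fst (u n)) = (b0 - a0) * (/ 2) ^ n /\
                         snd (snd (u n)) - fst (snd (u n)) = (d0 - c0) * (/ 2) ^ n).
  { induction n; [simpl; lra|].
    destruct (Hnext n) as [[_ [_ H1]] [_ [_ H2]]]. simpl pow. rewrite H1, H2. lra. }
  destruct (nested_intervals (fun n => fst (fst (u n))) (fun n => snd (fst (u n)))) as [x Hx].
  { intros n; apply (Hnext n). } { intros n; apply (Hnext n). }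
  { intros n; destruct (Hbad n) as [H _]; unfold sub in H; lra. }
  destruct (nested_intervals (fun n => fst (snd (u n))) (fun n => snd (snd (u n)))) as [y Hy].
  { intros n; apply (Hnext n). } { intros n; apply (Hnext n). }
  { intros n; destruct (Hbad n) as [H _]; unfold sub in H; lra. }
  destruct (P_local x y (Hx O) (Hy O)) as [dl [Hdl H]].
  (* The summand 1 keeps the denominator positive for a degenerate rectangle. *)
  assert (He : 0 < dl / (b0 - a0 + (d0 - c0) + 1)) by (apply Rdiv_lt_0_compat; lra).
  destruct (pow_lt_1_zero (/ 2) ltac:(rewrite Rabs_pos_eq; lra) _ He) as [n Hn].
  specialize (Hn n (le_n _)). rewrite Rabs_pos_eq in Hn by (apply pow_le; lra).
  assert (Hs : (b0 - a0 + (d0 - c0) + 1) * (/ 2) ^ n < dl).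
  { apply Rlt_le_trans with ((b0 - a0 + (d0 - c0) + 1) * (dl / (b0 - a0 + (d0 - c0) + 1))).
    - apply Rmult_lt_compat_l; lra.
    - right; field; lra. }
  assert (Hp : 0 < (/ 2) ^ n) by (apply pow_lt; lra).
  destruct (Hbad n) as [H1 H2]. destruct (Hw n) as [E1 E2].
  apply H2, H; [exact H1|apply Hx|apply Hy| |]; rewrite ?E1, ?E2; nra.
Qed.
End Bisection.

Lemma box_sub (a b c d a' b' c' d' : R) (z : C) :
  (a <= a')%R -> (a' <= b')%R -> (b' <= b)%R -> (c <= c')%R -> (c' <= d')%R -> (d' <= d)%R ->
  box a' b' c' d' z -> box a b c d z.
Proof.
  unfold box, between. intros.
  rewrite !Rmin_left, !Rmax_right in * by lra. lra.
Qed.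

Lemma CInt_Chasles_continuous (f : R -> C) (a b c : R) :
  (a <= b <= c)%R -> (forall x, (a <= x <= c)%R -> path_continuous f x) ->
  CInt f a c = CInt f a b + CInt f b c.
Proof.
  intros Hab H. apply CInt_unique, is_CInt_Chasles with b; apply CInt_correct; intros x [H1 H2];
  rewrite Rmin_left in H1 by lra; rewrite Rmax_right in H2 by lra; apply H; lra.
Qed.

Lemma boundary_integral_split (f : C -> C) (a b c d m n : R) :
  (a <= m <= b)%R -> (c <= n <= d)%R -> differentiable_on (box a b c d) f ->
  boundary_integral f a b c d =
  boundary_integral f a m c n + boundary_integral f m b c n +
  boundary_integral f a m n d + boundary_integral f m b n d.
Proof.
  intros Hm Hn Hf. unfold boundary_integral.
  assert (Hh : forall y, (c <= y <= d)%R ->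
    CInt (fun x => f (x, y)) a b = CInt (fun x => f (x, y)) a m + CInt (fun x => f (x, y)) m b).
  { intros y Hy. apply CInt_Chasles_continuous; auto. intros x Hx.
    destruct (Hf (x, y)) as [l Hl]; [|now apply horizontal_continuous with l].
    unfold box, between; simpl. rewrite !Rmin_left, !Rmax_right by lra. lra. }
  assert (Hv : forall x, (a <= x <= b)%R ->
    CInt (fun y => f (x, y)) c d = CInt (fun y => f (x, y)) c n + CInt (fun y => f (x, y)) n d).
  { intros x Hx. apply CInt_Chasles_continuous; auto. intros y Hy.
    destruct (Hf (x, y)) as [l Hl]; [|now apply vertical_continuous with l].
    unfold box, between; simpl. rewrite !Rmin_left, !Rmax_right by lra. lra. }
  rewrite (Hh c), (Hh d), (Hv a), (Hv b) by lra. ring.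
Qed.

Lemma Goursat (f : C -> C) (a b c d : R) :
  (a <= b)%R -> (c <= d)%R -> differentiable_on (box a b c d) f ->
  boundary_integral f a b c d = 0.
Proof.
  intros Hab Hcd Hf.
  assert (H : forall eps, (0 < eps)%R ->
    (Cmod (boundary_integral f a b c d) <= eps * ((b - a) + (d - c)) ^ 2)%R).
  { intros eps He.
    (* The bound is compatible with quartering: a quarter has half the side lengths, so its squared
       term is a quarter of the original one, and the four bounds add up exactly. *)
    apply (bisection (fun a b c d =>
      (Cmod (boundary_integral f a b c d) <= eps * ((b - a) + (d - c)) ^ 2)%R)); auto.
    - intros a' b' c' d' Hs m n H1 H2 H3 H4.
      rewrite (boundary_integral_split f a' b' c' d' m n).
      + set (p := boundary_integral f a' m c' n) in *.
        set (q := boundary_integral f m b' c' n) in *.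
        set (r := boundary_integral f a' m n d') in *.
        set (t := boundary_integral f m b' n d') in *.
        pose proof (Cmod_triangle (p + q + r) t). pose proof (Cmod_triangle (p + q) r).
        pose proof (Cmod_triangle p q).
        replace (b' - a' + (d' - c'))%R with (2 * (m - a' + (n - c')))%R by (unfold m, n; field).
        replace (b' - m + (n - c'))%R with (m - a' + (n - c'))%R in H2 by (unfold m, n; field).
        replace (m - a' + (d' - n))%R with (m - a' + (n - c'))%R in H3 by (unfold m, n; field).
        replace (b' - m + (d' - n))%R with (m - a' + (n - c'))%R in H4 by (unfold m, n; field).
        lra.
      + unfold m; lra.
      + unfold n; lra.
      + intros z Hz. apply Hf. revert Hz; apply box_sub; lra.
    - intros x y Hx Hy.
      destruct (boundary_integral_local f (x, y) eps) as [dl [Hdl H]]; auto.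
      { apply Hf. unfold box, between; simpl. rewrite !Rmin_left, !Rmax_right by lra. lra. }
      exists dl; split; auto. intros a' b' c' d' Hs Hx' Hy' H1 H2.
      apply H; auto; try lra.
      + intros z Hz. apply Hf. revert Hz; apply box_sub; lra.
      + unfold box, between; simpl. rewrite !Rmin_left, !Rmax_right by lra. lra. }
  apply Cmod_eq_0, Rle_antisym; [|apply Cmod_ge_0].
  apply le_epsilon. intros e He. rewrite Rplus_0_l.
  set (s := ((b - a) + (d - c))%R) in *. assert (0 <= s)%R by (unfold s; lra).
  eapply Rle_trans; [apply (H (e / (s ^ 2 + 1)))%R; apply Rdiv_lt_0_compat; nra|].
  apply Rle_trans with (e / (s ^ 2 + 1) * (s ^ 2 + 1))%R.
  - apply Rmult_le_compat_l; [|lra]. apply Rlt_le, Rdiv_lt_0_compat; nra.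
  - right; field; nra.
Qed.

Lemma between_sym (a b x : R) : between a b x -> between b a x.
Proof. unfold between. now rewrite Rmin_comm, Rmax_comm. Qed.

Lemma CInt_swap (f : R -> C) (a b : R) :
  (forall x, between a b x -> path_continuous f x) -> CInt f b a = - CInt f a b.
Proof. intros H. apply CInt_unique, is_CInt_swap, CInt_correct, H. Qed.

(** Reversing a pair of sides only changes the sign. This form lets a primitive be compared at two
    points in any relative position. *)
Lemma Goursat_oriented (f : C -> C) (a b c d : R) :
  differentiable_on (box a b c d) f -> boundary_integral f a b c d = 0.
Proof.
  assert (Hx : forall a b c d, differentiable_on (box a b c d) f ->
    boundary_integral f b a c d = - boundary_integral f a b c d).
  { clear. intros a b c d H.
    assert (Hs : forall y, between c d y ->
      CInt (fun x => f (x, y)) b a = - CInt (fun x => f (x, y)) a b).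
    { intros y Hy. apply CInt_swap. intros x Hx. destruct (H (x, y) (conj Hx Hy)) as [l Hl].
      now apply horizontal_continuous with l. }
    unfold boundary_integral.
    rewrite (Hs c (between_l _ _)), (Hs d (between_r _ _)). ring. }
  assert (Hy : forall a b c d, differentiable_on (box a b c d) f ->
    boundary_integral f a b d c = - boundary_integral f a b c d).
  { clear. intros a b c d H.
    assert (Hs : forall x, between a b x ->
      CInt (fun y => f (x, y)) d c = - CInt (fun y => f (x, y)) c d).
    { intros x Hx. apply CInt_swap. intros y Hy. destruct (H (x, y) (conj Hx Hy)) as [l Hl].
      now apply vertical_continuous with l. }
    unfold boundary_integral.
    rewrite (Hs a (between_l _ _)), (Hs b (between_r _ _)). ring. }
  assert (H1 : forall a b c d, (a <= b)%R -> differentiable_on (box a b c d) f ->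
    boundary_integral f a b c d = 0).
  { intros a' b' c' d' Hab Hf. destruct (Rle_dec c' d') as [Hcd|Hcd].
    - now apply Goursat.
    - assert (Hf' : differentiable_on (box a' b' d' c') f).
      { intros z [Hz1 Hz2]. apply Hf. split; auto. now apply between_sym. }
      rewrite Hy, Goursat; auto; [ring|lra]. }
  intros Hf. destruct (Rle_dec a b) as [Hab|Hab]; [now apply H1|].
  assert (Hf' : differentiable_on (box b a c d) f).
  { intros z [Hz1 Hz2]. apply Hf. split; auto. now apply between_sym. }
  rewrite Hx, H1; auto; [ring|lra].
Qed.

Lemma CInt_le_oriented (f : R -> C) (a b M : R) :
  (forall x, between a b x -> path_continuous f x) ->
  (forall x, between a b x -> (Cmod (f x) <= M)%R) ->
  (Cmod (CInt f a b) <= Rabs (b - a) * M)%R.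
Proof.
  intros Hf HM.
  assert (H : forall a b, (a <= b)%R -> (forall x, between a b x -> path_continuous f x) ->
    (forall x, between a b x -> (Cmod (f x) <= M)%R) ->
    (Cmod (CInt f a b) <= Rabs (b - a) * M)%R).
  { clear. intros a b Hab Hf HM. rewrite Rabs_pos_eq by lra.
    apply is_CInt_le with f; auto; [|now apply CInt_correct].
    intros x Hx. apply HM. unfold between. rewrite Rmin_left, Rmax_right; lra. }
  destruct (Rle_dec a b) as [Hab|Hab]; [now apply H|].
  rewrite CInt_swap, Cmod_opp, Rabs_minus_sym by (intros x Hx; apply Hf, between_sym, Hx).
  apply H; [lra|intros x Hx; apply Hf, between_sym, Hx|intros x Hx; apply HM, between_sym, Hx].
Qed.

(** * Primitives on an open rectangle *)

Definition rect (a b c d : R) (z : C) : Prop := (a < Re z < b)%R /\ (c < Im z < d)%R.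

Lemma between_open (a b x y t : R) :
  (a < x < b)%R -> (a < y < b)%R -> between x y t -> (a < t < b)%R.
Proof.
  unfold between. intros Hx Hy [H1 H2]. destruct (Rle_dec x y).
  - rewrite Rmin_left in H1 by lra. rewrite Rmax_right in H2 by lra. lra.
  - rewrite Rmin_right in H1 by lra. rewrite Rmax_left in H2 by lra. lra.
Qed.

Lemma between_dist (x y t : R) : between x y t -> (Rabs (t - x) <= Rabs (y - x))%R.
Proof.
  unfold between. intros [H1 H2]. destruct (Rle_dec x y).
  - rewrite Rmin_left in H1 by lra. rewrite Rmax_right in H2 by lra. rewrite !Rabs_pos_eq; lra.
  - rewrite Rmin_right in H1 by lra. rewrite Rmax_left in H2 by lra.
    rewrite !Rabs_left1; lra.
Qed.

Lemma CInt_Chasles (f : R -> C) (a b c : R) :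
  (forall x, between a b x -> path_continuous f x) ->
  (forall x, between b c x -> path_continuous f x) ->
  CInt f a c = CInt f a b + CInt f b c.
Proof. intros H1 H2. apply CInt_unique, is_CInt_Chasles with b; now apply CInt_correct. Qed.

Lemma CInt_const (c : C) (a b : R) : CInt (fun _ => c) a b = RtoC (b - a) * c.
Proof.
  apply CInt_unique. replace (RtoC (b - a) * c) with (RtoC b * c - RtoC a * c)
    by (rewrite RtoC_minus; ring).
  apply is_CInt_derive with (f := fun t => RtoC t * c); intros t _.
  - pose proof (path_derive_mult (fun t => RtoC t) (fun _ => c) t 1 0
      (horizontal_derive 0 t) (path_derive_const c t)) as H.
    cbv beta in H. replace (1 * c + t * 0) with c in H by ring. exact H.
  - apply (path_derive_continuous _ _ _ (path_derive_const c t)).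
Qed.

Lemma CInt_minus_const (f : R -> C) (a b : R) (c : C) :
  (forall x, between a b x -> path_continuous f x) ->
  CInt (fun x => f x - c) a b = CInt f a b - RtoC (b - a) * c.
Proof.
  intros Hf. rewrite <- CInt_const. apply CInt_minus; [now apply CInt_correct|].
  apply CInt_correct. intros x _. exact (path_derive_continuous _ _ _ (path_derive_const c x)).
Qed.

(** [F] integrates from the center, horizontally and then vertically. By Goursat's theorem its
    increment is an integral over two short segments starting at the point itself, along which [f]
    is nearly constant. *)
Lemma primitive (f : C -> C) (a b c d : R) :
  differentiable_on (rect a b c d) f ->
  exists F, forall z, rect a b c d z -> C_differential F z (f z).
Proof.
  intros Hf.
  destruct (Rlt_dec a b) as [Hab|Hab]; [|exists f; intros z [Hz _]; lra].
  destruct (Rlt_dec c d) as [Hcd|Hcd]; [|exists f; intros z [_ Hz]; lra].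
  set (x0 := ((a + b) / 2)%R). set (y0 := ((c + d) / 2)%R).
  assert (Hx0 : (a < x0 < b)%R) by (unfold x0; lra).
  assert (Hy0 : (c < y0 < d)%R) by (unfold y0; lra).
  assert (Hh : forall x y, (a < x < b)%R -> (c < y < d)%R ->
    path_continuous (fun t => f (t, y)) x).
  { intros x y Hx Hy. destruct (Hf (x, y) (conj Hx Hy)) as [l Hl].
    now apply horizontal_continuous with l. }
  assert (Hv : forall x y, (a < x < b)%R -> (c < y < d)%R ->
    path_continuous (fun t => f (x, t)) y).
  { intros x y Hx Hy. destruct (Hf (x, y) (conj Hx Hy)) as [l Hl].
    now apply vertical_continuous with l. }
  set (F := fun z : C => CInt (fun t => f (t, y0)) x0 (Re z) + Ci * CInt (fun s => f (Re z, s)) y0 (Im z)).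
  exists F. intros [x y] [Hx Hy] eps He. simpl in Hx, Hy.
  destruct (Hf (x, y) (conj Hx Hy)) as [l Hl].
  destruct (C_differential_Lipschitz _ _ _ Hl) as [d1 [Hd1 HL]].
  pose proof (Cmod_ge_0 l) as Hl0.
  set (rho := Rmin (Rmin (x - a) (b - x)) (Rmin (y - c) (d - y))).
  (* The two segments stay within [2 * W] of the point, [W] being the length of the increment; with
     this [e2] the function [f] varies there by at most [eps / 2], and each segment costs
     [eps / 2 * W]. *)
  set (e2 := (eps / (4 * (Cmod l + 1)))%R).
  assert (He2 : (0 < e2)%R) by (apply Rdiv_lt_0_compat; lra).
  assert (Hrho : (0 < rho)%R) by (unfold rho; repeat apply Rmin_pos; lra).
  set (dl := Rmin rho (Rmin (d1 / 2) e2)).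
  assert (Hdl : (0 < dl)%R) by (unfold dl; repeat apply Rmin_pos; lra).
  exists dl. split; auto. intros [x' y'] Hw.
  assert (B1 : (dl <= rho)%R) by apply Rmin_l.
  assert (B2 : (dl <= d1 / 2)%R) by (eapply Rle_trans; [apply Rmin_r|apply Rmin_l]).
  assert (B3 : (dl <= e2)%R) by (eapply Rle_trans; [apply Rmin_r|apply Rmin_r]).
  assert (B4 : (rho <= x - a)%R) by (eapply Rle_trans; [apply Rmin_l|apply Rmin_l]).
  assert (B5 : (rho <= b - x)%R) by (eapply Rle_trans; [apply Rmin_l|apply Rmin_r]).
  assert (B6 : (rho <= y - c)%R) by (eapply Rle_trans; [apply Rmin_r|apply Rmin_l]).
  assert (B7 : (rho <= d - y)%R) by (eapply Rle_trans; [apply Rmin_r|apply Rmin_r]).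
  set (W := Cmod ((x', y') - (x, y))) in *.
  assert (Wx : (Rabs (x' - x) <= W)%R) by exact (Rabs_Re_le_Cmod ((x', y') - (x, y))).
  assert (Wy : (Rabs (y' - y) <= W)%R) by exact (Rabs_Im_le_Cmod ((x', y') - (x, y))).
  assert (Hx' : (a < x' < b)%R) by (pose proof (Rabs_def2 (x' - x) dl ltac:(lra)); lra).
  assert (Hy' : (c < y' < d)%R) by (pose proof (Rabs_def2 (y' - y) dl ltac:(lra)); lra).
  (* This rectangle trades the horizontal step at the reference height [y0] for one at the height
     [y] of the point. *)
  assert (Gt : boundary_integral f x x' y0 y = 0).
  { apply Goursat_oriented. intros z [Hz1 Hz2]. apply Hf. split.
    - now apply between_open with x x'.
    - now apply between_open with y0 y. }
  assert (E : F (x', y') - F (x, y) =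
     CInt (fun t => f (t, y)) x x' + Ci * CInt (fun s => f (x', s)) y y').
  { unfold F; simpl. unfold boundary_integral in Gt.
    rewrite (CInt_Chasles (fun t => f (t, y0)) x0 x x').
    2:{ intros t Ht. apply Hh; auto. now apply between_open with x0 x. }
    2:{ intros t Ht. apply Hh; auto. now apply between_open with x x'. }
    rewrite (CInt_Chasles (fun s => f (x', s)) y0 y y').
    2:{ intros t Ht. apply Hv; auto. now apply between_open with y0 y. }
    2:{ intros t Ht. apply Hv; auto. now apply between_open with y y'. }
    match type of Gt with ?p - ?q + _ * (?r - ?s) = _ =>
      replace q with (p + Ci * (r - s));
      [ring | transitivity (q + (p - q + Ci * (r - s))); [ring|rewrite Gt; ring]] end. }
  assert (Cl : forall z, (Cmod (z - (x, y)) <= 2 * W)%R ->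
    (Cmod (f z - f (x, y)) <= eps / 2)%R).
  { intros z Hz. eapply Rle_trans; [apply HL; lra|].
    apply Rle_trans with ((Cmod l + 1) * (2 * e2))%R; [apply Rmult_le_compat_l; lra|].
    right; unfold e2; field; lra. }
  rewrite E.
  replace (CInt (fun t => f (t, y)) x x' + Ci * CInt (fun s => f (x', s)) y y' -
    ((x', y') - (x, y)) * f (x, y)) with
    (CInt (fun t => f (t, y) - f (x, y)) x x' + Ci * CInt (fun s => f (x', s) - f (x, y)) y y').
  2:{ assert (X1 : forall t, between x x' t -> path_continuous (fun t => f (t, y)) t).
      { intros t Ht. apply Hh; auto. now apply between_open with x x'. }
      assert (X2 : forall t, between y y' t -> path_continuous (fun t => f (x', t)) t).
      { intros t Ht. apply Hv; auto. now apply between_open with y y'. }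
      rewrite (CInt_minus_const (fun t => f (t, y)) x x' (f (x, y)) X1).
      rewrite (CInt_minus_const (fun t => f (x', t)) y y' (f (x, y)) X2).
      replace ((x', y') - (x, y)) with (RtoC (x' - x) + Ci * RtoC (y' - y)); [ring|].
      unfold Ci, RtoC, Cminus, Cplus, Copp, Cmult; simpl; f_equal; ring. }
  eapply Rle_trans; [apply Cmod_triangle|]. rewrite Cmod_mult, Cmod_Ci, Rmult_1_l.
  assert (I1 : (Cmod (CInt (fun t => f (t, y) - f (x, y))%C x x') <= Rabs (x' - x) * (eps / 2))%R).
  { apply CInt_le_oriented.
    - intros t Ht. apply (continuous_path_minus (fun t => f (t, y)) (fun _ => f (x, y))).
      + apply Hh; auto. now apply between_open with x x'.
      + apply (path_derive_continuous _ _ _ (path_derive_const _ t)).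
    - intros t Ht. apply Cl. eapply Rle_trans; [apply Cmod_le_abs_sum|]. simpl.
      apply between_dist in Ht.
      replace (t + - x)%R with (t - x)%R by ring. replace (y + - y)%R with 0%R by ring.
      rewrite Rabs_R0. pose proof (Rabs_pos (y' - y)). lra. }
  assert (I2 : (Cmod (CInt (fun t => f (x', t) - f (x, y))%C y y') <= Rabs (y' - y) * (eps / 2))%R).
  { apply CInt_le_oriented.
    - intros t Ht. apply (continuous_path_minus (fun t => f (x', t)) (fun _ => f (x, y))).
      + apply Hv; auto. now apply between_open with y y'.
      + apply (path_derive_continuous _ _ _ (path_derive_const _ t)).
    - intros t Ht. apply Cl. eapply Rle_trans; [apply Cmod_le_abs_sum|]. simpl.
      apply between_dist in Ht.
      replace (t + - y)%R with (t - y)%R by ring. replace (x' + - x)%R with (x' - x)%R by ring.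
      lra. }
  nra.
Qed.

Lemma horizontal_increment (F f : C -> C) (x x' y M : R) :
  (forall t, between x x' t -> C_differential F (t, y) (f (t, y))) ->
  (forall t, between x x' t -> exists l, C_differential f (t, y) l) ->
  (forall t, between x x' t -> (Cmod (f (t, y)) <= M)%R) ->
  (Cmod (F (x', y) - F (x, y)) <= Rabs (x' - x) * M)%R.
Proof.
  intros HF Hf HM.
  assert (Hc : forall t, between x x' t -> path_continuous (fun t => f (t, y)) t).
  { intros t Ht. destruct (Hf t Ht) as [l Hl]. now apply horizontal_continuous with l. }
  replace (F (x', y) - F (x, y)) with (CInt (fun t => f (t, y)) x x').
  - now apply CInt_le_oriented.
  - apply CInt_unique, (is_CInt_derive (fun t => F (t, y))); auto.
    intros t Ht. replace (f (t, y)) with (f (t, y) * 1) by ring.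
    apply (path_derive_comp F (fun t => (t, y))); [now apply HF|apply horizontal_derive].
Qed.

Lemma vertical_increment (F f : C -> C) (G dG : R -> R) (x y y' : R) :
  (y <= y')%R ->
  (forall t, (y <= t <= y')%R -> C_differential F (x, t) (f (x, t))) ->
  (forall t, (y <= t <= y')%R -> exists l, C_differential f (x, t) l) ->
  (forall t, (y <= t <= y')%R -> is_derive G t (dG t)) ->
  (forall t, (y <= t <= y')%R -> continuous dG t) ->
  (forall t, (y <= t <= y')%R -> (Cmod (f (x, t)) <= dG t)%R) ->
  (Cmod (F (x, y') - F (x, y)) <= G y' - G y)%R.
Proof.
  intros Hy HF Hf HG HdG HM.
  apply (path_increment_le (fun t => F (x, t)) (fun t => f (x, t) * Ci) G dG); auto.
  - intros t Ht. apply (path_derive_comp F (fun t => (x, t))); [now apply HF|apply vertical_derive].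
  - intros t Ht. destruct (Hf t Ht) as [l Hl].
    apply (continuous_comp_path (fun w => w * Ci) (fun t => f (x, t)) t (Ci)).
    + intros eps He. exists 1%R. split; [lra|]. intros w _.
      replace (w * Ci - f (x, t) * Ci - (w - f (x, t)) * Ci) with (RtoC 0) by ring.
      rewrite Cmod_0. pose proof (Cmod_ge_0 (w - f (x, t))). nra.
    + now apply vertical_continuous with l.
  - intros t Ht. rewrite Cmod_mult, Cmod_Ci, Rmult_1_r. auto.
Qed.

(** * Growth of the two primitives near the axis *)

Lemma derive_2sqrt (t : R) : (0 < t)%R -> is_derive (fun t => 2 * sqrt t)%R t (/ sqrt t)%R.
Proof.
  intros Ht. auto_derive; [lra|]. field. apply Rgt_not_eq, sqrt_lt_R0, Ht.
Qed.

Lemma derive_inv_sqrt (t : R) :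
  (0 < t)%R -> is_derive (fun t => - 2 / sqrt t)%R t (/ (t * sqrt t))%R.
Proof.
  intros Ht. pose proof (sqrt_lt_R0 t Ht). auto_derive; [split; [lra|split; auto; lra]|].
  rewrite !(sqrt_sqrt t) by lra. field. lra.
Qed.

Lemma continuous_inv_sqrt (t : R) : (0 < t)%R -> continuous (fun t => / sqrt t)%R t.
Proof.
  intros Ht. apply (ex_derive_continuous (V := R_NormedModule)). auto_derive.
  repeat split; auto. apply Rgt_not_eq, sqrt_lt_R0, Ht.
Qed.

Lemma continuous_inv_t_sqrt (t : R) : (0 < t)%R -> continuous (fun t => / (t * sqrt t))%R t.
Proof.
  intros Ht. apply (ex_derive_continuous (V := R_NormedModule)). auto_derive.
  repeat split; auto. apply Rmult_integral_contrapositive_currified; [lra|].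
  apply Rgt_not_eq, sqrt_lt_R0, Ht.
Qed.

Lemma continuous_Rscal (k : R) (g : R -> R) (t : R) :
  continuous g t -> continuous (fun s => k * g s)%R t.
Proof. intros H. exact (continuous_scal_r (K := R_AbsRing) k g t H). Qed.

Lemma sqrt_minus_le (a b : R) : (0 <= a)%R -> (a <= b)%R -> (sqrt b - sqrt a <= sqrt (b - a))%R.
Proof.
  intros Ha Hab. pose proof (sqrt_pos a). pose proof (sqrt_pos b). pose proof (sqrt_pos (b - a)).
  apply Rnot_lt_le. intros Hn.
  assert (sqrt b * sqrt b > (sqrt a + sqrt (b - a)) * (sqrt a + sqrt (b - a)))%R by nra.
  pose proof (sqrt_sqrt a Ha). pose proof (sqrt_sqrt b ltac:(lra)).
  pose proof (sqrt_sqrt (b - a) ltac:(lra)). nra.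
Qed.

Section Estimates.

Variables (f Phi1 Phi2 : C -> C) (A delta M : R).
Hypotheses (HA : (0 < A)%R) (Hdelta : (0 < delta)%R).
Hypothesis Hf : differentiable_on (rect (- A) A 0 delta) f.
Hypothesis HM : forall z, rect (- A) A 0 delta z -> (Cmod (f z) * Im z <= M)%R.
Hypothesis H1 : forall z, rect (- A) A 0 delta z -> C_differential Phi1 z (f z).
Hypothesis H2 : forall z, rect (- A) A 0 delta z -> C_differential Phi2 z (Phi1 z).

Lemma simple_bound_nonneg : (0 <= M)%R.
Proof.
  assert (Hz : rect (- A) A 0 delta (0, delta / 2)%R) by (unfold rect; simpl; lra).
  eapply Rle_trans; [|apply (HM _ Hz)]. apply Rmult_le_pos; [apply Cmod_ge_0|simpl; lra].
Qed.

(** Integration down from the fixed height [delta / 2]. Integrating [M / t] exactly would give a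
    logarithm; the cruder power is enough because it is still integrable at 0, and it keeps every
    primitive elementary. *)
Lemma primitive1_bound :
  exists K, (0 <= K)%R /\ forall x y, (- A < x < A)%R -> (0 < y < delta)%R ->
    (Cmod (Phi1 (x, y)) <= K * / sqrt y)%R.
Proof.
  pose proof simple_bound_nonneg as HM0.
  set (y1 := (delta / 2)%R). assert (Hy1 : (0 < y1 < delta)%R) by (unfold y1; lra).
  (* Since [sqrt t <= sqrt delta], the bound [M / t] is at most [k / (t * sqrt t)], whose primitive
     is [- 2 * k / sqrt t]. *)
  set (k := (M * sqrt delta)%R).
  assert (Hsd : (0 < sqrt delta)%R) by (apply sqrt_lt_R0; lra).
  assert (Hk : (0 <= k)%R) by (apply Rmult_le_pos; lra).
  assert (Hv : forall x y y', (- A < x < A)%R -> (0 < y)%R -> (y <= y')%R -> (y' < delta)%R ->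
    (Cmod (Phi1 (x, y') - Phi1 (x, y)) <= k * (2 / sqrt y))%R).
  { intros x y y' Hx Hy Hyy Hy'.
    apply Rle_trans with (k * (- 2 / sqrt y') - k * (- 2 / sqrt y))%R.
    - apply (vertical_increment Phi1 f (fun t => k * (- 2 / sqrt t))%R (fun t => k * / (t * sqrt t))%R); auto.
      + intros t Ht. apply H1. unfold rect; simpl; lra.
      + intros t Ht. apply Hf. unfold rect; simpl; lra.
      + intros t Ht. apply is_derive_scal.
        apply derive_inv_sqrt; lra.
      + intros t Ht. apply continuous_Rscal.
        apply continuous_inv_t_sqrt; lra.
      + intros t Ht.
        assert (Hr : rect (- A) A 0 delta (x, t)) by (unfold rect; simpl; lra).
        specialize (HM _ Hr). simpl in HM.
        assert (Hst : (0 < sqrt t)%R) by (apply sqrt_lt_R0; lra).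
        assert (sqrt t <= sqrt delta)%R by (apply sqrt_le_1; lra).
        apply Rmult_le_reg_r with (t * sqrt t)%R; [nra|].
        replace (k * / (t * sqrt t) * (t * sqrt t))%R with k by (field; lra).
        unfold k. pose proof (Cmod_ge_0 (f (x, t))).
        apply Rle_trans with (M * sqrt t)%R; [|nra].
        replace (Cmod (f (x, t)) * (t * sqrt t))%R with ((Cmod (f (x, t)) * t) * sqrt t)%R by ring.
        apply Rmult_le_compat_r; lra.
    - assert (0 < / sqrt y')%R by (apply Rinv_0_lt_compat, sqrt_lt_R0; lra).
      unfold Rdiv. nra. }
  assert (Hh : forall x, (- A < x < A)%R ->
    (Cmod (Phi1 (x, y1)) <= Cmod (Phi1 (0, y1)) + A * (M / y1))%R).
  { intros x Hx.
    replace (Phi1 (x, y1)) with (Phi1 (0%R, y1) + (Phi1 (x, y1) - Phi1 (0%R, y1))) by ring.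
    eapply Rle_trans; [apply Cmod_triangle|]. apply Rplus_le_compat_l.
    apply Rle_trans with (Rabs (x - 0) * (M / y1))%R.
    - assert (Hb : forall t, between 0 x t -> rect (- A) A 0 delta (t, y1)).
      { intros t Ht. apply (between_open (- A) A) in Ht; [|lra|lra]. unfold rect; simpl; lra. }
      apply (horizontal_increment Phi1 f); intros t Ht.
      + apply H1; auto.
      + apply Hf; auto.
      + apply Rmult_le_reg_r with y1; [lra|].
        replace (M / y1 * y1)%R with M by (field; lra). apply (HM _ (Hb t Ht)).
    - apply Rmult_le_compat_r.
      + apply Rmult_le_pos; [lra|]. apply Rlt_le, Rinv_0_lt_compat; lra.
      + apply Rabs_le; lra. }
  set (K0 := (Cmod (Phi1 (0, y1)) + A * (M / y1))%R) in *.
  assert (HK0 : (0 <= K0)%R).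
  { unfold K0. pose proof (Cmod_ge_0 (Phi1 (0%R, y1))).
    assert (0 <= M / y1)%R by (apply Rmult_le_pos; [lra|apply Rlt_le, Rinv_0_lt_compat; lra]). nra. }
  assert (Hs1 : (0 < / sqrt y1)%R) by (apply Rinv_0_lt_compat, sqrt_lt_R0; lra).
  (* The bounded contributions are absorbed into the singular one through
     [1 <= sqrt delta * / sqrt y]. *)
  exists ((K0 + 2 * k * / sqrt y1) * sqrt delta + 2 * k)%R. split.
  { assert (0 <= k * / sqrt y1)%R by (apply Rmult_le_pos; lra). nra. }
  intros x y Hx Hy.
  assert (Hsy : (0 < sqrt y)%R) by (apply sqrt_lt_R0; lra).
  assert (Hsy' : (0 < / sqrt y)%R) by (now apply Rinv_0_lt_compat).
  assert (Hd : (Cmod (Phi1 (x, y) - Phi1 (x, y1)) <= 2 * k * / sqrt y + 2 * k * / sqrt y1)%R).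
  { assert (0 <= k * / sqrt y1)%R by (apply Rmult_le_pos; lra).
    assert (0 <= k * / sqrt y)%R by (apply Rmult_le_pos; lra).
    destruct (Rle_dec y y1) as [Hc|Hc].
    - rewrite <- Cmod_opp. replace (- (Phi1 (x, y) - Phi1 (x, y1))) with (Phi1 (x, y1) - Phi1 (x, y)) by ring.
      eapply Rle_trans; [apply Hv; auto; lra|]. unfold Rdiv. lra.
    - eapply Rle_trans; [apply Hv; auto; lra|]. unfold Rdiv. lra. }
  replace (Phi1 (x, y)) with (Phi1 (x, y1) + (Phi1 (x, y) - Phi1 (x, y1))) by ring.
  eapply Rle_trans; [apply Cmod_triangle|]. specialize (Hh x Hx).
  assert (Hq : (1 <= sqrt delta * / sqrt y)%R).
  { replace 1%R with (sqrt y * / sqrt y)%R by (field; lra).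
    apply Rmult_le_compat_r; [lra|]. apply sqrt_le_1; lra. }
  set (K2 := (K0 + 2 * k * / sqrt y1)%R) in *.
  assert (HK2 : (0 <= K2)%R).
  { unfold K2. assert (0 <= k * / sqrt y1)%R by (apply Rmult_le_pos; lra). nra. }
  replace ((K2 * sqrt delta + 2 * k) * / sqrt y)%R with
    (K2 * (sqrt delta * / sqrt y) + 2 * k * / sqrt y)%R by ring.
  assert (K2 * 1 <= K2 * (sqrt delta * / sqrt y))%R by (apply Rmult_le_compat_l; lra).
  unfold K2 in *. lra.
Qed.

Lemma Phi1_differentiable z : rect (- A) A 0 delta z -> exists l, C_differential Phi1 z l.
Proof. intros Hz. exists (f z); auto. Qed.

Section WithBound.
Variable K : R.
Hypothesis HK : (0 <= K)%R.
Hypothesis Hb : forall x y, (- A < x < A)%R -> (0 < y < delta)%R ->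
    (Cmod (Phi1 (x, y)) <= K * / sqrt y)%R.

(** The integral of [K / sqrt t] is [2 * K] times a difference of square roots, and the square root
    is subadditive. *)
Lemma primitive2_vertical x y y' :
  (- A < x < A)%R -> (0 < y < delta)%R -> (0 < y' < delta)%R ->
  (Cmod (Phi2 (x, y') - Phi2 (x, y)) <= 2 * K * sqrt (Rabs (y' - y)))%R.
Proof.
  assert (H : forall y y', (- A < x < A)%R -> (0 < y)%R -> (y <= y')%R -> (y' < delta)%R ->
    (Cmod (Phi2 (x, y') - Phi2 (x, y)) <= 2 * K * sqrt (y' - y))%R).
  { clear y y'. intros y y' Hx Hy Hyy Hy'.
    apply Rle_trans with (K * (2 * sqrt y') - K * (2 * sqrt y))%R.
    - apply (vertical_increment Phi2 Phi1 (fun t => K * (2 * sqrt t))%R (fun t => K * / sqrt t)%R); auto.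
      + intros t Ht. apply H2. unfold rect; simpl; lra.
      + intros t Ht. apply Phi1_differentiable. unfold rect; simpl; lra.
      + intros t Ht. apply is_derive_scal.
        apply derive_2sqrt; lra.
      + intros t Ht. apply continuous_Rscal.
        apply continuous_inv_sqrt; lra.
      + intros t Ht. apply Hb; lra.
    - pose proof (sqrt_minus_le y y' ltac:(lra) Hyy). nra. }
  intros Hx Hy Hy'. destruct (Rle_dec y y').
  - rewrite Rabs_pos_eq by lra. apply H; lra.
  - rewrite Rabs_left1 by lra. rewrite <- Cmod_opp.
    replace (- (Phi2 (x, y') - Phi2 (x, y))) with (Phi2 (x, y) - Phi2 (x, y')) by ring.
    replace (- (y' - y))%R with (y - y')%R by ring. apply H; lra.
Qed.

Lemma primitive2_horizontal x x' y :
  (- A < x < A)%R -> (- A < x' < A)%R -> (0 < y < delta)%R ->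
  (Cmod (Phi2 (x', y) - Phi2 (x, y)) <= Rabs (x' - x) * (K * / sqrt y))%R.
Proof.
  intros Hx Hx' Hy.
  assert (Hr : forall t, between x x' t -> (- A < t < A)%R).
  { intros t Ht. now apply (between_open (- A) A) in Ht. }
  apply (horizontal_increment Phi2 Phi1); intros t Ht; specialize (Hr t Ht).
  - apply H2. unfold rect; simpl; lra.
  - apply Phi1_differentiable. unfold rect; simpl; lra.
  - apply Hb; lra.
Qed.

Lemma primitive2_bound :
  exists B, (0 <= B)%R /\ forall x y, (- A < x < A)%R -> (0 < y < delta)%R ->
    (Cmod (Phi2 (x, y)) <= B)%R.
Proof.
  set (y1 := (delta / 2)%R). assert (Hy1 : (0 < y1 < delta)%R) by (unfold y1; lra).
  assert (Hs1 : (0 < / sqrt y1)%R) by (apply Rinv_0_lt_compat, sqrt_lt_R0; lra).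
  assert (Hsd : (0 < sqrt delta)%R) by (apply sqrt_lt_R0; lra).
  exists (Cmod (Phi2 (0, y1)) + A * (K * / sqrt y1) + 2 * K * sqrt delta)%R.
  assert (0 <= K * / sqrt y1)%R by (apply Rmult_le_pos; lra).
  split; [pose proof (Cmod_ge_0 (Phi2 (0%R, y1))); nra|].
  intros x y Hx Hy.
  pose proof (primitive2_horizontal 0 x y1 ltac:(lra) Hx Hy1) as B1.
  pose proof (primitive2_vertical x y1 y Hx Hy1 Hy) as B2.
  assert (B3 : (sqrt (Rabs (y - y1)) <= sqrt delta)%R).
  { apply sqrt_le_1; [apply Rabs_pos|lra|]. apply Rabs_le; lra. }
  assert (B4 : (Rabs (x - 0) <= A)%R) by (apply Rabs_le; lra).
  replace (Phi2 (x, y)) with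
    (Phi2 (0%R, y1) + (Phi2 (x, y1) - Phi2 (0%R, y1)) + (Phi2 (x, y) - Phi2 (x, y1))) by ring.
  eapply Rle_trans; [apply Cmod_triangle|].
  eapply Rle_trans; [apply Rplus_le_compat_r, Cmod_triangle|].
  repeat apply Rplus_le_compat; [lra| |].
  - eapply Rle_trans; [apply B1|]. apply Rmult_le_compat_r; lra.
  - eapply Rle_trans; [apply B2|]. apply Rmult_le_compat_l; lra.
Qed.

(* Move up by the distance of the two points, then sideways, then down again. *)
Lemma primitive2_Holder x y x' y' :
  (- A < x < A)%R -> (- A < x' < A)%R -> (0 < y < delta / 3)%R -> (0 < y' < delta / 3)%R ->
  (Cmod ((x', y') - (x, y)) < delta / 3)%R ->
  (Cmod (Phi2 (x', y') - Phi2 (x, y)) <= 7 * K * sqrt (Cmod ((x', y') - (x, y))))%R.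
Proof.
  intros Hx Hx' Hy Hy' Hd. set (h := Cmod ((x', y') - (x, y))) in *.
  assert (Wx : (Rabs (x' - x) <= h)%R) by exact (Rabs_Re_le_Cmod ((x', y') - (x, y))).
  assert (Wy : (Rabs (y' - y) <= h)%R) by exact (Rabs_Im_le_Cmod ((x', y') - (x, y))).
  destruct (Rle_lt_or_eq_dec 0 h (Cmod_ge_0 _)) as [Hh|Hh].
  2:{ assert (x' = x) by (apply Rminus_diag_uniq, Rabs_eq_0; pose proof (Rabs_pos (x' - x)); lra).
      assert (y' = y) by (apply Rminus_diag_uniq, Rabs_eq_0; pose proof (Rabs_pos (y' - y)); lra).
      subst x' y'. replace (Phi2 (x, y) - Phi2 (x, y)) with (RtoC 0) by ring. rewrite Cmod_0.
      apply Rmult_le_pos; [lra|apply sqrt_pos]. }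
  pose proof (primitive2_vertical x y (y + h) Hx ltac:(lra) ltac:(lra)) as B1.
  pose proof (primitive2_horizontal x x' (y + h) Hx Hx' ltac:(lra)) as B2.
  pose proof (primitive2_vertical x' (y + h) y' Hx' ltac:(lra) ltac:(lra)) as B3.
  assert (Hs : (0 < sqrt h)%R) by (now apply sqrt_lt_R0).
  replace (y + h - y)%R with h in B1 by ring. rewrite (Rabs_pos_eq h) in B1 by lra.
  assert (C2 : (Rabs (x' - x) * (K * / sqrt (y + h)) <= K * sqrt h)%R).
  { apply Rle_trans with (h * (K * / sqrt h))%R.
    - assert (sqrt h <= sqrt (y + h))%R by (apply sqrt_le_1; lra).
      assert (0 < / sqrt (y + h))%R by (apply Rinv_0_lt_compat; lra).
      assert (/ sqrt (y + h) <= / sqrt h)%R by (apply Rinv_le_contravar; lra).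
      apply Rmult_le_compat; try nra; apply Rabs_pos.
    - right. rewrite <- (sqrt_sqrt h) at 1 by lra. field. lra. }
  (* The descent spans at most [2 * h], rounded up to [4 * h]; the three moves then cost 2 + 1 + 4 =
     7 times [K * sqrt h]. *)
  assert (C3 : (sqrt (Rabs (y' - (y + h))) <= 2 * sqrt h)%R).
  { replace (2 * sqrt h)%R with (sqrt (4 * h)).
    - apply sqrt_le_1; [apply Rabs_pos|lra|].
      pose proof (Rabs_le_between (y' - y) h) as [X _]. specialize (X Wy). apply Rabs_le; lra.
    - replace 4%R with (2 * 2)%R by ring. rewrite sqrt_mult, sqrt_square by lra. ring. }
  replace (Phi2 (x', y') - Phi2 (x, y)) with
    ((Phi2 (x, y + h)%R - Phi2 (x, y)) + (Phi2 (x', y + h)%R - Phi2 (x, y + h)%R) +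
     (Phi2 (x', y') - Phi2 (x', y + h)%R)) by ring.
  eapply Rle_trans; [apply Cmod_triangle|].
  eapply Rle_trans; [apply Rplus_le_compat_r, Cmod_triangle|].
  assert (2 * K * sqrt (Rabs (y' - (y + h))) <= 2 * K * (2 * sqrt h))%R by
    (apply Rmult_le_compat_l; lra).
  lra.
Qed.
End WithBound.
End Estimates.

Definition strip (pm : side) (A delta : R) (z : C) : Prop :=
  (Rabs (Re z) < A)%R /\ half_plane pm z /\ (Rabs (Im z) < delta)%R.

(* A double primitive of a function of simple behavior extends continuously to the axis: it is
   bounded and Hoelder continuous of exponent 1/2. *)
Definition double_primitive (pm : side) (A delta K : R) (f Phi1 Phi2 : C -> C) : Prop :=
  (forall z, strip pm A delta z ->
     C_differential Phi1 z (f z) /\ C_differential Phi2 z (Phi1 z) /\ (Cmod (Phi2 z) <= K)%R) /\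
  (forall z z', strip pm A delta z -> strip pm A delta z' -> (Cmod (z' - z) < delta)%R ->
     (Cmod (Phi2 z' - Phi2 z) <= K * sqrt (Cmod (z' - z)))%R).

(** The height drops to [delta / 3] so that, for points at distance less than [delta / 3], the
    upward detour of the Hoelder estimate stays below [delta]. *)
Lemma double_primitive_upper (f : C -> C) (A delta M : R) :
  (0 < A)%R -> (0 < delta)%R -> differentiable_on (strip Upper A delta) f ->
  (forall z, strip Upper A delta z -> (Cmod (f z) * Rabs (Im z) <= M)%R) ->
  exists Phi1 Phi2 K, double_primitive Upper A (delta / 3) K f Phi1 Phi2.
Proof.
  intros HA Hd Hf HM.
  assert (Hs : forall z, rect (- A) A 0 delta z -> strip Upper A delta z).
  { intros z [H1 H2]. split; [apply Rabs_def1; lra|]. split; [simpl; lra|apply Rabs_def1; lra]. }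
  assert (Hf' : differentiable_on (rect (- A) A 0 delta) f) by (intros z Hz; auto).
  assert (HM' : forall z, rect (- A) A 0 delta z -> (Cmod (f z) * Im z <= M)%R).
  { intros z Hz. rewrite <- (Rabs_pos_eq (Im z)) by (destruct Hz; lra). auto. }
  destruct (primitive f (- A) A 0 delta Hf') as [Phi1 H1].
  assert (Hf1 : differentiable_on (rect (- A) A 0 delta) Phi1) by (intros z Hz; exists (f z); auto).
  destruct (primitive Phi1 (- A) A 0 delta Hf1) as [Phi2 H2].
  destruct (primitive1_bound f Phi1 A delta M HA Hd Hf' HM' H1) as [K [HK Hb]].
  destruct (primitive2_bound f Phi1 Phi2 A delta HA Hd H1 H2 K HK Hb) as [B [HB Hb2]].
  exists Phi1, Phi2, (7 * K + B)%R.
  assert (Hs' : forall x y, strip Upper A (delta / 3) (x, y) ->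
    (- A < x < A)%R /\ (0 < y < delta / 3)%R).
  { intros x y [S1 [S2 S3]]. simpl in *. apply Rabs_def2 in S1, S3. lra. }
  split.
  - intros [x y] Hz. destruct (Hs' x y Hz) as [Hx Hy].
    assert (Hr : rect (- A) A 0 delta (x, y)) by (unfold rect; simpl; lra).
    repeat split; auto. specialize (Hb2 x y Hx ltac:(lra)). lra.
  - intros [x y] [x' y'] Hz Hz' Hlt.
    destruct (Hs' x y Hz) as [Hx Hy]. destruct (Hs' x' y' Hz') as [Hx' Hy'].
    eapply Rle_trans; [apply (primitive2_Holder f Phi1 Phi2 A delta Hd H1 H2 K HK Hb); auto|].
    apply Rmult_le_compat_r; [apply sqrt_pos|lra].
Qed.

Lemma C_differential_neg (f : C -> C) (z l : C) :
  C_differential f (- z) l -> C_differential (fun w => f (- w)) z (- l).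
Proof.
  intros H eps He. destruct (H eps He) as [d [Hd H1]]. exists d. split; auto. intros w Hw.
  assert (E : Cmod (- w - - z) = Cmod (w - z)).
  { rewrite <- Cmod_opp. f_equal; ring. }
  specialize (H1 (- w)). rewrite E in H1. specialize (H1 Hw).
  replace (f (- w) - f (- z) - (w - z) * - l) with (f (- w) - f (- z) - (- w - - z) * l) by ring.
  exact H1.
Qed.

Lemma strip_neg (A delta : R) (z : C) : strip Lower A delta z <-> strip Upper A delta (- z).
Proof.
  unfold strip. destruct z as [x y]; simpl. rewrite !Rabs_Ropp. intuition lra.
Qed.

(** The lower half plane is carried to the upper one by z -> -z. The first primitive changes sign
    under this substitution and the second does not. *)
Lemma double_primitive_exists (pm : side) (f : C -> C) (A delta M : R) :
  (0 < A)%R -> (0 < delta)%R -> differentiable_on (strip pm A delta) f ->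
  (forall z, strip pm A delta z -> (Cmod (f z) * Rabs (Im z) <= M)%R) ->
  exists Phi1 Phi2 K, double_primitive pm A (delta / 3) K f Phi1 Phi2.
Proof.
  intros HA Hd Hf HM. destruct pm; [now apply double_primitive_upper with M|].
  assert (Hs : forall z, strip Upper A delta z -> strip Lower A delta (- z)).
  { intros z Hz. apply strip_neg. now replace (- - z) with z by ring. }
  destruct (double_primitive_upper (fun z => f (- z)) A delta M HA Hd) as [P1 [P2 [K [H1 H2]]]].
  - intros z Hz. destruct (Hf _ (Hs z Hz)) as [l Hl]. exists (- l). now apply C_differential_neg.
  - intros z Hz. rewrite <- Rabs_Ropp. exact (HM _ (Hs z Hz)).
  - assert (E : forall z z' : C, Cmod (- z' - - z) = Cmod (z' - z)).
    { intros z z'. rewrite <- Cmod_opp. f_equal; ring. }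
    exists (fun z => - P1 (- z)), (fun z => P2 (- z)), K. split.
    + intros z Hz. apply strip_neg in Hz. destruct (H1 _ Hz) as [D1 [D2 D3]].
      repeat split; auto; [|now apply C_differential_neg].
      replace (- - z) with z in D1 by ring. apply C_differential_neg in D1.
      intros eps He. destruct (D1 eps He) as [d [Hd' D]]. exists d; split; auto. intros w Hw.
      specialize (D w Hw). rewrite <- Cmod_opp in D.
      replace (- P1 (- w) - - P1 (- z) - (w - z) * f z) with
        (- (P1 (- w) - P1 (- z) - (w - z) * - f z)) by ring. exact D.
    + intros z z' Hz Hz' Hlt. apply strip_neg in Hz, Hz'.
      rewrite <- (E z z') in *. now apply H2.
Qed.

Lemma continuous_path_components (f : R -> C) (t : R) :
  path_continuous f t <->
  continuous (fun s => Re (f s)) t /\ continuous (fun s => Im (f s)) t.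
Proof.
  split.
  - intros H. split.
    + exact (continuous_comp (V := CR) f (fst : CR -> R) t H (continuous_fst (fst (f t)) (snd (f t)))).
    + exact (continuous_comp (V := CR) f (snd : CR -> R) t H (continuous_snd (fst (f t)) (snd (f t)))).
  - intros [H1 H2]. apply continuous_path_eps. intros eps He.
    assert (He2 : (0 < eps / 2)%R) by lra.
    destruct (proj1 (filterlim_locally _ _) H1 (mkposreal _ He2)) as [d1 Hd1].
    destruct (proj1 (filterlim_locally _ _) H2 (mkposreal _ He2)) as [d2 Hd2].
    exists (Rmin d1 d2). split; [apply Rmin_pos; apply cond_pos|]. intros s Hs.
    specialize (Hd1 s (Rlt_le_trans _ _ _ Hs (Rmin_l _ _))).
    specialize (Hd2 s (Rlt_le_trans _ _ _ Hs (Rmin_r _ _))).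
    change (Rabs (Re (f s) - Re (f t)) < eps / 2)%R in Hd1.
    change (Rabs (Im (f s) - Im (f t)) < eps / 2)%R in Hd2.
    eapply Rle_lt_trans; [apply Cmod_le_abs_sum|].
    change (Re (f s - f t)) with (Re (f s) - Re (f t))%R.
    change (Im (f s - f t)) with (Im (f s) - Im (f t))%R. lra.
Qed.

Lemma continuous_path_mult (f g : R -> C) (t : R) :
  path_continuous f t -> path_continuous g t ->
  path_continuous (fun s => f s * g s) t.
Proof.
  rewrite !continuous_path_components. intros [H1 H2] [H3 H4]. split.
  - apply (continuous_minus (V := R_NormedModule)
      (fun s => Re (f s) * Re (g s))%R (fun s => Im (f s) * Im (g s))%R);
    now apply (continuous_mult (K := R_AbsRing)).
  - apply (continuous_plus (V := R_NormedModule)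
      (fun s => Re (f s) * Im (g s))%R (fun s => Im (f s) * Re (g s))%R);
    now apply (continuous_mult (K := R_AbsRing)).
Qed.

Lemma continuous_path_plus (f g : R -> C) (t : R) :
  path_continuous f t -> path_continuous g t ->
  path_continuous (fun s => f s + g s) t.
Proof. intros Hf Hg. exact (continuous_plus (V := CR) f g t Hf Hg). Qed.

Lemma continuous_path_const (c : C) (t : R) : path_continuous (fun _ => c) t.
Proof. exact (path_derive_continuous _ _ _ (path_derive_const c t)). Qed.

Lemma C_differential_inv (z : C) : z <> 0 -> C_differential Cinv z (- / (z * z)).
Proof.
  intros Hz eps He. assert (Hp : (0 < Cmod z)%R) by now apply Cmod_gt_0.
  set (d := Rmin (Cmod z / 2) (eps * Cmod z ^ 3 / 2)).
  assert (Hp3 : (0 < Cmod z ^ 3)%R) by now apply pow_lt.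
  exists d. split; [apply Rmin_pos; nra|]. intros w Hw.
  assert (D1 : (d <= Cmod z / 2)%R) by apply Rmin_l.
  assert (D2 : (d <= eps * Cmod z ^ 3 / 2)%R) by apply Rmin_r.
  assert (Hw1 : (Cmod z / 2 <= Cmod w)%R).
  { pose proof (Cmod_triangle w (z - w)) as T. replace (w + (z - w)) with z in T by ring.
    rewrite <- Cmod_opp in Hw. replace (- (w - z)) with (z - w) in Hw by ring. lra. }
  assert (Hw0 : w <> 0) by (intros ->; rewrite Cmod_0 in Hw1; lra).
  replace (/ w - / z - (w - z) * - / (z * z)) with ((w - z) / (w * (z * z)) * (w - z)) by (field; auto).
  rewrite Cmod_mult. apply Rmult_le_compat_r; [apply Cmod_ge_0|].
  rewrite Cmod_div, !Cmod_mult by (repeat apply Cmult_neq_0; auto).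
  apply Rmult_le_reg_r with (Cmod w * (Cmod z * Cmod z))%R; [nra|].
  unfold Rdiv at 1. rewrite Rmult_assoc, Rinv_l, Rmult_1_r by nra.
  apply Rle_trans with (eps * (Cmod z / 2 * (Cmod z * Cmod z)))%R; [simpl in *; nra|].
  apply Rmult_le_compat_l; [lra|]. apply Rmult_le_compat_r; nra.
Qed.

(** * Moebius paths interpolating between lines and circles *)

Definition path_den (lam tau x : R) : C := 1 - Ci * RtoC (lam * tau * x).

(* For lam = 0 the horizontal line at height tau. For lam = 1 the image of the circle of radius
   r = (1 - tau) / (1 + tau) under the Cayley transform, parametrized by x = tan (t / 2). *)
Definition path (lam tau x : R) : C := (RtoC x + Ci * RtoC tau) / path_den lam tau x.

(* The reciprocal of the derivative of [path], and its first two derivatives. *)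
Definition path_weight (lam tau x : R) : C :=
  path_den lam tau x * path_den lam tau x * RtoC (/ (1 - lam * tau ^ 2)).

Definition path_weight1 (lam tau x : R) : C :=
  - (2) * Ci * RtoC (lam * tau) * path_den lam tau x * RtoC (/ (1 - lam * tau ^ 2)).

Definition path_weight2 (lam tau : R) : C :=
  - (2) * RtoC (lam * tau) * RtoC (lam * tau) * RtoC (/ (1 - lam * tau ^ 2)).

Section Path.
Variables lam tau : R.
Hypotheses (Hlam : (0 <= lam <= 1)%R) (Htau : (Rabs tau <= / 2)%R).

(** The determinant of the Moebius transformation defining the path, whose derivative is therefore
    [d / den ^ 2]. *)
Let d : R := (1 - lam * tau ^ 2)%R.
Local Notation den := (path_den lam tau).
Local Notation q := (path_weight lam tau).
Local Notation q1 := (path_weight1 lam tau).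
Local Notation q2 := (path_weight2 lam tau).

Lemma path_scale_bounds : (/ 2 <= d <= 1)%R.
Proof.
  unfold d. rewrite <- (pow2_abs tau). pose proof (Rabs_pos tau).
  assert (0 <= Rabs tau ^ 2 <= / 2)%R by nra. nra.
Qed.

Lemma path_den_pair x : den x = (1, - (lam * tau * x))%R.
Proof. unfold path_den, Ci, RtoC, Cminus, Cplus, Copp, Cmult; simpl; f_equal; ring. Qed.

Lemma Cmod_path_den_ge x : (1 <= Cmod (den x))%R.
Proof.
  rewrite path_den_pair. eapply Rle_trans; [|apply (Rabs_Re_le_Cmod (1, - (lam * tau * x))%R)].
  simpl. rewrite Rabs_R1. lra.
Qed.

Lemma path_den_neq_0 x : den x <> 0.
Proof. intros H. pose proof (Cmod_path_den_ge x) as H'. rewrite H, Cmod_0 in H'. lra. Qed.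

Lemma path_den_derive x : path_derive den x (- Ci * RtoC (lam * tau)).
Proof.
  apply path_derive_ext with (fun t => 1 - Ci * RtoC (lam * tau) * RtoC t).
  { intros s. unfold path_den. rewrite (RtoC_mult (lam * tau) s). ring. }
  replace (- Ci * RtoC (lam * tau)) with
    (0 - (0 * RtoC x + Ci * RtoC (lam * tau) * 1)) by ring.
  apply path_derive_minus; [apply path_derive_const|].
  apply (path_derive_mult (fun _ => Ci * RtoC (lam * tau)) (fun t => RtoC t));
    [apply path_derive_const|exact (horizontal_derive 0 x)].
Qed.

Lemma path_weight_derive x : path_derive q x (q1 x).
Proof.
  replace (q1 x) with ((- Ci * RtoC (lam * tau) * den x + den x * (- Ci * RtoC (lam * tau))) * RtoC (/ d)
    + den x * den x * 0) by (unfold path_weight1; fold d; ring).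
  apply (path_derive_mult (fun s => den s * den s) (fun _ => RtoC (/ d))); [|apply path_derive_const].
  apply path_derive_mult; apply path_den_derive.
Qed.

Lemma path_weight1_derive x : path_derive q1 x q2.
Proof.
  replace q2 with ((0 * den x + (- (2) * Ci * RtoC (lam * tau)) * (- Ci * RtoC (lam * tau))) * RtoC (/ d)
    + (- (2) * Ci * RtoC (lam * tau) * den x) * 0).
  2:{ unfold path_weight2; fold d. transitivity (2 * (Ci * Ci) * RtoC (lam * tau) * RtoC (lam * tau) * RtoC (/ d));
      [ring|rewrite Ci_square; ring]. }
  apply (path_derive_mult (fun s => (- (2) * Ci * RtoC (lam * tau)) * den s) (fun _ => RtoC (/ d))); [|apply path_derive_const].
  apply (path_derive_mult (fun _ => - (2) * Ci * RtoC (lam * tau)) den); [apply path_derive_const|apply path_den_derive].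
Qed.

Lemma path_derive_path x : path_derive (path lam tau) x (/ q x).
Proof.
  assert (Hd : RtoC d <> 0) by (intros H; apply RtoC_inj in H; pose proof path_scale_bounds; lra).
  assert (Hd2 : (d <> 0)%R) by (pose proof path_scale_bounds; lra).
  replace (/ q x) with ((1 + 0) * / den x +
     (RtoC x + Ci * RtoC tau) * (- / (den x * den x) * (- Ci * RtoC (lam * tau)))).
  2:{ unfold path_weight; fold d. rewrite RtoC_inv by auto.
      transitivity ((den x + (Ci * RtoC x + (Ci * Ci) * RtoC tau) * RtoC (lam * tau)) / (den x * den x)).
      - field. apply path_den_neq_0.
      - rewrite Ci_square.
        replace (den x + (Ci * RtoC x + - RtoC 1 * RtoC tau) * RtoC (lam * tau)) with (RtoC d).
        + field. split; auto. apply path_den_neq_0.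
        + unfold path_den, d. rewrite RtoC_minus, !RtoC_mult, RtoC_pow. ring. }
  apply (path_derive_mult (fun t => RtoC t + Ci * RtoC tau) (fun t => / den t)).
  - apply path_derive_plus; [exact (horizontal_derive 0 x)|apply path_derive_const].
  - apply (path_derive_comp Cinv den); [apply C_differential_inv, path_den_neq_0|apply path_den_derive].
Qed.

Lemma path_weight_neq_0 x : q x <> 0.
Proof.
  unfold path_weight; fold d. pose proof path_scale_bounds.
  repeat apply Cmult_neq_0; try apply path_den_neq_0.
  intros E; apply RtoC_inj in E. pose proof (Rinv_0_lt_compat d ltac:(lra)). lra.
Qed.

(** The imaginary part of the path is [tau] times the positive factor
    [(1 + lam * x ^ 2) / (1 + s ^ 2)]. *)
Lemma path_half_plane pm x : half_plane pm (0, tau)%R -> half_plane pm (path lam tau x).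
Proof.
  set (s := (lam * tau * x)%R).
  assert (Hs : (0 < 1 + s * s)%R) by nra.
  assert (E : path lam tau x = ((x - tau * s) / (1 + s * s), tau * (1 + lam * (x * x)) / (1 + s * s))%R).
  { unfold path, path_den. fold s. unfold Cdiv, Cinv, RtoC, Ci, Cminus, Cplus, Copp, Cmult; simpl.
    f_equal; unfold s; field; unfold s in Hs; nra. }
  rewrite E.
  assert (Hp : (0 < (1 + lam * (x * x)) / (1 + s * s))%R) by (apply Rdiv_lt_0_compat; nra).
  destruct pm; simpl; intros H; unfold Rdiv in *; rewrite Rmult_assoc; nra.
Qed.

Variables (A x : R).
Hypotheses (HA : (0 < A)%R) (Hx : (Rabs x <= A)%R).

(** One crude constant for all first-order deviations in [tau] over [Rabs x <= A]: of the path from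
    the horizontal line, of the weight from 1, and of its derivatives from 0. *)
Let c : R := (4 * (A + 1) ^ 2)%R.

Lemma abs_lam_tau : (Rabs (lam * tau) <= Rabs tau)%R.
Proof. rewrite Rabs_mult, (Rabs_pos_eq lam) by lra. pose proof (Rabs_pos tau). nra. Qed.

Lemma abs_lam_tau_x : (Rabs (lam * tau * x) <= A * Rabs tau)%R.
Proof.
  rewrite Rabs_mult. pose proof abs_lam_tau. pose proof (Rabs_pos (lam * tau)). pose proof (Rabs_pos x). nra.
Qed.

Lemma Cmod_path_den_le : (Cmod (den x) <= 1 + A * Rabs tau)%R.
Proof.
  unfold path_den, Cminus. eapply Rle_trans; [apply Cmod_triangle|].
  rewrite Cmod_opp, Cmod_mult, Cmod_Ci, Cmod_1, Cmod_R. pose proof abs_lam_tau_x. lra.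
Qed.

Lemma inv_path_scale_le : (0 < / d <= 2)%R.
Proof.
  pose proof path_scale_bounds. split; [apply Rinv_0_lt_compat; lra|].
  replace 2%R with (/ / 2)%R by field. apply Rinv_le_contravar; lra.
Qed.

Lemma path_weight_close : (Cmod (q x - 1) <= c * Rabs tau)%R.
Proof.
  pose proof inv_path_scale_le as Hd. pose proof path_scale_bounds.
  replace (q x - 1) with ((- (2) * Ci * RtoC (lam * tau * x) - RtoC (lam * tau * x) * RtoC (lam * tau * x)
    + RtoC (lam * tau) * RtoC tau) * RtoC (/ d)).
  2:{ assert (Hid : RtoC d * RtoC (/ d) = 1) by (rewrite <- RtoC_mult; f_equal; apply Rinv_r; lra).
      transitivity (q x - RtoC d * RtoC (/ d)); [|now rewrite Hid].
      transitivity ((den x * den x - RtoC d) * RtoC (/ d)); [|unfold path_weight; fold d; ring].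
      f_equal. unfold path_den, d. rewrite RtoC_minus, !RtoC_mult, RtoC_pow.
      set (l := RtoC lam). set (t := RtoC tau). set (y := RtoC x).
      transitivity (- (2) * Ci * (l * t * y) + (Ci * Ci) * (l * t * y) * (l * t * y) + l * t * t);
        [rewrite Ci_square; ring|ring]. }
  rewrite Cmod_mult, Cmod_R, (Rabs_pos_eq (/ d)) by lra.
  assert (Hb : (Cmod (- (2) * Ci * RtoC (lam * tau * x) - RtoC (lam * tau * x) * RtoC (lam * tau * x)
    + RtoC (lam * tau) * RtoC tau) <= 2 * (A + 1) ^ 2 * Rabs tau)%R).
  { eapply Rle_trans; [apply Cmod_triangle|].
    eapply Rle_trans; [apply Rplus_le_compat_r, Cmod_triangle|].
    rewrite Cmod_opp, !Cmod_mult, Cmod_opp, Cmod_Ci, !Cmod_R, (Rabs_pos_eq 2) by lra.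
    pose proof abs_lam_tau_x. pose proof abs_lam_tau.
    pose proof (Rabs_pos tau). pose proof (Rabs_pos (lam * tau * x)). pose proof (Rabs_pos (lam * tau)).
    assert (Rabs (lam * tau * x) * Rabs (lam * tau * x) <= A * Rabs tau * (A * Rabs tau))%R by
      (apply Rmult_le_compat; lra).
    assert (Rabs (lam * tau) * Rabs tau <= Rabs tau * Rabs tau)%R by (apply Rmult_le_compat_r; lra).
    assert (Rabs tau * Rabs tau <= Rabs tau * / 2)%R by (apply Rmult_le_compat_l; lra).
    assert (A * A * (Rabs tau * Rabs tau) <= A * A * (Rabs tau * / 2))%R by (apply Rmult_le_compat_l; nra).
    nra. }
  unfold c. pose proof (Rabs_pos tau).
  pose proof (Cmod_ge_0 (- (2) * Ci * RtoC (lam * tau * x) - RtoC (lam * tau * x) * RtoC (lam * tau * x)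
    + RtoC (lam * tau) * RtoC tau)). nra.
Qed.

Lemma path_weight1_small : (Cmod (q1 x) <= c * Rabs tau)%R.
Proof.
  unfold path_weight1, c; fold d. pose proof inv_path_scale_le as Hd.
  rewrite !Cmod_mult, Cmod_opp, Cmod_Ci, !Cmod_R, (Rabs_pos_eq 2), (Rabs_pos_eq (/ d)) by lra.
  pose proof abs_lam_tau. pose proof Cmod_path_den_le. pose proof (Rabs_pos tau).
  pose proof (Rabs_pos (lam * tau)). pose proof (Cmod_ge_0 (den x)).
  assert (Rabs (lam * tau) * Cmod (den x) <= Rabs tau * (1 + A))%R by
    (apply Rmult_le_compat; nra).
  assert (0 <= Rabs (lam * tau) * Cmod (den x))%R by nra.
  replace (2 * 1 * Rabs (lam * tau) * Cmod (den x) * / d)%R with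
    (2 * (Rabs (lam * tau) * Cmod (den x)) * / d)%R by ring.
  apply Rle_trans with (2 * (Rabs (lam * tau) * Cmod (den x)) * 2)%R; [nra|].
  nra.
Qed.

Lemma path_weight2_small : (Cmod q2 <= c * Rabs tau)%R.
Proof.
  unfold path_weight2, c; fold d. pose proof inv_path_scale_le as Hd.
  rewrite !Cmod_mult, Cmod_opp, !Cmod_R, (Rabs_pos_eq 2), (Rabs_pos_eq (/ d)) by lra.
  pose proof abs_lam_tau. pose proof (Rabs_pos tau). pose proof (Rabs_pos (lam * tau)).
  assert (Rabs (lam * tau) * Rabs (lam * tau) <= Rabs tau * / 2)%R by (apply Rmult_le_compat; lra).
  assert (0 <= Rabs (lam * tau) * Rabs (lam * tau))%R by nra.
  replace (2 * Rabs (lam * tau) * Rabs (lam * tau) * / d)%R with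
    (2 * (Rabs (lam * tau) * Rabs (lam * tau)) * / d)%R by ring.
  apply Rle_trans with (2 * (Rabs (lam * tau) * Rabs (lam * tau)) * 2)%R; nra.
Qed.

Lemma path_close : (Cmod (path lam tau x - (x, tau)) <= c * Rabs tau)%R.
Proof.
  replace (path lam tau x - (x, tau)) with
    ((RtoC x + Ci * RtoC tau) * (Ci * RtoC (lam * tau * x)) / den x).
  2:{ replace (x, tau) with (RtoC x + Ci * RtoC tau)
        by (unfold Ci, RtoC, Cplus, Cmult; simpl; f_equal; ring).
      unfold path. replace (Ci * RtoC (lam * tau * x)) with (1 - den x) by (unfold path_den; ring). field. apply path_den_neq_0. }
  unfold Cdiv. rewrite !Cmod_mult, Cmod_Ci, Cmod_inv by apply path_den_neq_0.
  pose proof (Cmod_path_den_ge x). pose proof abs_lam_tau_x as Q1. pose proof (Rabs_pos tau).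
  assert (Q2 : (Cmod (RtoC x + Ci * RtoC tau) <= A + / 2)%R).
  { eapply Rle_trans; [apply Cmod_triangle|]. rewrite Cmod_mult, Cmod_Ci, !Cmod_R. lra. }
  pose proof (Cmod_ge_0 (RtoC x + Ci * RtoC tau)). pose proof (Rabs_pos (lam * tau * x)).
  assert (Q3 : (/ Cmod (den x) <= 1)%R) by (rewrite <- Rinv_1; apply Rinv_le_contravar; lra).
  assert (Q4 : (0 < / Cmod (den x))%R) by (apply Rinv_0_lt_compat; lra).
  rewrite Cmod_R.
  assert (Q5 : (Cmod (RtoC x + Ci * RtoC tau) * (1 * Rabs (lam * tau * x)) <= (A + / 2) * (A * Rabs tau))%R)
    by (apply Rmult_le_compat; lra).
  assert (0 <= Cmod (RtoC x + Ci * RtoC tau) * (1 * Rabs (lam * tau * x)))%R by nra.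
  unfold c. nra.
Qed.

(** The path moves away from [(x, tau)] by less than 1, which is why the strip has half width
    [A + 1]. *)
Lemma path_strip pm delta :
  half_plane pm (0, tau)%R -> (Rabs tau + c * Rabs tau < Rmin 1 delta)%R ->
  strip pm (A + 1) delta (path lam tau x).
Proof.
  intros Hpm Ht. pose proof path_close as Hc. bounds_Rmin 1%R delta.
  pose proof (Rabs_Re_le_Cmod (path lam tau x - (x, tau))) as H1.
  pose proof (Rabs_Im_le_Cmod (path lam tau x - (x, tau))) as H2.
  change (Re (path lam tau x - (x, tau))) with (Re (path lam tau x) - x)%R in H1.
  change (Im (path lam tau x - (x, tau))) with (Im (path lam tau x) - tau)%R in H2.
  pose proof (Rabs_pos tau).
  split; [|split; [now apply path_half_plane|]].
  - replace (Re (path lam tau x)) with ((Re (path lam tau x) - x) + x)%R by ring.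
    eapply Rle_lt_trans; [apply Rabs_triang|]. lra.
  - replace (Im (path lam tau x)) with ((Im (path lam tau x) - tau) + tau)%R by ring.
    eapply Rle_lt_trans; [apply Rabs_triang|]. lra.
Qed.

End Path.

(** * Boundary values along a family of paths *)

Lemma half_plane_axis pm (tau tau' : R) (x : R) :
  half_plane pm (x, tau) <-> half_plane pm (0%R, tau).
Proof. destruct pm; simpl; tauto. Qed.

(** Puts the two one-sided filters in one form, so that a single argument covers both signs. *)
Lemma to_axis_spec pm (P : R -> Prop) :
  to_axis pm P <-> exists eta, (0 < eta)%R /\
    forall tau, half_plane pm (0%R, tau) -> (Rabs tau < eta)%R -> P tau.
Proof.
  assert (Hb : forall t (e : posreal), ball 0%R e t <-> (Rabs t < e)%R).
  { intros t e. change (Rabs (t - 0) < e <-> Rabs t < e)%R. now rewrite Rminus_0_r. }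
  destruct pm; simpl; (split;
    [intros [e He]; exists e; split; [apply cond_pos|]; intros t H1 H2; apply He; auto; now apply Hb
    |intros [e [He H]]; exists (mkposreal _ He); intros t Ht Ht0; apply H; auto;
     exact (proj1 (Hb t (mkposreal _ He)) Ht)]).
Qed.

#[local] Instance to_axis_proper pm : ProperFilter (to_axis pm).
Proof. destruct pm; simpl; apply _. Qed.

Section BoundaryValue.

Variables (pm : side) (phi Phi1 Phi2 : C -> C) (A delta K : R).
Hypotheses (HA : (0 < A)%R) (Hdelta : (0 < delta)%R).
Hypothesis HPhi : double_primitive pm (A + 1) delta K phi Phi1 Phi2.
Hypothesis Hphi : differentiable_on (strip pm (A + 1) delta) phi.

Variables (E E1 E2 : R -> C).
Hypothesis HE1 : forall x, path_derive E x (E1 x).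
Hypothesis HE2 : forall x, path_derive E1 x (E2 x).
Hypothesis HE2c : forall x, path_continuous E2 x.
Hypothesis HE0 : forall x, (A <= Rabs x)%R -> E x = 0 /\ E1 x = 0.

(** Small enough that over [[-A, A]] every path with [0 <= lam <= 1] stays in the strip of the
    double primitive. *)
Definition admissible (tau : R) : Prop :=
  half_plane pm (0%R, tau) /\ (Rabs tau <= / 2)%R /\
  (Rabs tau + 4 * (A + 1) ^ 2 * Rabs tau < Rmin 1 delta)%R.

(** This is [((q E)' q)'] expanded by means of [q' = q1] and [q1' = q2]. *)
Let kernel (lam tau x : R) : C :=
  let q := path_weight lam tau x in
  let q1 := path_weight1 lam tau x in
  let q2 := path_weight2 lam tau in
  (q2 * E x + 2 * q1 * E1 x + q * E2 x) * q + (q1 * E x + q * E1 x) * q1.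

(* Two integrations by parts along the path, in the form of the derivative of
   [q E Phi1 - (q E)' q Phi2]. *)
Lemma integrate_by_parts lam tau :
  (0 <= lam <= 1)%R -> admissible tau ->
  exists I : C, is_CInt (fun x => E x * phi (path lam tau x)) (- A) A I /\
            is_CInt (fun x => kernel lam tau x * Phi2 (path lam tau x)) (- A) A I.
Proof.
  intros Hlam [Hpm [Htau Hsmall]].
  set (g := path lam tau). set (q := path_weight lam tau). set (q1 := path_weight1 lam tau).
  set (q2 := path_weight2 lam tau).
  assert (Hstrip : forall x, (- A <= x <= A)%R -> strip pm (A + 1) delta (g x)).
  { intros x Hx. apply path_strip; auto. apply Rabs_le; lra. }
  assert (Hg : forall x, path_derive g x (/ q x)) by (intros x; now apply path_derive_path).
  assert (Hgc : forall x, path_continuous g x)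
    by (intros x; exact (path_derive_continuous _ _ _ (Hg x))).
  assert (Hq : forall x, path_derive q x (q1 x)) by (intros x; now apply path_weight_derive).
  assert (Hqc : forall x, path_continuous q x)
    by (intros x; exact (path_derive_continuous _ _ _ (Hq x))).
  assert (Hq1 : forall x, path_derive q1 x q2) by (intros x; now apply path_weight1_derive).
  assert (Hq1c : forall x, path_continuous q1 x)
    by (intros x; exact (path_derive_continuous _ _ _ (Hq1 x))).
  assert (HEc : forall x, path_continuous E x)
    by (intros x; exact (path_derive_continuous _ _ _ (HE1 x))).
  assert (HE1c : forall x, path_continuous E1 x)
    by (intros x; exact (path_derive_continuous _ _ _ (HE2 x))).
  assert (Hr : forall x, (Rmin (- A) A <= x <= Rmax (- A) A)%R -> (- A <= x <= A)%R).
  { intros x Hx. rewrite Rmin_left, Rmax_right in Hx; lra. }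
  assert (C1 : forall x, (- A <= x <= A)%R ->
    path_continuous (fun x => E x * phi (g x)) x).
  { intros x Hx. apply continuous_path_mult; auto.
    destruct (Hphi _ (Hstrip x Hx)) as [l Hl]. now apply continuous_comp_path with l. }
  assert (C2 : forall x, (- A <= x <= A)%R ->
    path_continuous (fun x => kernel lam tau x * Phi2 (g x)) x).
  { intros x Hx. apply continuous_path_mult.
    - apply (continuous_path_plus (fun x => (q2 * E x + 2 * q1 x * E1 x + q x * E2 x) * q x)
        (fun x => (q1 x * E x + q x * E1 x) * q1 x)).
      + apply (continuous_path_mult (fun x => q2 * E x + 2 * q1 x * E1 x + q x * E2 x) q); auto.
        apply (continuous_path_plus (fun x => q2 * E x + 2 * q1 x * E1 x) (fun x => q x * E2 x));
          [|now apply continuous_path_mult].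
        apply (continuous_path_plus (fun x => q2 * E x) (fun x => 2 * q1 x * E1 x)).
        * apply (continuous_path_mult (fun _ => q2) E); auto. apply continuous_path_const.
        * apply (continuous_path_mult (fun x => 2 * q1 x) E1); auto.
          apply (continuous_path_mult (fun _ => RtoC 2) q1); auto. apply continuous_path_const.
      + apply (continuous_path_mult (fun x => q1 x * E x + q x * E1 x) q1); auto.
        apply (continuous_path_plus (fun x => q1 x * E x) (fun x => q x * E1 x));
          now apply continuous_path_mult.
    - destruct HPhi as [HP _]. destruct (HP _ (Hstrip x Hx)) as [_ [D _]].
      now apply continuous_comp_path with (Phi1 (g x)). }
  destruct (ex_CInt_continuous (fun x => E x * phi (g x)) (- A) A) as [I HI]; [now auto|].
  destruct (ex_CInt_continuous (fun x => kernel lam tau x * Phi2 (g x)) (- A) A) as [I' HI']; [now auto|].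
  exists I. split; auto. replace I with I'; auto.
  set (S := fun x => q x * E x * Phi1 (g x) - (q1 x * E x + q x * E1 x) * q x * Phi2 (g x)).
  assert (Hd : is_CInt (fun x => E x * phi (g x) - kernel lam tau x * Phi2 (g x)) (- A) A (S A - S (- A)%R)).
  { apply is_CInt_derive; intros x Hx; apply Hr in Hx.
    - destruct HPhi as [HP _]. destruct (HP _ (Hstrip x Hx)) as [D1 [D2 _]].
      assert (Hq0 : q x <> 0) by (now apply path_weight_neq_0).
      (* The new form is what the product rule yields for [S]; the factors [/ q x] come from the
         derivative of the path and cancel against [q x]. *)
      replace (E x * phi (g x) - kernel lam tau x * Phi2 (g x)) with
        (((q1 x * E x + q x * E1 x) * Phi1 (g x) + q x * E x * (phi (g x) * / q x)) -
         ((((q2 * E x + q1 x * E1 x) + (q1 x * E1 x + q x * E2 x)) * q x +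
           (q1 x * E x + q x * E1 x) * q1 x) * Phi2 (g x) +
          (q1 x * E x + q x * E1 x) * q x * (Phi1 (g x) * / q x))).
      + apply path_derive_minus.
        * apply (path_derive_mult (fun x => q x * E x) (fun x => Phi1 (g x)));
            [now apply path_derive_mult|now apply path_derive_comp].
        * apply (path_derive_mult (fun x => (q1 x * E x + q x * E1 x) * q x) (fun x => Phi2 (g x)));
            [|now apply path_derive_comp].
          apply (path_derive_mult (fun x => q1 x * E x + q x * E1 x) q); auto.
          apply path_derive_plus; now apply path_derive_mult.
      + unfold kernel. cbv zeta. fold q q1 q2. change (path_weight lam tau x) with (q x).
        change (path_weight1 lam tau x) with (q1 x). field. auto.
    - apply continuous_path_minus; auto. }
  assert (HS : S A - S (- A)%R = 0).
  { unfold S.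
    (* The boundary terms involve only [E] and [E1], and both vanish at the end points. *)
    destruct (HE0 A) as [Z1 Z2]; [rewrite Rabs_pos_eq; lra|].
    destruct (HE0 (- A)%R) as [Z3 Z4]; [rewrite Rabs_Ropp, Rabs_pos_eq; lra|].
    rewrite Z1, Z2, Z3, Z4. ring. }
  rewrite HS in Hd.
  assert (Heq : I - I' = RtoC 0)
    by exact (is_CInt_unique _ _ _ _ _ (is_CInt_minus _ _ _ _ _ _ HI HI') Hd).
  clear - Heq. change (@eq C I' I). transitivity (I - (I - I')); [ring|]. rewrite Heq. ring.
Qed.

Variable N : R.
Hypothesis HN : forall x, (- A <= x <= A)%R ->
  (Cmod (E x) <= N)%R /\ (Cmod (E1 x) <= N)%R /\ (Cmod (E2 x) <= N)%R.

Let c : R := (4 * (A + 1) ^ 2)%R.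

Lemma test_bound_nonneg : (0 <= N)%R.
Proof. destruct (HN 0%R) as [H _]; [lra|]. eapply Rle_trans; [apply Cmod_ge_0|exact H]. Qed.

(** Once [E2] is subtracted, every remaining coefficient contains one of [q - 1], [q1], [q2], all of
    size [c * Rabs tau]. *)
Lemma kernel_close lam tau x :
  (0 <= lam <= 1)%R -> admissible tau -> (- A <= x <= A)%R ->
  (Cmod (kernel lam tau x - E2 x) <= 8 * (1 + c) ^ 2 * N * Rabs tau)%R.
Proof.
  intros Hlam [Hpm [Htau Hsmall]] Hx.
  assert (HxA : (Rabs x <= A)%R) by (apply Rabs_le; lra).
  pose proof (path_weight_close lam tau Hlam Htau A x HxA) as B0.
  pose proof (path_weight1_small lam tau Hlam Htau A x HA HxA) as B1.
  pose proof (path_weight2_small lam tau Hlam Htau A HA) as B2.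
  fold c in B0, B1, B2. pose proof test_bound_nonneg as HN0.
  destruct (HN x Hx) as [N0 [N1 N2]].
  set (q := path_weight lam tau x) in *. set (q1 := path_weight1 lam tau x) in *.
  set (q2 := path_weight2 lam tau) in *. set (s := Rabs tau) in *.
  assert (Hs : (0 <= s <= / 2)%R) by (split; [apply Rabs_pos|exact Htau]).
  assert (Hc : (0 <= c)%R) by (unfold c; nra).
  assert (Bq : (Cmod q <= 1 + c)%R).
  { replace q with ((q - 1) + 1) by ring. eapply Rle_trans; [apply Cmod_triangle|].
    rewrite Cmod_1. nra. }
  replace (kernel lam tau x - E2 x) with
    ((q - 1) * (q + 1) * E2 x + 3 * (q * q1) * E1 x + (q * q2 + q1 * q1) * E x)
    by (unfold kernel; cbv zeta; fold q q1 q2; ring).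
  pose proof (Cmod_ge_0 q). pose proof (Cmod_ge_0 q1). pose proof (Cmod_ge_0 q2).
  assert (T1 : (Cmod ((q - 1) * (q + 1) * E2 x) <= (c * s * (2 + c)) * N)%R).
  { rewrite !Cmod_mult. apply Rmult_le_compat; auto; try apply Cmod_ge_0.
    - apply Rmult_le_pos; apply Cmod_ge_0.
    - apply Rmult_le_compat; try apply Cmod_ge_0; auto.
      eapply Rle_trans; [apply Cmod_triangle|]. rewrite Cmod_1. lra. }
  assert (T2 : (Cmod (3 * (q * q1) * E1 x) <= (3 * ((1 + c) * (c * s))) * N)%R).
  { rewrite !Cmod_mult, Cmod_R, (Rabs_pos_eq 3) by lra.
    apply Rmult_le_compat; auto; try apply Cmod_ge_0.
    - apply Rmult_le_pos; [lra|]. apply Rmult_le_pos; apply Cmod_ge_0.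
    - apply Rmult_le_compat_l; [lra|]. apply Rmult_le_compat; auto. }
  assert (T3 : (Cmod ((q * q2 + q1 * q1) * E x) <= ((1 + c) * (c * s) + (c * s) * (c * s)) * N)%R).
  { rewrite Cmod_mult. apply Rmult_le_compat; auto; try apply Cmod_ge_0.
    eapply Rle_trans; [apply Cmod_triangle|]. rewrite !Cmod_mult.
    apply Rplus_le_compat; apply Rmult_le_compat; auto. }
  eapply Rle_trans; [apply Cmod_triangle|].
  eapply Rle_trans; [apply Rplus_le_compat_r, Cmod_triangle|].
  assert (Hcs : (c * s * (c * s) <= c * s * c)%R).
  { apply Rmult_le_compat_l; nra. }
  replace (8 * (1 + c) ^ 2 * N * s)%R with ((8 * (1 + c) ^ 2 * s) * N)%R by ring.
  apply Rle_trans with ((c * s * (2 + c) + 3 * ((1 + c) * (c * s)) + ((1 + c) * (c * s) + c * s * c)) * N)%R.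
  - apply (Rmult_le_compat_r N) in Hcs; lra.
  - apply Rmult_le_compat_r; [lra|].
    assert (0 <= c * s)%R by nra. assert (0 <= c * (c * s))%R by nra. nra.
Qed.

(** The common yardstick: it does not depend on [lam], and all path integrals at parameter [tau] are
    compared with it. *)
Let J (tau : R) : C := CInt (fun x => E2 x * Phi2 (x, tau)) (- A) A.

Lemma admissible_strip tau x :
  admissible tau -> (- A <= x <= A)%R -> strip pm (A + 1) delta (x, tau).
Proof.
  intros [Hpm [Htau Hsmall]] Hx. pose proof (Rmin_r 1 delta). pose proof (Rabs_pos tau).
  assert (0 <= 4 * (A + 1) ^ 2 * Rabs tau)%R by nra.
  split; [|split].
  - apply Rabs_def1; simpl; lra.
  - now apply half_plane_axis.
  - simpl. lra.
Qed.

Lemma axis_integral_correct tau : admissible tau ->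
  is_CInt (fun x => E2 x * Phi2 (x, tau)) (- A) A (J tau).
Proof.
  intros Ht. apply CInt_correct. intros x [H1 H2].
  rewrite Rmin_left in H1 by lra. rewrite Rmax_right in H2 by lra.
  apply continuous_path_mult; auto.
  destruct HPhi as [HP _]. destruct (HP _ (admissible_strip tau x Ht ltac:(lra))) as [_ [D _]].
  now apply horizontal_continuous with (Phi1 (x, tau)).
Qed.

Lemma admissible_near : exists eta, (0 < eta)%R /\
  forall tau, half_plane pm (0%R, tau) -> (Rabs tau < eta)%R -> admissible tau.
Proof.
  assert (Hc : (0 <= c)%R) by (unfold c; nra).
  assert (Hm : (0 < Rmin 1 delta)%R) by (apply Rmin_pos; lra).
  exists (Rmin (/ 2) (Rmin 1 delta / (1 + c))). split.
  { apply Rmin_pos; [lra|]. apply Rdiv_lt_0_compat; lra. }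
  intros tau Hpm Ht. split; auto.
  bounds_Rmin (/ 2)%R (Rmin 1 delta / (1 + c))%R.
  split; [lra|]. fold c.
  apply Rlt_le_trans with (Rmin 1 delta / (1 + c) * (1 + c))%R.
  - replace (Rabs tau + c * Rabs tau)%R with (Rabs tau * (1 + c))%R by ring.
    apply Rmult_lt_compat_r; lra.
  - right; field; lra.
Qed.

Lemma primitive_bound_nonneg tau : admissible tau -> (0 <= K)%R.
Proof.
  intros Ht. destruct HPhi as [HP _].
  destruct (HP _ (admissible_strip tau 0 Ht ltac:(lra))) as [_ [_ D]].
  eapply Rle_trans; [apply Cmod_ge_0|exact D].
Qed.

Lemma axis_integral_close tau tau' : admissible tau -> admissible tau' -> (Rabs (tau' - tau) < delta)%R ->
  (Cmod (J tau' - J tau) <= 2 * A * (N * (K * sqrt (Rabs (tau' - tau)))))%R.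
Proof.
  intros Ht Ht' Hd. replace (2 * A)%R with (A - - A)%R by ring.
  apply is_CInt_le with (fun x => E2 x * Phi2 (x, tau') - E2 x * Phi2 (x, tau)); [lra| |].
  - intros x Hx. cbv beta.
    replace (E2 x * Phi2 (x, tau') - E2 x * Phi2 (x, tau)) with
      (E2 x * (Phi2 (x, tau') - Phi2 (x, tau))) by ring.
    assert (Hm : Cmod ((x, tau') - (x, tau)) = Rabs (tau' - tau)).
    { replace ((x, tau') - (x, tau)) with (Ci * RtoC (tau' - tau)).
      - now rewrite Cmod_mult, Cmod_Ci, Cmod_R, Rmult_1_l.
      - unfold Ci, RtoC, Cmult, Cminus, Cplus, Copp; simpl; f_equal; ring. }
    rewrite Cmod_mult. apply Rmult_le_compat; try apply Cmod_ge_0; [apply HN; lra|].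
    rewrite <- Hm. destruct HPhi as [_ HP].
    apply HP; try (apply admissible_strip; auto). now rewrite Hm.
  - apply is_CInt_minus; now apply axis_integral_correct.
Qed.

(** The error splits into the error of the kernel times the bounded [Phi2], and [E2] times the
    Hoelder difference of [Phi2] between the path and the line. *)
Lemma path_integral_close lam tau I :
  (0 <= lam <= 1)%R -> admissible tau -> (c * Rabs tau < delta)%R ->
  is_CInt (fun x => E x * phi (path lam tau x)) (- A) A I ->
  (Cmod (I - J tau) <=
   2 * A * (8 * (1 + c) ^ 2 * N * Rabs tau * K + N * (K * sqrt (c * Rabs tau))))%R.
Proof.
  intros Hlam Ht Hd HI. destruct (integrate_by_parts lam tau Hlam Ht) as [I' [HI1 HI2]].
  rewrite (is_CInt_unique _ _ _ _ _ HI HI1). clear I HI HI1.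
  replace (2 * A)%R with (A - - A)%R by ring.
  apply is_CInt_le with (fun x => kernel lam tau x * Phi2 (path lam tau x) - E2 x * Phi2 (x, tau)); [lra| |].
  - intros x Hx.
    replace (kernel lam tau x * Phi2 (path lam tau x) - E2 x * Phi2 (x, tau)) with
      ((kernel lam tau x - E2 x) * Phi2 (path lam tau x) +
       E2 x * (Phi2 (path lam tau x) - Phi2 (x, tau))) by ring.
    assert (HxA : (Rabs x <= A)%R) by (apply Rabs_le; lra).
    pose proof (admissible_strip tau x Ht Hx) as Hs.
    pose proof (kernel_close lam tau x Hlam Ht Hx) as Hk.
    destruct Ht as [Hpm [Htau Hsmall]].
    pose proof (path_strip lam tau Hlam Htau A x HxA pm delta Hpm Hsmall) as Hs'.
    pose proof (path_close lam tau Hlam Htau A x HxA) as Hc. fold c in Hc.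
    destruct HPhi as [HP HH]. destruct (HP _ Hs') as [_ [_ D]].
    eapply Rle_trans; [apply Cmod_triangle|]. rewrite !Cmod_mult.
    apply Rplus_le_compat; apply Rmult_le_compat; auto; try apply Cmod_ge_0; [apply HN; lra|].
    eapply Rle_trans; [apply HH; auto; lra|].
    apply Rmult_le_compat_l.
    + eapply Rle_trans; [apply Cmod_ge_0|exact D].
    + apply sqrt_le_1; auto; [apply Cmod_ge_0|].
      eapply Rle_trans; [apply Cmod_ge_0|exact Hc].
  - apply is_CInt_minus; auto. now apply axis_integral_correct.
Qed.

(** The first summand bounds the distance from a path integral to [J], the second the distance
    between two values of [J]. Their sum is continuous and vanishes at 0, so one modulus serves both
    the Cauchy criterion and the final comparison. *)
Lemma modulus_small (eps : R) : (0 < eps)%R -> (0 <= K)%R ->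
  exists eta, (0 < eta)%R /\ forall s, (0 <= s < eta)%R ->
    (2 * A * (8 * (1 + c) ^ 2 * N * s * K + N * (K * sqrt (c * s))) +
     2 * A * (N * (K * sqrt (2 * s))) < eps)%R.
Proof.
  intros He HK.
  set (m := fun s => (2 * A * (8 * (1 + c) ^ 2 * N * s * K + N * (K * sqrt (c * s))) +
     2 * A * (N * (K * sqrt (2 * s))))%R).
  assert (Hm0 : m 0%R = 0%R) by (unfold m; rewrite !Rmult_0_r, sqrt_0; ring).
  assert (Hm : continuity_pt m 0) by (unfold m; reg; lra).
  destruct (Hm eps He) as [eta [Heta H]]. exists eta. split; [exact Heta|].
  intros s Hs. change (m s < eps)%R. destruct (Req_dec s 0) as [->|Hs0]; [lra|].
  specialize (H s). simpl in H. unfold R_dist in H. rewrite Hm0, !Rminus_0_r in H.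
  eapply Rle_lt_trans; [apply Rle_abs|]. apply H. split; [split; [exact Logic.I|auto]|].
  rewrite Rabs_pos_eq; lra.
Qed.

Lemma axis_integral_le tau M : admissible tau -> (forall x, (- A <= x <= A)%R -> (Cmod (E2 x) <= M)%R) ->
  (Cmod (J tau) <= 2 * A * (M * K))%R.
Proof.
  intros Ht HM. replace (2 * A)%R with (A - - A)%R by ring.
  apply is_CInt_le with (fun x => E2 x * Phi2 (x, tau)); [lra| |now apply axis_integral_correct].
  intros x Hx. rewrite Cmod_mult. apply Rmult_le_compat; auto; try apply Cmod_ge_0.
  destruct HPhi as [HP _]. now destruct (HP _ (admissible_strip tau x Ht Hx)) as [_ [_ D]].
Qed.

(** The Cauchy criterion gives the limit [L] of [J], and the comparison with [J] transfers it to all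
    paths, uniformly in [lam]. The last clause, a bound by [E2] alone, becomes the continuity
    estimate of the distributions. *)
Lemma boundary_value : exists L : C,
  (forall eps, (0 < eps)%R -> exists eta, (0 < eta)%R /\ forall lam tau, (0 <= lam <= 1)%R -> half_plane pm (0%R, tau) -> (Rabs tau < eta)%R ->
       (forall x, (- A <= x <= A)%R -> exists l, C_differential phi (path lam tau x) l) /\
       exists I : C, is_CInt (fun x => E x * phi (path lam tau x)) (- A) A I /\ (Cmod (I - L) < eps)%R) /\ (forall M, (forall x, (- A <= x <= A)%R -> (Cmod (E2 x) <= M)%R) -> (Cmod L <= 2 * A * (M * K))%R).
Proof.
  destruct admissible_near as [eta0 [He0 Hadm]].
  assert (Hex : exists t, half_plane pm (0%R, t) /\ (Rabs t < eta0)%R).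
  { destruct pm; simpl.
    - exists (eta0 / 2)%R. rewrite Rabs_pos_eq; lra.
    - exists (- (eta0 / 2))%R. rewrite Rabs_Ropp, Rabs_pos_eq; lra. }
  assert (HK : (0 <= K)%R) by (destruct Hex as [t [H1 H2]]; apply (primitive_bound_nonneg t); auto).
  assert (Hc : (0 <= c)%R) by (unfold c; nra).
  assert (HJ : exists L : C, forall eps, (0 < eps)%R -> exists eta, (0 < eta)%R /\
    forall tau, half_plane pm (0%R, tau) -> (Rabs tau < eta)%R -> (Cmod (J tau - L) < eps)%R).
  { destruct (proj1 (filterlim_locally_cauchy (U := C_R_CompleteNormedModule) (F := to_axis pm) J)) as [L HL].
    - intros eps. destruct (modulus_small eps (cond_pos eps) HK) as [eta1 [He1 Hm]].
      exists (fun tau => half_plane pm (0%R, tau) /\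
        (Rabs tau < Rmin eta0 (Rmin eta1 (delta / 2)))%R).
      split.
      { apply to_axis_spec. exists (Rmin eta0 (Rmin eta1 (delta / 2))). split; auto.
        repeat apply Rmin_pos; lra. }
      bounds_Rmin eta0 (Rmin eta1 (delta / 2))%R.
      bounds_Rmin eta1 (delta / 2)%R.
      intros u v [Hu1 Hu2] [Hv1 Hv2].
      apply (norm_compat1 (V := CR)). rewrite norm_CR.
      assert (Huv : (Rabs (v - u) < delta)%R).
      { unfold Rminus. eapply Rle_lt_trans; [apply Rabs_triang|]. rewrite Rabs_Ropp. lra. }
      change (minus (J v) (J u)) with (J v - J u).
      eapply Rle_lt_trans; [apply axis_integral_close; auto; apply Hadm; auto; lra|].
      (* The difference of the two heights is at most [2 * s], whence the term [sqrt (2 * s)] of the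
         modulus. *)
      set (s := Rmax (Rabs u) (Rabs v)).
      assert (Hs : (0 <= s < eta1)%R).
      { split; [eapply Rle_trans; [apply Rabs_pos|apply Rmax_l]|]. apply Rmax_lub_lt; lra. }
      eapply Rle_lt_trans; [|apply (Hm s Hs)].
      pose proof test_bound_nonneg.
      assert (0 <= 2 * A * (8 * (1 + c) ^ 2 * N * s * K + N * (K * sqrt (c * s))))%R.
      { apply Rmult_le_pos; [lra|]. apply Rplus_le_le_0_compat.
        - repeat apply Rmult_le_pos; try lra; nra.
        - repeat apply Rmult_le_pos; try lra. apply sqrt_pos. }
      assert (sqrt (Rabs (v - u)) <= sqrt (2 * s))%R.
      { apply sqrt_le_1; [apply Rabs_pos|lra|]. unfold Rminus.
        eapply Rle_trans; [apply Rabs_triang|]. rewrite Rabs_Ropp.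
        assert (Rabs u <= s)%R by apply Rmax_l. assert (Rabs v <= s)%R by apply Rmax_r. lra. }
      assert (2 * A * (N * (K * sqrt (Rabs (v - u)))) <= 2 * A * (N * (K * sqrt (2 * s))))%R.
      { apply Rmult_le_compat_l; [lra|]. apply Rmult_le_compat_l; auto. now apply Rmult_le_compat_l. }
      lra.
    - exists L. intros eps He.
      apply (to_axis_spec pm (fun tau => (Cmod (J tau - L) < eps)%R)).
      apply (HL (fun z => (Cmod (z - L) < eps)%R)), locally_Cmod. now exists eps. }
  destruct HJ as [L HL]. exists L. split.
  - intros eps He.
    destruct (HL (eps / 2)%R ltac:(lra)) as [eta1 [He1 H1]].
    destruct (modulus_small (eps / 2)%R ltac:(lra) HK) as [eta2 [He2 H2]].
    set (eta3 := (delta / (c + 1))%R). assert (He3 : (0 < eta3)%R) by (apply Rdiv_lt_0_compat; lra).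
    exists (Rmin (Rmin eta0 eta1) (Rmin eta2 eta3)). split; [repeat apply Rmin_pos; auto|].
    intros lam tau Hlam Hpm Ht.
    bounds_Rmin (Rmin eta0 eta1)%R (Rmin eta2 eta3)%R.
    bounds_Rmin eta0 eta1.
    bounds_Rmin eta2 eta3.
    assert (Ha : admissible tau) by (apply Hadm; auto; lra).
    split.
    { intros x Hx. apply Hphi. destruct Ha as [_ [Ha1 Ha2]].
      apply path_strip; auto. apply Rabs_le; lra. }
    destruct (integrate_by_parts lam tau Hlam Ha) as [I [HI _]]. exists I. split; auto.
    assert (Hd : (c * Rabs tau < delta)%R).
    { pose proof (Rabs_pos tau). apply Rle_lt_trans with ((c + 1) * Rabs tau)%R; [nra|].
      apply Rlt_le_trans with ((c + 1) * eta3)%R; [apply Rmult_lt_compat_l; lra|].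
      right; unfold eta3; field; lra. }
    pose proof (path_integral_close lam tau I Hlam Ha Hd HI) as HC.
    specialize (H1 tau Hpm ltac:(lra)).
    specialize (H2 (Rabs tau) ltac:(split; [apply Rabs_pos|lra])).
    replace (I - L) with ((I - J tau) + (J tau - L)) by ring.
    eapply Rle_lt_trans; [apply Cmod_triangle|].
    pose proof test_bound_nonneg.
    assert (0 <= 2 * A * (N * (K * sqrt (2 * Rabs tau))))%R.
    { repeat apply Rmult_le_pos; try lra. apply sqrt_pos. }
    lra.
  - intros M HM. apply le_epsilon. intros eps He.
    destruct (HL eps He) as [eta1 [He1 H1]].
    assert (Hex1 : exists t, half_plane pm (0%R, t) /\ (Rabs t < Rmin eta0 eta1)%R).
    { pose proof (Rmin_pos _ _ He0 He1). destruct pm; simpl.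
      - exists (Rmin eta0 eta1 / 2)%R. rewrite Rabs_pos_eq; lra.
      - exists (- (Rmin eta0 eta1 / 2))%R. rewrite Rabs_Ropp, Rabs_pos_eq; lra. }
    destruct Hex1 as [t [Ht1 Ht2]].
    bounds_Rmin eta0 eta1.
    specialize (H1 t Ht1 ltac:(lra)).
    pose proof (axis_integral_le t M (Hadm t Ht1 ltac:(lra)) HM) as H2.
    replace L with (J t + - (J t - L)) by ring.
    eapply Rle_trans; [apply Cmod_triangle|]. rewrite Cmod_opp. lra.
Qed.

End BoundaryValue.

(** * Smooth functions *)

Section RealSmooth.
Local Open Scope R_scope.

(* [n] times differentiable near [x]: this only depends on the germ of [f] at [x], which makes the
   closure properties provable by induction on [n]. *)
Fixpoint Cn (n : nat) (f : R -> R) (x : R) : Prop :=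
  match n with
  | O => True
  | S n => exists f', locally x (fun t => is_derive f t (f' t)) /\ Cn n f' x
  end.

Definition smooth_at (f : R -> R) (x : R) : Prop := forall n, Cn n f x.

Lemma Cn_S n f x : Cn (S n) f x -> Cn n f x.
Proof.
  revert f; induction n; intros f; [easy|].
  intros [f' [H1 H2]]. exists f'. split; auto.
Qed.

Lemma Cn_ext n f g x : locally x (fun t => f t = g t) -> Cn n f x -> Cn n g x.
Proof.
  destruct n; [easy|]. intros He [f' [H1 H2]]. exists f'. split; auto.
  apply locally_locally in He. generalize (filter_and _ _ He H1). apply filter_imp.
  intros t [E D]. now apply (is_derive_ext_loc f).
Qed.

Lemma Cn_plus n f g x : Cn n f x -> Cn n g x -> Cn n (fun t => f t + g t) x.
Proof.
  revert f g; induction n; intros f g; [easy|].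
  intros [f' [F1 F2]] [g' [G1 G2]]. exists (fun t => f' t + g' t). split; auto.
  generalize (filter_and _ _ F1 G1). apply filter_imp. intros t [D1 D2].
  now apply (is_derive_plus (V := R_NormedModule)).
Qed.

Lemma Cn_mult n f g x : Cn n f x -> Cn n g x -> Cn n (fun t => f t * g t) x.
Proof.
  revert f g; induction n; intros f g; [easy|]. intros F G.
  pose proof (Cn_S _ _ _ F). pose proof (Cn_S _ _ _ G).
  destruct F as [f' [F1 F2]]. destruct G as [g' [G1 G2]].
  exists (fun t => f' t * g t + f t * g' t). split.
  - generalize (filter_and _ _ F1 G1). apply filter_imp. intros t [D1 D2].
    apply (is_derive_mult (K := R_AbsRing)); auto. intros; apply Rmult_comm.
  - apply (Cn_plus n (fun t => f' t * g t) (fun t => f t * g' t)); auto.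
Qed.

Lemma Cn_const n c x : Cn n (fun _ => c) x.
Proof.
  revert c; induction n; intros c; [easy|]. exists (fun _ => 0). split; auto.
  apply filter_forall. intros t. exact (is_derive_const (K := R_AbsRing) (V := R_NormedModule) c t).
Qed.

Lemma Cn_id n x : Cn n (fun t => t) x.
Proof.
  destruct n; [easy|]. exists (fun _ => 1). split; [|apply Cn_const].
  apply filter_forall. intros t. exact (is_derive_id (K := R_AbsRing) t).
Qed.

Lemma Cn_continuous n f x : Cn (S n) f x -> continuous f x.
Proof.
  intros [f' [H _]]. apply locally_singleton in H.
  apply (ex_derive_continuous (V := R_NormedModule)). now exists (f' x).
Qed.

(** Continuity of [g] pulls the neighborhood of [g x] where [f] is differentiable back to one of
    [x]. *)
Lemma Cn_comp n f g x : Cn n g x -> Cn n f (g x) -> Cn n (fun t => f (g t)) x.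
Proof.
  revert f g; induction n; intros f g; [easy|]. intros G F.
  pose proof (Cn_continuous _ _ _ G) as Hc. pose proof (Cn_S _ _ _ G).
  destruct F as [f' [F1 F2]]. destruct G as [g' [G1 G2]].
  exists (fun t => g' t * f' (g t)). split.
  - assert (F1' : locally x (fun t => is_derive f (g t) (f' (g t)))) by exact (Hc _ F1).
    generalize (filter_and _ _ F1' G1). apply filter_imp. intros t [D1 D2].
    exact (is_derive_comp (K := R_AbsRing) (V := R_NormedModule) f g t _ _ D1 D2).
  - apply (Cn_mult n g' (fun t => f' (g t))); auto.
Qed.

Lemma Cn_opp n f x : Cn n f x -> Cn n (fun t => - f t) x.
Proof.
  intros F. apply Cn_ext with (fun t => -1 * f t).
  - apply filter_forall. intros t. ring.
  - apply (Cn_mult n (fun _ => -1)); auto. apply Cn_const.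
Qed.

Lemma Cn_minus n f g x : Cn n f x -> Cn n g x -> Cn n (fun t => f t - g t) x.
Proof. intros F G. apply (Cn_plus n f (fun t => - g t)); auto. now apply Cn_opp. Qed.

Lemma locally_neq (x : R) : x <> 0 -> locally x (fun t => t <> 0).
Proof.
  intros Hx. assert (H : 0 < Rabs x) by now apply Rabs_pos_lt.
  exists (mkposreal _ H). intros t Ht E. subst t.
  change (Rabs (0 - x) < Rabs x) in Ht.
  unfold Rminus in Ht. rewrite Rplus_0_l, Rabs_Ropp in Ht. lra.
Qed.

Lemma Cn_Rinv n x : x <> 0 -> Cn n Rinv x.
Proof.
  intros Hx. induction n; [easy|]. exists (fun t => - (/ t * / t)). split.
  - generalize (locally_neq x Hx). apply filter_imp. intros t Ht.
    auto_derive; auto. field. auto.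
  - apply (Cn_opp n (fun t => / t * / t)), (Cn_mult n Rinv Rinv); auto.
Qed.

Lemma Cn_inv n f x : f x <> 0 -> Cn n f x -> Cn n (fun t => / f t) x.
Proof. intros H F. apply (Cn_comp n Rinv f); auto. now apply Cn_Rinv. Qed.

Lemma Cn_div n f g x : g x <> 0 -> Cn n f x -> Cn n g x -> Cn n (fun t => f t / g t) x.
Proof. intros H F G. apply (Cn_mult n f (fun t => / g t)); auto. now apply Cn_inv. Qed.

Lemma Cn_sqr n x : Cn n (fun t => t ^ 2) x.
Proof.
  apply Cn_ext with (fun t => t * t); [apply filter_forall; intros; ring|].
  apply (Cn_mult n (fun t => t) (fun t => t)); apply Cn_id.
Qed.

Lemma Cn_one_plus_sqr n x : Cn n (fun t => 1 + t ^ 2) x.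
Proof. apply (Cn_plus n (fun _ => 1)); [apply Cn_const|apply Cn_sqr]. Qed.

Lemma one_plus_sqr_neq_0 (x : R) : 1 + x ^ 2 <> 0.
Proof. nra. Qed.

Lemma Cn_atan n x : Cn n atan x.
Proof.
  destruct n; [easy|]. exists (fun t => / (1 + t ^ 2)). split.
  - apply filter_forall. intros t. apply is_derive_Reals.
    apply derivable_pt_lim_atan.
  - apply Cn_inv; [apply one_plus_sqr_neq_0|apply Cn_one_plus_sqr].
Qed.

(** [Cn] peels derivatives from the inside while [ex_derive_n] adds them on the outside;
    [Derive_n_comp] converts one into the other. *)
Lemma smooth_at_iff (f : R -> R) :
  (forall n x, ex_derive_n f n x) <-> (forall x, smooth_at f x).
Proof.
  split.
  - intros H x n. revert f H. induction n; intros f H; [easy|].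
    exists (Derive f). split.
    + apply filter_forall. intros t. apply Derive_correct, (H 1%nat t).
    + apply IHn. intros k t. destruct k; [easy|].
      pose proof (H (S (S k)) t) as H2. simpl in H2 |- *.
      apply (ex_derive_ext (Derive_n f (S k))); auto.
      intros s. pose proof (Derive_n_comp f k 1 s) as E. rewrite Nat.add_comm in E. now symmetry.
  - intros H n. revert f H. induction n; intros f H x; [easy|].
    destruct n; [destruct (H x 1%nat) as [f' [D _]]; apply locally_singleton in D; now exists (f' x)|].
    assert (Hd : forall x, smooth_at (Derive f) x).
    { intros t k. destruct (H t (S k)) as [f' [D1 D2]].
      apply Cn_ext with f'; auto. revert D1. apply filter_imp. intros s D.
      symmetry. now apply is_derive_unique. }
    specialize (IHn _ Hd x). simpl in IHn |- *.
    apply (ex_derive_ext (Derive_n (Derive f) n)); auto.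
    intros s. pose proof (Derive_n_comp f n 1 s) as E. now rewrite Nat.add_comm in E.
Qed.

(** ** A smooth step function *)

(** The powers of 1/x in front of exp (-1/x) are carried along because differentiation then stays
    within the family: the derivative of [flat k] is a combination of [flat (k + 2)] and
    [flat (k + 1)]. *)
Definition flat (k : nat) (x : R) : R :=
  if Rlt_dec 0 x then (/ x) ^ k * exp (- / x) else 0.

(** The inequality [u / n <= exp (u / n)], raised to the power [n]. *)
Lemma pow_le_exp (n : nat) (u : R) : (0 < n)%nat -> 0 <= u -> u ^ n <= INR n ^ n * exp u.
Proof.
  intros Hn Hu. apply lt_INR in Hn. simpl in Hn.
  replace (exp u) with (exp (u / INR n) ^ n).
  - rewrite <- Rpow_mult_distr. apply pow_incr. split; auto.
    pose proof (exp_ineq1_le (u / INR n)).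
    apply Rle_trans with (INR n * (u / INR n)); [right; field; lra|apply Rmult_le_compat_l; lra].
  - assert (H : forall k y, exp y ^ k = exp (INR k * y)).
    { induction k; intros y; [simpl; now rewrite Rmult_0_l, exp_0|].
      rewrite S_INR. simpl. rewrite IHk, <- exp_plus. f_equal. ring. }
    rewrite H. f_equal. field. lra.
Qed.

(** Quadratic decay at 0 makes the difference quotient there tend to 0; the exponent [k + 2] pays
    for the factor [(/ x) ^ k] and for this square. *)
Lemma flat_le (k : nat) (x : R) : Rabs (flat k x) <= INR (k + 2) ^ (k + 2) * x ^ 2.
Proof.
  unfold flat. destruct (Rlt_dec 0 x) as [Hx|Hx].
  - assert (Hi : 0 < / x) by now apply Rinv_0_lt_compat.
    rewrite Rabs_pos_eq.
    2:{ apply Rmult_le_pos; [apply pow_le; lra|apply Rlt_le, exp_pos]. }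
    pose proof (pow_le_exp (k + 2) (/ x) ltac:(lia) ltac:(lra)) as H.
    rewrite (pow_add (/ x)) in H.
    apply (Rmult_le_compat_r (exp (- / x) * x ^ 2)) in H.
    2:{ apply Rmult_le_pos; [apply Rlt_le, exp_pos|nra]. }
    replace ((/ x) ^ k * (/ x) ^ 2 * (exp (- / x) * x ^ 2)) with ((/ x) ^ k * exp (- / x)) in H
      by (field; lra).
    replace (INR (k + 2) ^ (k + 2) * exp (/ x) * (exp (- / x) * x ^ 2)) with
      (INR (k + 2) ^ (k + 2) * x ^ 2 * (exp (/ x) * exp (- / x))) in H by ring.
    rewrite <- exp_plus, Rplus_opp_r, exp_0, Rmult_1_r in H. exact H.
  - rewrite Rabs_R0. apply Rmult_le_pos; [apply pow_le, pos_INR|nra].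
Qed.

Lemma flat_derive (k : nat) (x : R) :
  is_derive (flat k) x (flat (k + 2) x - INR k * flat (k + 1) x).
Proof.
  destruct (total_order_T x 0) as [[Hx|Hx]|Hx].
  - replace (flat (k + 2) x - INR k * flat (k + 1) x) with 0.
    2:{ unfold flat. destruct (Rlt_dec 0 x); [lra|ring]. }
    apply (is_derive_ext_loc (fun _ => 0)).
    + exists (mkposreal (- x) ltac:(lra)). intros t Ht.
      change (Rabs (t - x) < - x) in Ht. apply Rabs_def2 in Ht.
      unfold flat. destruct (Rlt_dec 0 t); [lra|auto].
    + exact (is_derive_const (K := R_AbsRing) (V := R_NormedModule) 0 x).
  - subst x. replace (flat (k + 2) 0 - INR k * flat (k + 1) 0) with 0.
    2:{ unfold flat. destruct (Rlt_dec 0 0); [lra|ring]. }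
    assert (Hp : 0 < INR (k + 2) ^ (k + 2)) by (apply pow_lt, lt_0_INR; lia).
    apply is_derive_Reals. intros eps He.
    assert (Hd : 0 < eps / INR (k + 2) ^ (k + 2)) by (now apply Rdiv_lt_0_compat).
    exists (mkposreal _ Hd). intros h Hh0 Hh. simpl in Hh.
    rewrite Rplus_0_l. replace (flat k 0) with 0.
    2:{ unfold flat. destruct (Rlt_dec 0 0); [lra|auto]. }
    rewrite !Rminus_0_r. unfold Rdiv. rewrite Rabs_mult, Rabs_inv.
    assert (Hha : 0 < Rabs h) by now apply Rabs_pos_lt.
    apply Rmult_lt_reg_r with (Rabs h); auto.
    rewrite Rmult_assoc, Rinv_l, Rmult_1_r by lra.
    eapply Rle_lt_trans; [apply flat_le|]. rewrite <- (pow2_abs h).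
    apply (Rmult_lt_compat_l (INR (k + 2) ^ (k + 2))) in Hh; auto.
    replace (INR (k + 2) ^ (k + 2) * (eps / INR (k + 2) ^ (k + 2))) with eps in Hh by (field; lra).
    simpl. nra.
  - apply (is_derive_ext_loc (fun t => (/ t) ^ k * exp (- / t))).
    + exists (mkposreal x Hx). intros t Ht.
      change (Rabs (t - x) < x) in Ht. apply Rabs_def2 in Ht.
      unfold flat. destruct (Rlt_dec 0 t); [auto|lra].
    + unfold flat. destruct (Rlt_dec 0 x); [|lra].
      auto_derive; [split; [lra|split; [lra|auto]]|].
      rewrite !pow_add. destruct k; [simpl; field; lra|].
      rewrite S_INR. simpl. field. lra.
Qed.

Lemma Cn_flat n k x : Cn n (flat k) x.
Proof.
  revert k; induction n; intros k; [easy|].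
  exists (fun t => flat (k + 2) t - INR k * flat (k + 1) t). split.
  - apply filter_forall. intros t. apply flat_derive.
  - apply (Cn_minus n (flat (k + 2)) (fun t => INR k * flat (k + 1) t)); auto.
    apply (Cn_mult n (fun _ => INR k)); auto. apply Cn_const.
Qed.

Lemma flat_pos x : 0 < x -> 0 < flat 0 x.
Proof. intros Hx. unfold flat. destruct (Rlt_dec 0 x); [|lra]. simpl. rewrite Rmult_1_l. apply exp_pos. Qed.

Lemma flat_nonpos x : x <= 0 -> flat 0 x = 0.
Proof. intros Hx. unfold flat. destruct (Rlt_dec 0 x); lra. Qed.

(** Rises from 0 to 1 between -1/2 and 1/2. The denominator is even in [c], which yields the
    symmetry [step (- c) = 1 - step c]. *)
Definition step (c : R) : R := flat 0 (/ 2 + c) / (flat 0 (/ 2 + c) + flat 0 (/ 2 - c)).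

Lemma step_den c : 0 < flat 0 (/ 2 + c) + flat 0 (/ 2 - c).
Proof.
  assert (H : forall x, 0 <= flat 0 x).
  { intros x. destruct (Rlt_dec 0 x); [apply Rlt_le, flat_pos; lra|rewrite flat_nonpos; lra]. }
  destruct (Rle_dec c 0).
  - pose proof (H (/ 2 + c)). pose proof (flat_pos (/ 2 - c) ltac:(lra)). lra.
  - pose proof (H (/ 2 - c)). pose proof (flat_pos (/ 2 + c) ltac:(lra)). lra.
Qed.

Lemma Cn_step n c : Cn n step c.
Proof.
  assert (H1 : Cn n (fun t => flat 0 (/ 2 + t)) c).
  { apply (Cn_comp n (flat 0) (fun t => / 2 + t)); [|apply Cn_flat].
    apply (Cn_plus n (fun _ => / 2)); [apply Cn_const|apply Cn_id]. }
  assert (H2 : Cn n (fun t => flat 0 (/ 2 - t)) c).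
  { apply (Cn_comp n (flat 0) (fun t => / 2 - t)); [|apply Cn_flat].
    apply (Cn_minus n (fun _ => / 2)); [apply Cn_const|apply Cn_id]. }
  apply (Cn_div n (fun t => flat 0 (/ 2 + t)) (fun t => flat 0 (/ 2 + t) + flat 0 (/ 2 - t))); auto.
  - pose proof (step_den c). lra.
  - apply (Cn_plus n (fun t => flat 0 (/ 2 + t))); auto.
Qed.

(* As a function of the angle [t = 2 atan x] the argument of [step] is [cos t], so that the
   inversion exchanges [cutoff] and [1 - cutoff]. *)
Definition cutoff (x : R) : R := step ((1 - x ^ 2) / (1 + x ^ 2)).

Lemma Cn_cutoff n x : Cn n cutoff x.
Proof.
  apply (Cn_comp n step (fun x => (1 - x ^ 2) / (1 + x ^ 2))); [|apply Cn_step].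
  apply (Cn_div n (fun x => 1 - x ^ 2)); [apply one_plus_sqr_neq_0| |apply Cn_one_plus_sqr].
  apply (Cn_minus n (fun _ => 1)); [apply Cn_const|apply Cn_sqr].
Qed.

(** The argument of [step] is at most -3/5 there, to the left of the transition. *)
Lemma cutoff_support x : 2 <= Rabs x -> cutoff x = 0.
Proof.
  intros Hx. unfold cutoff, step. rewrite flat_nonpos; [unfold Rdiv; ring|].
  assert (Hx2 : 4 <= x ^ 2) by (rewrite <- (pow2_abs x); nra).
  apply Rmult_le_reg_r with (1 + x ^ 2); [lra|].
  rewrite Rmult_plus_distr_r. unfold Rdiv. rewrite Rmult_assoc, Rinv_l by lra. lra.
Qed.

Lemma step_opp c : step (- c) = 1 - step c.
Proof.
  unfold step. pose proof (step_den c). replace (/ 2 + - c) with (/ 2 - c) by ring.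
  replace (/ 2 - - c) with (/ 2 + c) by ring. field. lra.
Qed.

Lemma cutoff_inv x : x <> 0 -> cutoff (- / x) = 1 - cutoff x.
Proof.
  intros Hx. unfold cutoff. rewrite <- step_opp. f_equal. field.
  repeat split; auto; nra.
Qed.

Lemma cutoff_0 : cutoff 0 = 1.
Proof.
  unfold cutoff. replace ((1 - 0 ^ 2) / (1 + 0 ^ 2)) with 1 by field.
  unfold step. rewrite (flat_nonpos (/ 2 - 1)) by lra. pose proof (flat_pos (/ 2 + 1) ltac:(lra)).
  field. lra.
Qed.

End RealSmooth.

(** * Complex valued smooth functions *)

Definition csmooth_at (f : R -> C) (x : R) : Prop :=
  smooth_at (fun t => Re (f t)) x /\ smooth_at (fun t => Im (f t)) x.

Lemma smooth_iff (f : R -> C) : smooth f <-> (forall x, csmooth_at f x).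
Proof.
  split.
  - intros H x. split; apply smooth_at_iff; intros n t; apply H.
  - intros H n x. split; apply smooth_at_iff; intros t; apply H.
Qed.

Lemma csmooth_at_ext (f g : R -> C) (x : R) :
  locally x (fun t => f t = g t) -> csmooth_at f x -> csmooth_at g x.
Proof.
  intros H [H1 H2].
  split; intros n; [apply Cn_ext with (fun t => Re (f t))|apply Cn_ext with (fun t => Im (f t))]; auto;
    revert H; apply filter_imp; intros t Ht; now rewrite Ht.
Qed.

Lemma csmooth_at_mult (f g : R -> C) (x : R) :
  csmooth_at f x -> csmooth_at g x -> csmooth_at (fun t => f t * g t) x.
Proof.
  intros [H1 H2] [H3 H4]. split; intros n.
  - apply (Cn_minus n (fun t => Re (f t) * Re (g t))%R (fun t => Im (f t) * Im (g t))%R);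
      [apply (Cn_mult n (fun t => Re (f t)) (fun t => Re (g t)))
      |apply (Cn_mult n (fun t => Im (f t)) (fun t => Im (g t)))]; auto.
  - apply (Cn_plus n (fun t => Re (f t) * Im (g t))%R (fun t => Im (f t) * Re (g t))%R);
      [apply (Cn_mult n (fun t => Re (f t)) (fun t => Im (g t)))
      |apply (Cn_mult n (fun t => Im (f t)) (fun t => Re (g t)))]; auto.
Qed.

Lemma csmooth_at_RtoC (m : R -> R) (x : R) : smooth_at m x -> csmooth_at (fun t => RtoC (m t)) x.
Proof. intros H. split; [exact H|]. intros n. exact (Cn_const n 0 x). Qed.

Lemma csmooth_at_const (c : C) (x : R) : csmooth_at (fun _ => c) x.
Proof. split; intros n; apply Cn_const. Qed.

Lemma csmooth_at_comp (f : R -> C) (h : R -> R) (x : R) :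
  smooth_at h x -> csmooth_at f (h x) -> csmooth_at (fun t => f (h t)) x.
Proof.
  intros H [H1 H2]. split; intros n.
  - apply (Cn_comp n (fun t => Re (f t)) h); auto.
  - apply (Cn_comp n (fun t => Im (f t)) h); auto.
Qed.

Lemma smooth_mult_RtoC (f : R -> C) (m : R -> R) :
  smooth f -> (forall x, smooth_at m x) -> smooth (fun x => f x * RtoC (m x)).
Proof.
  rewrite !smooth_iff. intros Hf Hm x.
  apply (csmooth_at_mult f (fun t => RtoC (m t))); auto. now apply csmooth_at_RtoC.
Qed.

Lemma Dn_derive (f : R -> C) (n : nat) (x : R) : smooth f -> path_derive (Dn f n) x (Dn f (S n) x).
Proof.
  intros H. apply path_derive_components. unfold Dn; simpl. destruct (H (S n) x) as [H1 H2].
  split; apply Derive_correct; assumption.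
Qed.

Lemma Dn_0 (f : R -> C) (x : R) : Dn f 0 x = f x.
Proof. unfold Dn; simpl. now destruct (f x). Qed.

Lemma smooth_derive (f : R -> C) (x : R) : smooth f -> path_derive f x (Dn f 1 x).
Proof.
  intros H. apply path_derive_ext with (Dn f 0); [apply Dn_0|]. now apply Dn_derive.
Qed.

Lemma Dn_vanishes (f : R -> C) (n : nat) (A x : R) :
  (forall x, (A < Rabs x)%R -> f x = 0) -> (A < Rabs x)%R -> Dn f n x = 0.
Proof.
  intros Hf Hx.
  assert (Hl : locally x (fun t => f t = 0)).
  { exists (mkposreal (Rabs x - A) ltac:(lra)). intros t Ht. apply Hf.
    change (Rabs (t - x) < Rabs x - A)%R in Ht.
    pose proof (Rabs_triang_inv x (x - t)) as T. replace (x - (x - t))%R with t in T by (simpl; lra).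
    rewrite (Rabs_minus_sym x t) in T. lra. }
  unfold Dn.
  rewrite (Derive_n_ext_loc (fun t => Re (f t)) (fun _ => 0%R)), (Derive_n_ext_loc (fun t => Im (f t)) (fun _ => 0%R));
    [|revert Hl; apply filter_imp; intros t ->; reflexivity
     |revert Hl; apply filter_imp; intros t ->; reflexivity].
  destruct n; [reflexivity|]. now rewrite !Derive_n_const.
Qed.

Lemma continuous_bounded (f : R -> C) (A : R) :
  (forall x, path_continuous f x) -> exists N, forall x, (- A <= x <= A)%R -> (Cmod (f x) <= N)%R.
Proof.
  intros H. destruct (bounded_continuity (V := CR) f (- A) A) as [N HN].
  - intros x _. apply H.
  - exists N. intros x Hx. rewrite <- norm_CR. apply Rlt_le. now apply HN.
Qed.

(** * Behavior near the axis *)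

(** All that the estimates use of the hypotheses, stated at finite points and without the domain, so
    that it applies alike to [phi] and to its inversion. *)
Definition tame (pm : side) (phi : C -> C) : Prop :=
  forall x : R, exists delta M : R, (0 < delta)%R /\ forall z,
    (Rabs (Re z - x) < delta)%R -> half_plane pm z -> (Rabs (Im z) < delta)%R ->
    (exists l, C_differential phi z l) /\ (Cmod (phi z) * Rabs (Im z) <= M)%R.

(** Compactness of [[-A, A]], obtained by bisection of a rectangle of height 0: two neighboring
    intervals are merged with the smaller height and the larger bound. *)
Lemma tame_strip (pm : side) (phi : C -> C) (A : R) : (0 < A)%R -> tame pm phi ->
  exists delta M, (0 < delta)%R /\ differentiable_on (strip pm A delta) phi /\
    forall z, strip pm A delta z -> (Cmod (phi z) * Rabs (Im z) <= M)%R.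
Proof.
  intros HA H.
  destruct (bisection (fun a b _ _ => exists delta M, (0 < delta)%R /\ forall z,
    (a <= Re z <= b)%R -> half_plane pm z -> (Rabs (Im z) < delta)%R ->
    (exists l, C_differential phi z l) /\ (Cmod (phi z) * Rabs (Im z) <= M)%R)
    (- A)%R A 0%R 0%R) as [d [M [Hd HM]]]; try lra.
  - intros a b c d _ m n [d1 [M1 [Hd1 H1]]] [d2 [M2 [Hd2 H2]]] _ _.
    exists (Rmin d1 d2), (Rmax M1 M2). split; [now apply Rmin_pos|].
    intros z Hz Hpm Hi. bounds_Rmin d1 d2.
    bounds_Rmax M1 M2.
    destruct (Rle_dec (Re z) m).
    + destruct (H1 z ltac:(lra) Hpm ltac:(lra)). split; auto. lra.
    + destruct (H2 z ltac:(lra) Hpm ltac:(lra)). split; auto. lra.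
  - intros x y _ _. destruct (H x) as [d [M [Hd H1]]]. exists d. split; auto.
    intros a b c e _ Hx _ Hab _. exists d, M. split; auto.
    intros z Hz. apply H1. apply Rabs_def1; lra.
  - exists d, M. split; auto. split.
    + intros z [H1 [H2 H3]]. apply Rabs_def2 in H1. apply HM; auto; lra.
    + intros z [H1 [H2 H3]]. apply Rabs_def2 in H1. apply HM; auto; lra.
Qed.

(** The constant [c] is chosen before [E]: this uniformity is the continuity required of a
    distribution. *)
Lemma tame_limit (pm : side) (phi : C -> C) (A : R) : (0 < A)%R -> tame pm phi ->
  exists c, (0 <= c)%R /\ forall E, smooth E -> (forall x, (A < Rabs x)%R -> E x = 0) ->
  exists L : C,
    (forall eps, (0 < eps)%R -> exists eta, (0 < eta)%R /\
       forall lam tau, (0 <= lam <= 1)%R -> half_plane pm (0%R, tau) -> (Rabs tau < eta)%R ->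
       (forall x, (- (A + 1) <= x <= A + 1)%R -> exists l, C_differential phi (path lam tau x) l) /\
       exists I : C, is_CInt (fun x => E x * phi (path lam tau x)) (- (A + 1)) (A + 1) I /\
         (Cmod (I - L) < eps)%R) /\
    (forall M, (forall k x, (k <= 2)%nat -> (Cmod (Dn E k x) <= M)%R) -> (Cmod L <= c * M)%R).
Proof.
  intros HA Ht.
  (* One unit makes [E] and its derivative vanish at the ends [A + 1] of the integral; the other is
     the room that the curved paths need. *)
  destruct (tame_strip pm phi (A + 1 + 1) ltac:(lra) Ht) as [d [M0 [Hd [H1 H2]]]].
  destruct (double_primitive_exists pm phi (A + 1 + 1) d M0 ltac:(lra) Hd H1 H2)
    as [Phi1 [Phi2 [K HPhi]]].
  exists (2 * (A + 1) * Rmax K 0)%R. split.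
  { pose proof (Rmax_r K 0). nra. }
  intros E HE HE0.
  assert (Hcont : forall k x, path_continuous (Dn E k) x).
  { intros k x. exact (path_derive_continuous _ _ _ (Dn_derive E k x HE)). }
  assert (HN : exists N, forall x, (- (A + 1) <= x <= A + 1)%R ->
    (Cmod (E x) <= N)%R /\ (Cmod (Dn E 1 x) <= N)%R /\ (Cmod (Dn E 2 x) <= N)%R).
  { destruct (continuous_bounded (Dn E 0) (A + 1) (Hcont 0%nat)) as [N0 B0].
    destruct (continuous_bounded (Dn E 1) (A + 1) (Hcont 1%nat)) as [N1 B1].
    destruct (continuous_bounded (Dn E 2) (A + 1) (Hcont 2%nat)) as [N2 B2].
    exists (Rmax N0 (Rmax N1 N2)). intros x Hx.
    bounds_Rmax N0 (Rmax N1 N2)%R.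
    bounds_Rmax N1 N2.
    specialize (B0 x Hx). rewrite Dn_0 in B0. specialize (B1 x Hx). specialize (B2 x Hx).
    repeat split; lra. }
  destruct HN as [N HN].
  destruct (boundary_value pm phi Phi1 Phi2 (A + 1) (d / 3) K ltac:(lra) ltac:(lra) HPhi) with
    (E := E) (E1 := Dn E 1) (E2 := Dn E 2) (N := N) as [L [HL1 HL2]]; auto.
  - intros z [Z1 [Z2 Z3]]. apply H1. split; auto. split; auto. lra.
  - intros x. now apply smooth_derive.
  - intros x. now apply Dn_derive.
  - intros x Hx. split; [apply HE0; lra|]. apply (Dn_vanishes E 1 A); auto. lra.
  - exists L. split; auto. intros M HM.
    assert (HM0 : (0 <= M)%R) by (eapply Rle_trans; [apply Cmod_ge_0|apply (HM O 0%R); lia]).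
    eapply Rle_trans; [apply (HL2 M); intros x _; apply HM; lia|].
    pose proof (Rmax_l K 0).
    replace (2 * (A + 1) * Rmax K 0 * M)%R with (2 * (A + 1) * (M * Rmax K 0))%R by ring.
    apply Rmult_le_compat_l; [lra|]. now apply Rmult_le_compat_l.
Qed.

(** * Limits of integrals *)

Lemma filterlimi_C {T : Type} (F : (T -> Prop) -> Prop) {FF : Filter F} (I : T -> C -> Prop) (l : C) :
  filterlimi I F (@locally C_UniformSpace l) <->
  forall eps, (0 < eps)%R -> F (fun y => exists z, I y z /\ (Cmod (z - l) < eps)%R).
Proof.
  split.
  - intros H eps He. apply (H (fun z => (Cmod (z - l) < eps)%R)), locally_Cmod. now exists eps.
  - intros H P HP. apply locally_Cmod in HP. destruct HP as [e [He0 He]].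
    change (F (fun y => exists z, I y z /\ P z)).
    generalize (H e He0). apply filter_imp. intros y [z [H1 H2]].
    exists z. auto.
Qed.

Lemma filterlimi_C_unique {T : Type} (F : (T -> Prop) -> Prop) {FF : ProperFilter F}
    (I : T -> C -> Prop) (l m : C) :
  (forall y z z', I y z -> I y z' -> z = z') ->
  filterlimi I F (@locally C_UniformSpace l) -> filterlimi I F (@locally C_UniformSpace m) -> l = m.
Proof.
  intros HI. rewrite !filterlimi_C by apply _. intros Hl Hm.
  assert (E : (Cmod (l - m) <= 0)%R).
  { apply le_epsilon. intros eps He. rewrite Rplus_0_l.
    assert (He2 : (0 < eps / 2)%R) by lra.
    destruct (filter_ex _ (filter_and _ _ (Hl _ He2) (Hm _ He2)))
      as [y [[z [Z1 Z2]] [z' [Z3 Z4]]]].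
    rewrite <- (HI y z z' Z1 Z3) in Z4.
    replace (l - m) with (- (z - l) + (z - m)) by ring.
    eapply Rle_trans; [apply Cmod_triangle|]. rewrite Cmod_opp. lra. }
  assert (E0 : l - m = 0) by (apply Cmod_eq_0, Rle_antisym; [exact E|apply Cmod_ge_0]).
  replace l with ((l - m) + m) by ring. rewrite E0. ring.
Qed.

Lemma filterlimi_C_lin {T : Type} (F : (T -> Prop) -> Prop) {FF : Filter F} (I1 I2 I3 : T -> C -> Prop)
    (a l1 l2 : C) :
  (forall y z1 z2, I1 y z1 -> I2 y z2 -> I3 y (a * z1 + z2)) ->
  filterlimi I1 F (@locally C_UniformSpace l1) -> filterlimi I2 F (@locally C_UniformSpace l2) ->
  filterlimi I3 F (@locally C_UniformSpace (a * l1 + l2)).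
Proof.
  intros HI. rewrite !filterlimi_C by apply _. intros H1 H2 eps He.
  pose proof (Cmod_ge_0 a).
  assert (He' : (0 < eps / 2 / (Cmod a + 1))%R) by (apply Rdiv_lt_0_compat; lra).
  assert (He2 : (0 < eps / 2)%R) by lra.
  generalize (filter_and _ _ (H1 _ He') (H2 _ He2)). apply filter_imp.
  intros y [[z1 [Z1 Z2]] [z2 [Z3 Z4]]]. exists (a * z1 + z2). split; auto.
  replace (a * z1 + z2 - (a * l1 + l2)) with (a * (z1 - l1) + (z2 - l2)) by ring.
  eapply Rle_lt_trans; [apply Cmod_triangle|]. rewrite Cmod_mult.
  assert (Cmod a * Cmod (z1 - l1) <= eps / 2)%R.
  { apply Rle_trans with ((Cmod a + 1) * (eps / 2 / (Cmod a + 1)))%R.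
    - apply Rmult_le_compat; try apply Cmod_ge_0; lra.
    - right; field; lra. }
  lra.
Qed.

(** The limit is kept as a relation between a test function and a value, with the integrability of
    the approximants built in. *)
Definition line_limit (pm : side) (phi : C -> C) (f : R -> C) (l : C) : Prop :=
  filterlimi
    (fun (y : R) (l : C) =>
       is_RInt_gen (V := CR) (fun x : R => f x * phi (x, y))
         (Rbar_locally m_infty) (Rbar_locally p_infty) l)
    (to_axis pm) (@locally C_UniformSpace l).

Definition circle_limit (pm : side) (Phi : C -> C) (g : R -> C) (l : C) : Prop :=
  filterlimi
    (fun (r : R) (l : C) =>
       is_CInt (fun t : R => g t * Phi (r * cos t, r * sin t)%R) (- PI) PI l)
    (to_circle pm) (@locally C_UniformSpace l).

#[local] Instance to_circle_proper pm : ProperFilter (to_circle pm).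
Proof. destruct pm; simpl; apply _. Qed.

Lemma is_RInt_gen_unique_C (f : R -> C) (l m : C) :
  is_RInt_gen (V := CR) f (Rbar_locally m_infty) (Rbar_locally p_infty) l ->
  is_RInt_gen (V := CR) f (Rbar_locally m_infty) (Rbar_locally p_infty) m -> l = m.
Proof.
  intros H1 H2.
  apply (is_RInt_gen_unique (V := C_R_CompleteNormedModule)) in H1; try apply _.
  apply (is_RInt_gen_unique (V := C_R_CompleteNormedModule)) in H2; try apply _.
  congruence.
Qed.

Lemma line_limit_unique pm phi f l m : line_limit pm phi f l -> line_limit pm phi f m -> l = m.
Proof.
  apply filterlimi_C_unique; [apply to_axis_proper|]. intros y z z'. apply is_RInt_gen_unique_C.
Qed.

Lemma circle_limit_unique pm Phi g l m : circle_limit pm Phi g l -> circle_limit pm Phi g m -> l = m.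
Proof.
  apply filterlimi_C_unique; [apply to_circle_proper|]. intros y z z'. apply is_CInt_unique.
Qed.

Lemma circle_limit_lin pm Phi (a : C) f g l m :
  circle_limit pm Phi f l -> circle_limit pm Phi g m ->
  circle_limit pm Phi (fun t => a * f t + g t) (a * l + m).
Proof.
  apply filterlimi_C_lin; [apply filter_filter|]. intros r z1 z2 H1 H2.
  apply (is_CInt_ext (fun t => a * (f t * Phi (r * cos t, r * sin t)%R) + g t * Phi (r * cos t, r * sin t)%R)).
  - intros t _. ring.
  - apply (is_CInt_lin a (fun t => f t * Phi (r * cos t, r * sin t)%R)); auto.
Qed.

Lemma is_RInt_gen_compact (f : R -> C) (A : R) (l : C) :
  (0 < A)%R -> (forall x, (A < Rabs x)%R -> f x = 0) -> is_CInt f (- A) A l ->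
  is_RInt_gen (V := CR) f (Rbar_locally m_infty) (Rbar_locally p_infty) l.
Proof.
  intros HA Hf HI P HP.
  exists (fun a => (a < - A)%R) (fun b => (A < b)%R).
  - exists (- A)%R. auto.
  - exists A. auto.
  - intros a b Ha Hb. exists l. split; [|now apply locally_singleton in HP].
    simpl. replace l with (0 + l + 0) by ring.
    apply is_CInt_Chasles with A; [apply is_CInt_Chasles with (- A)%R; auto|].
    + apply is_CInt_ext with (fun _ => RtoC 0); [|apply is_CInt_zero].
      intros x Hx. rewrite Rmin_left, Rmax_right in Hx by lra.
      rewrite Hf; auto. rewrite Rabs_left1 by lra. lra.
    + apply is_CInt_ext with (fun _ => RtoC 0); [|apply is_CInt_zero].
      intros x Hx. rewrite Rmin_left, Rmax_right in Hx by lra.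
      rewrite Hf; auto. rewrite Rabs_pos_eq by lra. lra.
Qed.

Lemma line_limit_lin pm phi (a : C) f g l m :
  line_limit pm phi f l -> line_limit pm phi g m ->
  line_limit pm phi (fun x => a * f x + g x) (a * l + m).
Proof.
  apply filterlimi_C_lin; [apply filter_filter|]. intros y z1 z2.
  (* The improper integral is itself a relational limit over pairs of end points, so linearity of
     limits is applied a second time. *)
  intros Z1 Z2. refine (filterlimi_C_lin _ _ _ _ a z1 z2 _ Z1 Z2). intros [b c] w1 w2 H1 H2. simpl in *.
  apply (is_CInt_ext (fun x => a * (f x * phi (x, y)) + g x * phi (x, y))).
  - intros x _. ring.
  - apply (is_CInt_lin a (fun x => f x * phi (x, y))); auto.
Qed.

Lemma circle_limit_ext pm Phi f g l : (forall t, (- PI < t < PI)%R -> f t = g t) ->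
  circle_limit pm Phi f l -> circle_limit pm Phi g l.
Proof.
  intros H. unfold circle_limit. rewrite !filterlimi_C by apply filter_filter.
  intros Hf eps He. generalize (Hf eps He). apply filter_imp. intros r [z [H1 H2]].
  exists z. split; auto. revert H1. apply is_CInt_ext. intros t Ht.
  pose proof PI_RGT_0. rewrite Rmin_left, Rmax_right in Ht by lra. now rewrite H.
Qed.

(** * From lines to circles through the Cayley transform *)

Lemma path_0 (tau x : R) : path 0 tau x = (x, tau).
Proof.
  unfold path, path_den. rewrite !Rmult_0_l.
  replace (x, tau) with (RtoC x + Ci * RtoC tau)
    by (unfold Ci, RtoC, Cplus, Cmult; simpl; f_equal; ring).
  field.
Qed.

Lemma cos_sin_half (t : R) :
  (cos t = cos (t / 2) * cos (t / 2) - sin (t / 2) * sin (t / 2) /\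
   sin t = 2 * sin (t / 2) * cos (t / 2) /\
   cos (t / 2) * cos (t / 2) + sin (t / 2) * sin (t / 2) = 1)%R.
Proof.
  split; [|split].
  - replace t with (2 * (t / 2))%R at 1 by field. apply cos_2a.
  - replace t with (2 * (t / 2))%R at 1 by field. apply sin_2a.
  - pose proof (sin2_cos2 (t / 2)) as H. unfold Rsqr in H. lra.
Qed.

(** With [u] the point of angle t/2 on the unit circle and z = r u^2, both 1 - z and 1 + z are
    divisible by [u]. The quotient of the cofactors [q] and [p], each divided by
    [(1 + r) * cos (t / 2)], is the path in the variable [tan (t / 2)]. *)
Lemma cayley_path (phi : C -> C) (r t : R) : (0 < r)%R -> cos (t / 2) <> 0%R ->
  cayley phi (r * cos t, r * sin t)%R = - Ci * phi (path 1 ((1 - r) / (1 + r)) (tan (t / 2))).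
Proof.
  intros Hr Hc. unfold cayley. f_equal. f_equal.
  destruct (cos_sin_half t) as [Ec [Es E1]]. rewrite Ec, Es.
  unfold tan. set (c := cos (t / 2)) in *. set (s := sin (t / 2)) in *.
  set (tau := ((1 - r) / (1 + r))%R).
  set (u := (c, s) : C).
  set (p := ((1 + r) * c, - ((1 - r) * s))%R : C).
  set (q := ((1 - r) * c, - ((1 + r) * s))%R : C).
  replace (1 - (r * (c * c - s * s), r * (2 * s * c))%R) with (u * q).
  2:{ unfold u, q, RtoC, Cminus, Cplus, Copp, Cmult; simpl. f_equal; [|ring].
      transitivity (c * c + s * s - r * (c * c - s * s))%R; [ring|rewrite E1; ring]. }
  replace (1 + (r * (c * c - s * s), r * (2 * s * c))%R) with (u * p).
  2:{ unfold u, p, RtoC, Cminus, Cplus, Copp, Cmult; simpl. f_equal; [|ring].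
      transitivity (c * c + s * s + r * (c * c - s * s))%R; [ring|rewrite E1; ring]. }
  assert (Hu : u <> 0).
  { unfold u, RtoC. intros E. injection E as E2 E3. contradiction. }
  assert (Hp : p <> 0).
  { unfold p, RtoC. intros E. injection E as E2 E3. apply Rmult_integral in E2. destruct E2; lra. }
  transitivity (Ci * (q / p)); [field; auto|].
  unfold path. set (d := path_den 1 tau (s / c)).
  set (k := RtoC ((1 + r) * c)).
  assert (Hk : k <> 0).
  { unfold k. intros E. apply RtoC_inj in E. apply Rmult_integral in E. destruct E; lra. }
  assert (Ep : p = k * d).
  { unfold p, k, d, path_den, tau, Ci, RtoC, Cminus, Cplus, Copp, Cmult; simpl. f_equal; field; split; auto; lra. }
  assert (Eq : Ci * q = k * (RtoC (s / c) + Ci * RtoC tau)).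
  { unfold q, k, tau, Ci, RtoC, Cminus, Cplus, Copp, Cmult; simpl. f_equal; field; split; auto; lra. }
  assert (Hd : d <> 0) by (intros E; apply Hp; rewrite Ep, E; ring).
  transitivity (Ci * q / p); [field; auto|]. rewrite Eq, Ep. field. auto.
Qed.

(** The Jacobian dt/dx of t = 2 atan x. *)
Definition density (x : R) : R := (2 / (1 + x ^ 2))%R.

Lemma smooth_density (x : R) : smooth_at density x.
Proof.
  intros n. apply (Cn_div n (fun _ => 2%R)); [apply one_plus_sqr_neq_0|apply Cn_const|apply Cn_one_plus_sqr].
Qed.

Lemma cos_half_pos (t : R) : (- PI < t < PI)%R -> (0 < cos (t / 2))%R.
Proof. intros Ht. apply cos_gt_0; lra. Qed.

Lemma tan_half_lt (a : R) (t : R) : (2 * atan a < t < PI)%R -> (a < tan (t / 2))%R.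
Proof.
  intros Ht. pose proof (atan_bound a). rewrite <- (tan_atan a).
  apply tan_increasing; lra.
Qed.

Lemma tan_half_abs (A t : R) : (2 * atan A < Rabs t < PI)%R -> (A < Rabs (tan (t / 2)))%R.
Proof.
  intros Ht. destruct (Rle_dec 0 t).
  - rewrite Rabs_pos_eq in Ht by lra. eapply Rlt_le_trans; [now apply tan_half_lt|apply Rle_abs].
  - rewrite Rabs_left in Ht by lra.
    rewrite <- Rabs_Ropp, <- tan_neg. eapply Rlt_le_trans; [|apply Rle_abs].
    replace (- (t / 2))%R with (- t / 2)%R by field. now apply tan_half_lt.
Qed.

(** The substitution x = tan (t/2) on the arc corresponding to [[-A, A]]; on the two remaining arcs
    the integrand is 0, so the point t = pi, where the tangent is infinite, is never met. *)
Lemma is_CInt_circle (phi : C -> C) (k : Rhat -> C) (A r : R) (I : C) :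
  (0 < A)%R -> (0 < r)%R -> (forall x, (A < Rabs x)%R -> chart0 k x = 0) ->
  let g := path 1 ((1 - r) / (1 + r)) in
  (forall x, (- A <= x <= A)%R -> path_continuous (fun x => chart0 k x * RtoC (density x) * phi (g x)) x) ->
  is_CInt (fun x => chart0 k x * RtoC (density x) * phi (g x)) (- A) A I ->
  is_CInt (fun t => k (tan_half t) * cayley phi (r * cos t, r * sin t)%R) (- PI) PI (- Ci * I).
Proof.
  intros HA Hr Hk g Hc HI.
  set (al := (2 * atan A)%R).
  assert (Hal : (0 < al < PI)%R).
  { unfold al. pose proof (atan_bound A). pose proof (atan_increasing 0 A HA). rewrite atan_0 in *. lra. }
  assert (Hth : forall t, (- PI < t < PI)%R -> tan_half t = Some (tan (t / 2))).
  { intros t Ht. unfold tan_half. destruct (Req_EM_T (cos (t / 2)) 0); auto.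
    pose proof (cos_half_pos t Ht). lra. }
  assert (H0 : forall t, (al < Rabs t < PI)%R ->
    k (tan_half t) * cayley phi (r * cos t, r * sin t)%R = 0).
  { intros t Ht. rewrite Hth by (pose proof (Rabs_def2 t PI (proj2 Ht)); lra).
    change (k (Some (tan (t / 2)))) with (chart0 k (tan (t / 2))).
    rewrite Hk; [ring|]. now apply tan_half_abs. }
  replace (- Ci * I) with (0 + - Ci * I + 0) by ring.
  apply is_CInt_Chasles with al; [apply is_CInt_Chasles with (- al)%R|].
  - apply is_CInt_ext with (fun _ => RtoC 0); [|apply is_CInt_zero].
    intros t Ht. rewrite Rmin_left, Rmax_right in Ht by lra. symmetry. apply H0.
    rewrite Rabs_left by lra. lra.
  - set (F := fun x => chart0 k x * RtoC (density x) * phi (g x)).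
    set (dg := fun t => ((1 + tan (t / 2) ^ 2) / 2)%R).
    assert (Ha1 : tan (al / 2) = A).
    { unfold al. replace (2 * atan A / 2)%R with (atan A) by field. apply tan_atan. }
    assert (Ha2 : tan (- al / 2) = (- A)%R).
    { replace (- al / 2)%R with (- (al / 2))%R by field. now rewrite tan_neg, Ha1. }
    assert (Hder : forall t, (- PI < t < PI)%R -> is_derive (fun t => tan (t / 2)) t (dg t)).
    { intros t Ht. pose proof (cos_half_pos t Ht).
      unfold dg.
      replace ((1 + tan (t / 2) ^ 2) / 2)%R with (scal (/ 2)%R (tan (t / 2) ^ 2 + 1)%R : R)
        by (unfold scal; simpl; unfold mult; simpl; field).
      apply (is_derive_comp (K := R_AbsRing) (V := R_NormedModule) tan (fun t => t / 2)%R).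
      - apply is_derive_tan. lra.
      - auto_derive; auto. lra. }
    assert (Hb : forall t, (Rmin (- al) al <= t <= Rmax (- al) al)%R -> (- al <= t <= al)%R).
    { intros t Ht. rewrite Rmin_left, Rmax_right in Ht by lra. lra. }
    assert (Hrange : forall t, (- al <= t <= al)%R -> (- A <= tan (t / 2) <= A)%R).
    { intros t Ht.
      assert (HT : (tan (- al / 2) <= tan (t / 2) <= tan (al / 2))%R).
      { split; (destruct (Req_dec t al) as [->|N1]; [|destruct (Req_dec t (- al)) as [->|N2]]);
          try (rewrite ?Ha1, ?Ha2; lra); apply Rlt_le, tan_increasing; lra. }
      now rewrite Ha1, Ha2 in HT. }
    pose proof (is_RInt_comp (V := C_R_CompleteNormedModule) F (fun t => tan (t / 2)) dg (- al) al) as HC.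
    cbv beta in HC. rewrite Ha1, Ha2 in HC.
    assert (HFI : RInt (V := C_R_CompleteNormedModule) F (- A) A = I).
    { exact (is_RInt_unique (V := C_R_CompleteNormedModule) F _ _ _ HI). }
    rewrite HFI in HC.
    apply is_CInt_ext with (fun t => - Ci * (RtoC (dg t) * F (tan (t / 2)))).
    + intros t Ht. rewrite Rmin_left, Rmax_right in Ht by lra.
      rewrite Hth, cayley_path by (try lra; pose proof (cos_half_pos t ltac:(lra)); lra).
      fold g. unfold F. change (k (Some (tan (t / 2)))) with (chart0 k (tan (t / 2))).
      (* The derivative of tan (t/2) cancels the density. *)
      assert (E : RtoC (dg t) * RtoC (density (tan (t / 2))) = 1).
      { rewrite <- RtoC_mult. f_equal. unfold dg, density. field. apply one_plus_sqr_neq_0. }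
      transitivity (RtoC (dg t) * RtoC (density (tan (t / 2))) *
        (- Ci * (chart0 k (tan (t / 2)) * phi (g (tan (t / 2)))))); [ring|rewrite E; ring].
    + apply is_CInt_scal.
      apply is_CInt_ext with (fun t => scal (dg t) (F (tan (t / 2)) : CR)).
      { intros t _. apply injective_projections; unfold scal; simpl; unfold prod_scal, scal; simpl; unfold mult; simpl; ring. }
      apply HC.
      * intros t Ht. apply Hc. apply Hrange, Hb, Ht.
      * intros t Ht. apply Hb in Ht. split; [apply Hder; lra|].
        apply (ex_derive_continuous (V := R_NormedModule)). unfold dg.
        pose proof (Hder t ltac:(lra)) as D.
        apply (ex_derive_ext (fun t => (1 + tan (t / 2) * tan (t / 2)) * / 2)%R).
        { intros s. simpl. field. }
        apply ex_derive_mult; [|apply ex_derive_const].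
        apply (ex_derive_plus (V := R_NormedModule)); [apply ex_derive_const|].
        apply ex_derive_mult; eexists; exact D.
  - apply is_CInt_ext with (fun _ => RtoC 0); [|apply is_CInt_zero].
    intros t Ht. rewrite Rmin_left, Rmax_right in Ht by lra. symmetry. apply H0.
    rewrite Rabs_pos_eq by lra. lra.
Qed.

(** The parameter (1 - r) / (1 + r) tends to 0 as r -> 1 and is positive exactly inside the circle,
    which matches r -> 1 - 0 with the upper half plane and r -> 1 + 0 with the lower one. *)
Lemma to_circle_near pm (P : R -> Prop) (eta : R) : (0 < eta)%R ->
  (forall r, (0 < r)%R -> half_plane pm (0%R, ((1 - r) / (1 + r))%R) ->
     (Rabs ((1 - r) / (1 + r)) < eta)%R -> P r) ->
  to_circle pm P.
Proof.
  intros He H.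
  assert (Hd : (0 < Rmin eta (/ 2))%R) by (apply Rmin_pos; lra).
  assert (Hr : forall r, (Rabs (r - 1) < Rmin eta (/ 2))%R ->
    (0 < r)%R /\ (Rabs ((1 - r) / (1 + r)) < eta)%R).
  { intros r Hr. bounds_Rmin eta (/ 2)%R.
    pose proof (Rabs_def2 (r - 1) (/ 2) ltac:(lra)). split; [lra|].
    unfold Rdiv. rewrite Rabs_mult, Rabs_inv, (Rabs_pos_eq (1 + r)) by lra.
    rewrite Rabs_minus_sym in Hr. pose proof (Rabs_pos (1 - r)).
    apply Rmult_lt_reg_r with (1 + r)%R; [lra|]. rewrite Rmult_assoc, Rinv_l, Rmult_1_r by lra. nra. }
  destruct pm; simpl; exists (mkposreal _ Hd); intros r Hb Hlt;
    destruct (Hr r Hb) as [R1 R2]; apply H; auto; simpl.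
  - apply Rdiv_lt_0_compat; lra.
  - assert (0 < (r - 1) / (1 + r))%R by (apply Rdiv_lt_0_compat; lra).
    replace ((1 - r) / (1 + r))%R with (- ((r - 1) / (1 + r)))%R by (field; lra). lra.
Qed.

Lemma line_limit_of_paths (pm : side) (phi : C -> C) (A : R) (E : R -> C) (L : C) : (0 < A)%R ->
  (forall x, (A < Rabs x)%R -> E x = 0) ->
  (forall eps, (0 < eps)%R -> exists eta, (0 < eta)%R /\
     forall lam tau, (0 <= lam <= 1)%R -> half_plane pm (0%R, tau) -> (Rabs tau < eta)%R ->
     (forall x, (- (A + 1) <= x <= A + 1)%R -> exists l, C_differential phi (path lam tau x) l) /\
     exists I : C, is_CInt (fun x => E x * phi (path lam tau x)) (- (A + 1)) (A + 1) I /\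
       (Cmod (I - L) < eps)%R) ->
  line_limit pm phi E L.
Proof.
  intros HA HE0 HL. apply filterlimi_C; [apply filter_filter|].
  intros eps He. destruct (HL eps He) as [eta [Heta HI]].
  apply to_axis_spec. exists eta. split; auto. intros tau Hpm Htau.
  destruct (HI 0%R tau ltac:(lra) Hpm Htau) as [_ [I [I1 I2]]]. exists I. split; auto.
  apply (is_RInt_gen_compact _ (A + 1)); [lra| |].
  - intros x Hx. rewrite HE0 by lra. ring.
  - revert I1. apply is_CInt_ext. intros x _. now rewrite path_0.
Qed.

Lemma line_limit_exists (pm : side) (phi : C -> C) (A : R) : (0 < A)%R -> tame pm phi ->
  exists c, (0 <= c)%R /\ forall E, smooth E -> (forall x, (A < Rabs x)%R -> E x = 0) ->
  exists L, line_limit pm phi E L /\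
    forall M, (forall k x, (k <= 2)%nat -> (Cmod (Dn E k x) <= M)%R) -> (Cmod L <= c * M)%R.
Proof.
  intros HA Ht. destruct (tame_limit pm phi A HA Ht) as [c [Hc H]].
  exists c. split; auto. intros E HE HE0. destruct (H E HE HE0) as [L [HL1 HL2]].
  exists L. split; [now apply line_limit_of_paths with A|exact HL2].
Qed.

(** The same [L] occurs in both limits because the estimate is uniform in [lam]: 0 gives the lines
    and 1 the circles. *)
Lemma line_circle_limit (pm : side) (phi : C -> C) (A : R) (k : Rhat -> C) : (0 < A)%R -> tame pm phi ->
  smooth (chart0 k) -> (forall x, (A < Rabs x)%R -> chart0 k x = 0) ->
  exists L, line_limit pm phi (fun x => chart0 k x * RtoC (density x)) L /\
    circle_limit pm (cayley phi) (fun t => k (tan_half t)) (- Ci * L).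
Proof.
  intros HA Ht Hk Hk0. destruct (tame_limit pm phi A HA Ht) as [c [_ H]].
  set (E := fun x => chart0 k x * RtoC (density x)).
  assert (HE : smooth E) by (apply smooth_mult_RtoC; auto; apply smooth_density).
  assert (HE0 : forall x, (A < Rabs x)%R -> E x = 0).
  { intros x Hx. unfold E. rewrite Hk0 by auto. ring. }
  destruct (H E HE HE0) as [L [HL1 _]].
  exists L. split; [now apply line_limit_of_paths with A|].
  apply filterlimi_C; [apply filter_filter|]. intros eps He. destruct (HL1 eps He) as [eta [Heta HI]].
  apply to_circle_near with (Rmin eta (/ 2)); [apply Rmin_pos; lra|].
  intros r Hr Hpm Hsmall. bounds_Rmin eta (/ 2)%R.
  set (tau := ((1 - r) / (1 + r))%R) in *.
  destruct (HI 1%R tau ltac:(lra) Hpm ltac:(lra)) as [Hd [I [I1 I2]]].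
  exists (- Ci * I). split.
  + apply (is_CInt_circle phi k (A + 1) r I); auto; [lra|intros x Hx; apply Hk0; lra|].
    intros x Hx. apply (continuous_path_mult E (fun x => phi (path 1 tau x))).
    * exact (path_derive_continuous _ _ _ (smooth_derive E x HE)).
    * destruct (Hd x Hx) as [l Hl]. apply continuous_comp_path with l; auto.
      assert (P := path_derive_path 1 tau ltac:(lra) ltac:(lra) x).
      exact (path_derive_continuous _ _ _ P).
  + replace (- Ci * I - - Ci * L) with (- Ci * (I - L)) by ring.
    now rewrite Cmod_mult, Cmod_opp, Cmod_Ci, Rmult_1_l.
Qed.

(** * The inversion *)

Lemma Rhat_inv_involutive (s : Rhat) : Rhat_inv (Rhat_inv s) = s.
Proof.
  destruct s as [x|]; simpl.
  - destruct (Req_EM_T x 0) as [->|Hx]; simpl; auto.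
    assert (Hi : (- / x <> 0)%R) by (apply Ropp_neq_0_compat, Rinv_neq_0_compat, Hx).
    destruct (Req_EM_T (- / x) 0); [contradiction|]. f_equal. field. auto.
  - destruct (Req_EM_T 0 0); congruence.
Qed.

(** A half turn of the circle is the inversion of the extended line: tan (u + pi/2) = -1 / tan u. *)
Lemma tan_half_shift (t : R) : tan_half (t + PI) = Rhat_inv (tan_half t).
Proof.
  unfold tan_half.
  replace ((t + PI) / 2)%R with (t / 2 + PI / 2)%R by field.
  assert (Ec : cos (t / 2 + PI / 2) = (- sin (t / 2))%R).
  { rewrite cos_plus, cos_PI2, sin_PI2. ring. }
  assert (Es : sin (t / 2 + PI / 2) = cos (t / 2)).
  { rewrite sin_plus, cos_PI2, sin_PI2. ring. }
  assert (E1 := cos_sin_half t). destruct E1 as [_ [_ E1]].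
  unfold tan. rewrite Ec, Es.
  destruct (Req_EM_T (cos (t / 2)) 0) as [Hc|Hc]; simpl.
  - rewrite Hc in *. destruct (Req_EM_T (- sin (t / 2)) 0) as [Hs|Hs]; [nra|].
    f_equal. unfold Rdiv. ring.
  - destruct (Req_EM_T (- sin (t / 2)) 0) as [Hs|Hs];
    destruct (Req_EM_T (sin (t / 2) / cos (t / 2)) 0) as [Hq|Hq]; auto.
    + exfalso. apply Hq. replace (sin (t / 2)) with 0%R by lra. field. auto.
    + exfalso. apply Hs. replace (sin (t / 2)) with (sin (t / 2) / cos (t / 2) * cos (t / 2))%R by (field; auto).
      rewrite Hq. ring.
    + f_equal. field. split; auto; lra.
Qed.

Lemma tan_half_periodic (t : R) : tan_half (t + 2 * PI) = tan_half t.
Proof.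
  replace (t + 2 * PI)%R with (t + PI + PI)%R by ring.
  now rewrite !tan_half_shift, Rhat_inv_involutive.
Qed.

Lemma cayley_neg (phi : C -> C) (z : C) : 1 + z <> 0 -> 1 - z <> 0 ->
  cayley phi (- z) = cayley (inversion phi) z.
Proof.
  intros H1 H2. unfold cayley, inversion. f_equal. f_equal.
  replace (1 - - z) with (1 + z) by ring. replace (1 + - z) with (1 - z) by ring.
  assert (Hi : Ci <> 0) by (unfold Ci, RtoC; intros E; injection E; lra).
  set (b := Ci * ((1 - z) / (1 + z))).
  assert (Hb : b <> 0).
  { unfold b. repeat apply Cmult_neq_0; auto. intros E. apply H1.
    transitivity ((1 + z) * (/ (1 + z) * (1 + z))); [field; auto|]. rewrite E. ring. }
  transitivity (Ci * ((1 + z) / (1 - z)) * b * / b); [field; auto|].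
  replace (Ci * ((1 + z) / (1 - z)) * b) with (Ci * Ci) by (unfold b; field; auto).
  rewrite Ci_square. ring.
Qed.

(** The integrand of one side is that of the other translated by pi, and an integral over a full
    period does not see translations. *)
Lemma circle_limit_rotate (pm : side) (phi : C -> C) (k : Rhat -> C) (l : C) :
  circle_limit pm (cayley (inversion phi)) (fun t => k (tan_half t)) l ->
  circle_limit pm (cayley phi) (fun t => k (Rhat_inv (tan_half t))) l.
Proof.
  unfold circle_limit. rewrite !filterlimi_C by apply filter_filter. intros H eps He.
  (* For [r <> 1] the circle avoids 1 and -1, where the formula for the rotated Cayley transform
     would divide by 0. *)
  assert (Hne : to_circle pm (fun r => (0 < r)%R /\ r <> 1%R)).
  { apply to_circle_near with 1%R; [lra|]. intros r Hr Hpm _. split; auto. intros ->.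
    replace ((1 - 1) / (1 + 1))%R with 0%R in Hpm by field. destruct pm; simpl in Hpm; lra. }
  generalize (filter_and _ _ Hne (H eps He)). apply filter_imp.
  intros r [[Hr Hr1] [I [HI Hclose]]]. exists I. split; auto.
  set (h := fun t => k (tan_half t) * cayley (inversion phi) (r * cos t, r * sin t)%R) in *.
  assert (Hh : forall t, k (Rhat_inv (tan_half (t + PI))) * cayley phi (r * cos (t + PI), r * sin (t + PI))%R = h t).
  { intros t. unfold h. rewrite tan_half_shift, Rhat_inv_involutive, neg_cos, neg_sin. f_equal.
    replace (r * - cos t, r * - sin t)%R with (- (r * cos t, r * sin t)%R)
      by (unfold Copp; simpl; f_equal; ring).
    pose proof (sin2_cos2 t) as E1. unfold Rsqr in E1.
    apply cayley_neg; intros E; injection E as E2 E3; simpl in E2, E3.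
    - assert (r * r = 1)%R by (transitivity (r * r * (sin t * sin t + cos t * cos t))%R; [rewrite E1; ring|nra]).
      apply Hr1. nra.
    - assert (r * r = 1)%R by (transitivity (r * r * (sin t * sin t + cos t * cos t))%R; [rewrite E1; ring|nra]).
      apply Hr1. nra. }
  assert (Hper : forall t, h (t + 2 * PI)%R = h t).
  { intros t. unfold h. rewrite tan_half_periodic. f_equal. f_equal.
    replace (t + 2 * PI)%R with (t + 2 * INR 1 * PI)%R by (simpl; ring).
    now rewrite cos_period, sin_period. }
  set (G := fun t => k (Rhat_inv (tan_half t)) * cayley phi (r * cos t, r * sin t)%R).
  assert (HG1 : forall t, G t = h (t - PI)%R).
  { intros t. unfold G. rewrite <- Hh. now replace (t - PI + PI)%R with t by ring. }
  assert (HG2 : forall t, G t = h (t + PI)%R).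
  { intros t. rewrite HG1, <- Hper. f_equal. ring. }
  pose proof PI_RGT_0 as Hpi.
  assert (Hex : ex_RInt (V := CR) h (- PI) PI) by (now exists I).
  (* Translation by pi exchanges the two halves of the period, so the integral is cut at 0 and its
     pieces are swapped. *)
  assert (Hex1 : ex_RInt (V := CR) h (- PI) 0).
  { apply (ex_RInt_Chasles_1 (V := C_R_CompleteNormedModule) h (- PI) 0 PI); [lra|exact Hex]. }
  assert (Hex2 : ex_RInt (V := CR) h 0 PI).
  { apply (ex_RInt_Chasles_2 (V := C_R_CompleteNormedModule) h (- PI) 0 PI); [lra|exact Hex]. }
  destruct Hex1 as [I1 HI1]. destruct Hex2 as [I2 HI2].
  assert (EI : I = (I2 : C) + (I1 : C)).
  { rewrite Cplus_comm. apply (is_CInt_unique h (- PI) PI); auto. now apply is_CInt_Chasles with 0%R. }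
  rewrite EI. apply is_CInt_Chasles with 0%R.
  - apply (is_CInt_ext (fun t => scal 1%R (h (1 * t + PI)%R : CR))).
    + intros t _. fold G. change (k (Rhat_inv (tan_half t)) * cayley phi (r * cos t, r * sin t)%R) with (G t).
      rewrite HG2. rewrite (scal_one (V := CR)). f_equal. ring.
    + apply (is_RInt_comp_lin (V := CR) h 1 PI (- PI) 0).
      replace (1 * - PI + PI)%R with 0%R by ring. now replace (1 * 0 + PI)%R with PI by ring.
  - apply (is_CInt_ext (fun t => scal 1%R (h (1 * t + - PI)%R : CR))).
    + intros t _. change (k (Rhat_inv (tan_half t)) * cayley phi (r * cos t, r * sin t)%R) with (G t).
      rewrite HG1. rewrite (scal_one (V := CR)). f_equal. ring.
    + apply (is_RInt_comp_lin (V := CR) h 1 (- PI) 0 PI).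
      replace (1 * 0 + - PI)%R with (- PI)%R by ring. now replace (1 * PI + - PI)%R with 0%R by ring.
Qed.

Lemma open_box (O : C -> Prop) (z : C) : open O -> O z ->
  exists delta, (0 < delta)%R /\ forall w,
    (Rabs (Re w - Re z) < delta)%R -> (Rabs (Im w - Im z) < delta)%R -> O w.
Proof.
  intros H Hz. destruct (H z Hz) as [e He]. exists e. split; [apply cond_pos|].
  intros w H1 H2. apply He. split; assumption.
Qed.

Lemma open_Cmod (O : C -> Prop) (z : C) : open O -> O z ->
  exists delta, (0 < delta)%R /\ forall w, (Cmod (w - z) < delta)%R -> O w.
Proof.
  intros H Hz. destruct (open_box O z H Hz) as [d [Hd H1]]. exists d. split; auto.
  intros w Hw. apply H1.
  - eapply Rle_lt_trans; [apply (Rabs_Re_le_Cmod (w - z))|exact Hw].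
  - eapply Rle_lt_trans; [apply (Rabs_Im_le_Cmod (w - z))|exact Hw].
Qed.

Lemma open_intro (O : C -> Prop) :
  (forall z, O z -> exists delta, (0 < delta)%R /\ forall w, (Cmod (w - z) < delta)%R -> O w) -> open O.
Proof.
  intros H z Hz. exact (proj2 (locally_Cmod z O) (H z Hz)).
Qed.

Lemma open_disc (c : C) (r : R) : open (fun z => (Cmod (z - c) < r)%R).
Proof.
  apply open_intro. intros z Hz. exists (r - Cmod (z - c))%R. split; [lra|]. intros w Hw.
  replace (w - c) with ((w - z) + (z - c)) by ring.
  eapply Rle_lt_trans; [apply Cmod_triangle|]. lra.
Qed.

Lemma C_differential_neg_inv (z : C) : z <> 0 -> C_differential (fun w => - / w) z (/ (z * z)).
Proof.
  intros Hz. replace (/ (z * z)) with (- (1) * - / (z * z)) by ring.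
  apply (C_differential_comp (fun w => - w) Cinv); [|now apply C_differential_inv].
  intros eps He. exists 1%R. split; [lra|]. intros w _.
  replace (- w - - / z - (w - / z) * - (1)) with (RtoC 0) by ring.
  rewrite Cmod_0. pose proof (Cmod_ge_0 (w - / z)). nra.
Qed.

Lemma Im_neg_inv (z : C) : Im (- / z) = (Im z * / (Re z ^ 2 + Im z ^ 2))%R.
Proof. destruct z as [x y]. unfold Cinv, Copp; simpl. unfold Rdiv. ring. Qed.

Lemma half_plane_neq_0 pm (z : C) : half_plane pm z -> z <> 0.
Proof. intros H ->. destruct pm; simpl in H; lra. Qed.

Lemma half_plane_neg_inv pm (z : C) : half_plane pm (- / z) <-> half_plane pm z.
Proof.
  assert (H : Im z <> 0%R -> (0 < / (Re z ^ 2 + Im z ^ 2))%R).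
  { intros Hz. apply Rinv_0_lt_compat. nra. }
  destruct (Req_dec (Im z) 0) as [E|E].
  - destruct pm; unfold half_plane; rewrite Im_neg_inv, E; lra.
  - specialize (H E). destruct pm; unfold half_plane; rewrite Im_neg_inv; split; intros; nra.
Qed.

Lemma neg_inv_involutive (z : C) : z <> 0 -> - / - / z = z.
Proof.
  intros Hz. assert (Hz' : / z <> 0).
  { intros E. apply Hz. transitivity (z * (/ z * z)); [field; auto|]. rewrite E. ring. }
  field. auto.
Qed.

Section Inversion.

Variables (pm : side) (D : C -> Prop) (phi : C -> C).
Hypothesis hD : boundary_nbhd pm full D.
Hypothesis hol : holomorphic_on D phi.
Hypothesis simple : behaves_simply_on pm phi full.

Lemma tame_of_simple : tame pm phi.
Proof.
  intros x. destruct hD as [U [[HU _] [Hs HD]]].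
  destruct (open_box (fun z => U (Some z)) (RtoC x) HU (Hs (Some x) Logic.I)) as [d1 [Hd1 H1]].
  destruct (simple (Some x) Logic.I) as [V [HV [Hx [M HM]]]].
  destruct (open_box V (RtoC x) HV Hx) as [d2 [Hd2 H2]].
  exists (Rmin d1 d2), M. split; [now apply Rmin_pos|]. intros z Hz1 Hpm Hz2.
  bounds_Rmin d1 d2.
  replace (Im z) with (Im z - Im (RtoC x))%R in Hz2 by (simpl; ring).
  change (Re z - x)%R with (Re z - Re (RtoC x))%R in Hz1. split.
  - assert (Dz : D z) by (apply HD; split; auto; apply H1; lra).
    destruct (hol z Dz) as [l Hl]. exists l. now apply is_derive_C_differential.
  - rewrite Rmult_comm, <- Cmod_R, <- Cmod_mult. apply HM; auto. apply H2; lra.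
Qed.

Lemma inversion_boundary_nbhd : boundary_nbhd pm full (fun w => D (- / w)).
Proof.
  destruct hD as [U [[HU Hinf] [Hs HD]]].
  (* The preimage of [U] under -1/z on the sphere, where 0 and infinity change places. *)
  exists (fun s : Chat => match s with
    | None => U (Some (RtoC 0))
    | Some z => (z = 0 -> U None) /\ (z <> 0 -> U (Some (- / z)))
    end).
  split; [split|split].
  - apply open_intro. intros z [Hz1 Hz2]. destruct (Ceq_dec z 0) as [->|Hz].
    + destruct (Hinf (Hz1 eq_refl)) as [r Hr].
      (* The radius [r] of the neighborhood of infinity may be 0 or negative; [Rabs r + 1] is a
         positive substitute. *)
      assert (Hp : (0 < / (Rabs r + 1))%R).
      { apply Rinv_0_lt_compat. pose proof (Rabs_pos r). lra. }
      exists (/ (Rabs r + 1))%R. split; auto. intros w Hw. split; auto.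
      intros Hw0. apply Hr. rewrite Cmod_opp, Cmod_inv by auto.
      replace (w - 0) with w in Hw by ring. pose proof (Cmod_gt_0 w) as [G _]. specialize (G Hw0).
      apply Rinv_lt_contravar in Hw; [|nra]. rewrite Rinv_inv in Hw. pose proof (Rle_abs r). lra.
    + destruct (open_Cmod _ _ HU (Hz2 Hz)) as [d [Hd H1]].
      destruct (C_differential_Lipschitz _ _ _ (C_differential_neg_inv z Hz)) as [d2 [Hd2 H2]].
      pose proof (Cmod_gt_0 z) as [G _]. specialize (G Hz).
      set (k := (Cmod (/ (z * z)) + 1)%R) in *.
      assert (Hk : (0 < k)%R) by (unfold k; pose proof (Cmod_ge_0 (/ (z * z))); lra).
      assert (Hdk : (0 < d / k)%R) by (now apply Rdiv_lt_0_compat).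
      exists (Rmin (Cmod z) (Rmin d2 (d / k))). split; [repeat apply Rmin_pos; auto|].
      intros w Hw. bounds_Rmin (Cmod z)%R (Rmin d2 (d / k))%R.
      bounds_Rmin d2 (d / k)%R. split.
      * intros ->. rewrite <- Cmod_opp in Hw. replace (- (0 - z)) with z in Hw by ring. lra.
      * intros _. apply H1. eapply Rle_lt_trans; [apply H2; lra|].
        apply Rlt_le_trans with (k * (d / k))%R; [apply Rmult_lt_compat_l; lra|]. right; field; lra.
  - intros H0. destruct (open_Cmod _ _ HU H0) as [d [Hd H1]]. exists (/ d)%R. intros z Hz.
    assert (Hp : (0 < / d)%R) by now apply Rinv_0_lt_compat.
    assert (Hz0 : z <> 0) by (intros ->; rewrite Cmod_0 in Hz; lra).
    split; [contradiction|]. intros _. apply H1. replace (- / z - 0) with (- / z) by ring.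
    rewrite Cmod_opp, Cmod_inv by auto. rewrite <- (Rinv_inv d).
    apply Rinv_lt_contravar; auto. apply Rmult_lt_0_compat; lra.
  - intros [x|] _; simpl.
    + split; [intros _; apply (Hs None Logic.I)|]. intros Hx.
      assert (Hx0 : x <> 0%R) by (intros ->; auto).
      rewrite <- RtoC_inv, <- RtoC_opp by auto. apply (Hs (Some (- / x)%R) Logic.I).
    + apply (Hs (Some 0%R) Logic.I).
  - intros z. rewrite HD, half_plane_neg_inv. split.
    + intros [H1 H2]. split; auto. split; auto. intros E. now destruct (half_plane_neq_0 pm z H2).
    + intros [[H1 H2] H3]. split; auto. apply H2. now apply half_plane_neq_0 with pm.
Qed.

Lemma inversion_holomorphic : holomorphic_on (fun w => D (- / w)) (inversion phi).
Proof.
  intros z Hz. destruct (hol _ Hz) as [l Hl]. apply is_derive_C_differential in Hl.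
  assert (Hz0 : z <> 0).
  { destruct hD as [U [_ [_ HD]]]. apply HD in Hz. destruct Hz as [_ Hz].
    exact (half_plane_neq_0 pm z (proj1 (half_plane_neg_inv pm z) Hz)). }
  exists (l * / (z * z)). apply is_derive_C_differential.
  apply (C_differential_comp phi (fun w => - / w)); auto. now apply C_differential_neg_inv.
Qed.

(** At a finite nonzero point the bound is transported by [Im z = Im (- / z) * Cmod z ^ 2], with
    [Cmod z] bounded nearby. The conditions at 0 and at infinity are simply exchanged. *)
Lemma inversion_simple : behaves_simply_on pm (inversion phi) full.
Proof.
  intros [x|] _; simpl.
  - destruct (Req_dec x 0) as [->|Hx]; [exact (simple None Logic.I)|].
    destruct (simple (Some (- / x)%R) Logic.I) as [V [HV [Hy [M HM]]]].
    assert (Hx0 : RtoC x <> 0) by (intros E; apply RtoC_inj in E; auto).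
    rewrite RtoC_opp, RtoC_inv in Hy by auto.
    destruct (open_Cmod V _ HV Hy) as [d [Hd H1]].
    destruct (C_differential_Lipschitz _ _ _ (C_differential_neg_inv (RtoC x) Hx0)) as [d2 [Hd2 H2]].
    set (k := (Cmod (/ (RtoC x * RtoC x)) + 1)%R) in *.
    assert (Hk : (0 < k)%R) by (unfold k; pose proof (Cmod_ge_0 (/ (RtoC x * RtoC x))); lra).
    assert (Hdk : (0 < d / k)%R) by (now apply Rdiv_lt_0_compat).
    set (r := Rmin 1 (Rmin d2 (d / k))).
    assert (Hr : (0 < r)%R) by (unfold r; repeat apply Rmin_pos; lra).
    exists (fun z => (Cmod (z - RtoC x) < r)%R). split; [apply open_disc|]. split.
    { replace (RtoC x - RtoC x) with (RtoC 0) by ring. now rewrite Cmod_0. }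
    exists (M * (Cmod (RtoC x) + 1) ^ 2)%R. intros z Hz Hpm.
    assert (R1 : (r <= 1)%R) by apply Rmin_l.
    assert (R2 : (r <= d2)%R) by (eapply Rle_trans; [apply Rmin_r|apply Rmin_l]).
    assert (R3 : (r <= d / k)%R) by (eapply Rle_trans; [apply Rmin_r|apply Rmin_r]).
    assert (Hz0 : z <> 0) by now apply half_plane_neq_0 with pm.
    assert (HVz : V (- / z)).
    { apply H1. eapply Rle_lt_trans; [apply H2; lra|].
      apply Rlt_le_trans with (k * (d / k))%R; [apply Rmult_lt_compat_l; lra|]. right; field; lra. }
    specialize (HM _ HVz (proj2 (half_plane_neg_inv pm z) Hpm)).
    assert (Hsq : (Cmod z ^ 2 = Re z ^ 2 + Im z ^ 2)%R).
    { unfold Cmod. rewrite pow2_sqrt; [reflexivity|]. pose proof (pow2_ge_0 (fst z)). pose proof (pow2_ge_0 (snd z)). lra. }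
    assert (Hpos : (0 < Cmod z)%R) by now apply Cmod_gt_0.
    assert (EI : Im z = (Im (- / z) * Cmod z ^ 2)%R).
    { rewrite Im_neg_inv, Hsq. field. rewrite <- Hsq. nra. }
    unfold inversion. rewrite EI, RtoC_mult.
    replace (RtoC (Im (- / z)) * RtoC (Cmod z ^ 2) * phi (- / z)) with
      (RtoC (Im (- / z)) * phi (- / z) * RtoC (Cmod z ^ 2)) by ring.
    rewrite Cmod_mult, (Cmod_R (Cmod z ^ 2)), (Rabs_pos_eq (Cmod z ^ 2)) by nra.
    apply Rmult_le_compat; auto; [apply Cmod_ge_0|nra|].
    apply pow_incr. split; [lra|].
    replace z with ((z - RtoC x) + RtoC x) by ring.
    eapply Rle_trans; [apply Cmod_triangle|]. lra.
  - destruct (simple (Some 0%R) Logic.I) as [V [HV [Hy [M HM]]]].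
    exists V. split; auto. split; auto. exists M. intros z Hz Hpm. unfold inversion.
    rewrite neg_inv_involutive by now apply half_plane_neq_0 with pm. now apply HM.
Qed.

End Inversion.

(** * The boundary distributions *)

Lemma path_derive_RtoC (m : R -> R) (x dm : R) :
  is_derive m x dm -> path_derive (fun t => RtoC (m t)) x (RtoC dm).
Proof.
  intros H. apply path_derive_components. split; [exact H|].
  exact (is_derive_const (K := R_AbsRing) (V := R_NormedModule) 0%R x).
Qed.

Lemma path_derive_reparam (g : R -> C) (th : R -> R) (x dth : R) (v : C) :
  path_derive g (th x) v -> is_derive th x dth ->
  path_derive (fun t => g (th t)) x (RtoC dth * v).
Proof.
  intros Hg Hth.
  replace (RtoC dth * v) with (scal dth (v : CR) : C).
  - exact (is_derive_comp (K := R_AbsRing) (V := CR) g th x v dth Hg Hth).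
  - apply injective_projections; unfold scal; simpl; unfold prod_scal, scal; simpl; unfold mult; simpl; ring.
Qed.

Lemma Dn_1_unique (f : R -> C) (x : R) (v : C) : path_derive f x v -> Dn f 1 x = v.
Proof.
  rewrite path_derive_components. intros [H1 H2]. apply is_derive_unique in H1, H2.
  destruct v. now apply injective_projections.
Qed.

Lemma Dn_2_unique (f f1 : R -> C) (x : R) (v : C) :
  (forall t, path_derive f t (f1 t)) -> path_derive f1 x v -> Dn f 2 x = v.
Proof.
  intros H H1. rewrite <- (Dn_1_unique f1 x v H1). unfold Dn. simpl.
  f_equal; apply Derive_ext; intros t; apply is_derive_unique;
    now apply (path_derive_components f t (f1 t)).
Qed.

Lemma smooth_bounded (f : R -> R) (A : R) : (forall x, smooth_at f x) ->
  exists B, (0 <= B)%R /\ forall k x, (k <= 2)%nat -> (Rabs x <= A)%R -> (Rabs (Derive_n f k x) <= B)%R.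
Proof.
  intros Hs. pose proof (proj2 (smooth_at_iff f) Hs) as Hf.
  assert (H : forall k, exists B, forall x, (- A <= x <= A)%R -> (Rabs (Derive_n f k x) < B)%R).
  { intros k. destruct (bounded_continuity (V := R_NormedModule) (Derive_n f k) (- A) A) as [B HB].
    - intros x _. apply (ex_derive_continuous (V := R_NormedModule)). exact (Hf (S k) x).
    - now exists B. }
  destruct (H 0%nat) as [B0 H0]. destruct (H 1%nat) as [B1 H1]. destruct (H 2%nat) as [B2 H2].
  exists (Rmax 0 (Rmax B0 (Rmax B1 B2))). split; [apply Rmax_l|]. intros k x Hk Hx.
  pose proof (Rmax_r 0 (Rmax B0 (Rmax B1 B2))). bounds_Rmax B0 (Rmax B1 B2)%R. bounds_Rmax B1 B2.
  apply Rabs_le_between in Hx.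
  destruct k as [|[|[|k]]]; [specialize (H0 x Hx)|specialize (H1 x Hx)|specialize (H2 x Hx)|lia]; lra.
Qed.

(** Controls the derivatives up to order two of a function read through a change of variable [th]
    and localized by [m]. It converts the seminorms of the circle and of the extended line into
    those of the line. *)
Lemma C2_bound (m th : R -> R) (A : R) :
  (forall x, smooth_at m x) -> (forall x, smooth_at th x) -> (forall x, (A < Rabs x)%R -> m x = 0%R) ->
  exists c, (0 <= c)%R /\ forall (g : R -> C) (M : R), smooth g ->
    (forall k x, (k <= 2)%nat -> (Rabs x <= A)%R -> (Cmod (Dn g k (th x)) <= M)%R) -> (0 <= M)%R ->
    forall k x, (k <= 2)%nat -> (Cmod (Dn (fun t => g (th t) * RtoC (m t))%C k x) <= c * M)%R.
Proof.
  intros Hm Hth Hm0.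
  destruct (smooth_bounded m A Hm) as [B1 [HB1 Bm]]. destruct (smooth_bounded th A Hth) as [B2 [HB2 Bth]].
  set (B := Rmax B1 B2). assert (B1 <= B)%R by apply Rmax_l. assert (B2 <= B)%R by apply Rmax_r.
  (* With [B] bounding all the derivatives involved, this is the sum of the bounds of the terms of
     the second derivative [E2]; it also dominates the orders 0 and 1. *)
  exists (B ^ 3 + 3 * B ^ 2 + B)%R. split; [assert (0 <= B ^ 2)%R by nra; assert (0 <= B ^ 3)%R by (apply pow_le; lra); lra|].
  intros g M Hg HM HM0 k x Hk.
  set (E := fun t => g (th t) * RtoC (m t)).
  assert (HB : (0 <= B)%R) by lra.
  assert (HB' : (0 <= B ^ 2)%R) by nra. assert (HB3 : (0 <= B ^ 3)%R) by (apply pow_le; lra).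
  destruct (Rle_dec (Rabs x) A) as [Hx|Hx].
  2:{ rewrite (Dn_vanishes E k A); [|intros t Ht; unfold E; rewrite Hm0 by auto; ring|lra].
      rewrite Cmod_0. apply Rmult_le_pos; lra. }
  pose proof (proj2 (smooth_at_iff m) Hm) as Hm'. pose proof (proj2 (smooth_at_iff th) Hth) as Hth'.
  assert (Dm : forall n t, is_derive (Derive_n m n) t (Derive_n m (S n) t)).
  { intros n t. apply Derive_correct. exact (Hm' (S n) t). }
  assert (Dth : forall n t, is_derive (Derive_n th n) t (Derive_n th (S n) t)).
  { intros n t. apply Derive_correct. exact (Hth' (S n) t). }
  set (E1 := fun t => RtoC (Derive_n th 1 t) * Dn g 1 (th t) * RtoC (m t) + g (th t) * RtoC (Derive_n m 1 t)).
  set (E2 := fun t =>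
    (RtoC (Derive_n th 2 t) * Dn g 1 (th t) + RtoC (Derive_n th 1 t) * (RtoC (Derive_n th 1 t) * Dn g 2 (th t))) * RtoC (m t)
    + RtoC (Derive_n th 1 t) * Dn g 1 (th t) * RtoC (Derive_n m 1 t) +
    (RtoC (Derive_n th 1 t) * Dn g 1 (th t) * RtoC (Derive_n m 1 t) + g (th t) * RtoC (Derive_n m 2 t))).
  assert (P0 : forall t, path_derive E t (E1 t)).
  { intros t. apply (path_derive_mult (fun t => g (th t)) (fun t => RtoC (m t))).
    - apply path_derive_reparam; [now apply smooth_derive|exact (Dth O t)].
    - apply path_derive_RtoC. exact (Dm O t). }
  assert (P1 : forall t, path_derive E1 t (E2 t)).
  { intros t. apply (path_derive_plus (fun t => RtoC (Derive_n th 1 t) * Dn g 1 (th t) * RtoC (m t))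
      (fun t => g (th t) * RtoC (Derive_n m 1 t))).
    - apply (path_derive_mult (fun t => RtoC (Derive_n th 1 t) * Dn g 1 (th t)) (fun t => RtoC (m t))).
      + apply (path_derive_mult (fun t => RtoC (Derive_n th 1 t)) (fun t => Dn g 1 (th t))).
        * apply path_derive_RtoC, Dth.
        * apply path_derive_reparam; [now apply Dn_derive|exact (Dth O t)].
      + apply path_derive_RtoC. exact (Dm O t).
    - apply (path_derive_mult (fun t => g (th t)) (fun t => RtoC (Derive_n m 1 t))).
      + apply path_derive_reparam; [now apply smooth_derive|exact (Dth O t)].
      + apply path_derive_RtoC, Dm. }
  assert (G0 := HM 0%nat x ltac:(lia) Hx). rewrite Dn_0 in G0.
  assert (G1 := HM 1%nat x ltac:(lia) Hx). assert (G2 := HM 2%nat x ltac:(lia) Hx).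
  assert (M0 : (Rabs (m x) <= B)%R) by (eapply Rle_trans; [exact (Bm 0%nat x ltac:(lia) Hx)|lra]).
  assert (M1 : (Rabs (Derive_n m 1 x) <= B)%R) by (eapply Rle_trans; [exact (Bm 1%nat x ltac:(lia) Hx)|lra]).
  assert (M2 : (Rabs (Derive_n m 2 x) <= B)%R) by (eapply Rle_trans; [exact (Bm 2%nat x ltac:(lia) Hx)|lra]).
  assert (T1 : (Rabs (Derive_n th 1 x) <= B)%R) by (eapply Rle_trans; [exact (Bth 1%nat x ltac:(lia) Hx)|lra]).
  assert (T2 : (Rabs (Derive_n th 2 x) <= B)%R) by (eapply Rle_trans; [exact (Bth 2%nat x ltac:(lia) Hx)|lra]).
  assert (Q : forall a b p q, (Cmod a <= p)%R -> (Cmod b <= q)%R -> (Cmod (a * b) <= p * q)%R).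
  { intros a b p q Ha Hb. rewrite Cmod_mult. apply Rmult_le_compat; auto; apply Cmod_ge_0. }
  assert (QR : forall r p, (Rabs r <= p)%R -> (Cmod (RtoC r) <= p)%R) by (intros r p Hr; now rewrite Cmod_R).
  assert (Sm : forall a b p q, (Cmod a <= p)%R -> (Cmod b <= q)%R -> (Cmod (a + b) <= p + q)%R).
  { intros a b p q Ha Hb. eapply Rle_trans; [apply Cmod_triangle|lra]. }
  assert (B3M : (0 <= B ^ 3 * M)%R) by nra. assert (B2M : (0 <= B ^ 2 * M)%R) by nra.
  assert (BM : (0 <= B * M)%R) by nra.
  destruct k as [|[|[|k]]]; [| | |lia].
  - rewrite Dn_0. eapply Rle_trans; [apply (Q _ _ M B); auto|]. nra.
  - rewrite (Dn_1_unique E x (E1 x) (P0 x)).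
    apply Rle_trans with (B * M * B + M * B)%R; [|nra].
    apply Sm; apply Q; auto.
  - rewrite (Dn_2_unique E E1 x (E2 x) P0 (P1 x)).
    apply Rle_trans with ((B * M + B * (B * M)) * B + B * M * B + (B * M * B + M * B))%R; [|nra].
    unfold E2. repeat first [apply Sm | apply Q]; auto.
Qed.

(** A total function chosen from the limit relation: unspecified where no limit exists, and equal to
    the limit, by uniqueness, wherever there is one. *)
Definition boundary_functional (pm : side) (phi : C -> C) (f : R -> C) : C :=
  epsilon (inhabits (RtoC 0)) (line_limit pm phi f).

Definition circle_functional (pm : side) (Phi : C -> C) (g : R -> C) : C :=
  epsilon (inhabits (RtoC 0)) (circle_limit pm Phi g).

Lemma boundary_functional_eq pm phi f l : line_limit pm phi f l -> boundary_functional pm phi f = l.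
Proof.
  intros H. apply (line_limit_unique pm phi f); auto.
  unfold boundary_functional. apply epsilon_spec. now exists l.
Qed.

Lemma circle_functional_eq pm Phi g l : circle_limit pm Phi g l -> circle_functional pm Phi g = l.
Proof.
  intros H. apply (circle_limit_unique pm Phi g); auto.
  unfold circle_functional. apply epsilon_spec. now exists l.
Qed.

Lemma compact_interval (K : R -> Prop) : Rtopology.compact K ->
  exists A, (0 < A)%R /\ forall f, vanishes_off K f -> forall x, (A < Rabs x)%R -> f x = 0.
Proof.
  intros HK. destruct (compact_P1 K HK) as [a [b Hab]].
  (* The 1 makes the bound positive even when [K] is empty or reduced to 0. *)
  exists (Rmax 1 (Rmax (Rabs a) (Rabs b))). split; [eapply Rlt_le_trans; [apply Rlt_0_1|apply Rmax_l]|].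
  intros f Hf x Hx. apply Hf. intros Hk. destruct (Hab x Hk) as [H1 H2].
  pose proof (Rmax_r 1 (Rmax (Rabs a) (Rabs b))). bounds_Rmax (Rabs a)%R (Rabs b)%R. pose proof (Rle_abs b). pose proof (Rle_abs (- a)%R).
  rewrite Rabs_Ropp in *. assert (Rabs x <= Rmax (Rabs a) (Rabs b))%R by (apply Rabs_le; lra). lra.
Qed.

Lemma boundary_functional_distribution (pm : side) (phi : C -> C) : tame pm phi ->
  is_boundary_distribution pm (fun _ => True) phi (boundary_functional pm phi).
Proof.
  intros Ht.
  assert (Hlim : forall f, test_function (fun _ => True) f ->
    line_limit pm phi f (boundary_functional pm phi f)).
  { intros f [Hf [K [HK [_ Hv]]]]. destruct (compact_interval K HK) as [A [HA HA0]].
    destruct (line_limit_exists pm phi A HA Ht) as [c [_ H]].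
    destruct (H f Hf (HA0 f Hv)) as [L [HL _]]. now rewrite (boundary_functional_eq _ _ _ _ HL). }
  split; [split|exact Hlim].
  - intros a f g Hf Hg. apply boundary_functional_eq. apply line_limit_lin; now apply Hlim.
  - intros K HK _. destruct (compact_interval K HK) as [A [HA HA0]].
    destruct (line_limit_exists pm phi A HA Ht) as [c [_ H]].
    exists 2%nat, c. intros f M Hf Hv HM.
    destruct (H f Hf (HA0 f Hv)) as [L [HL HB]]. rewrite (boundary_functional_eq _ _ _ _ HL). now apply HB.
Qed.

(** * Gluing the two charts through the circle *)

Section Joined.

Variables (pm : side) (phi : C -> C).
Hypotheses (Ht : tame pm phi) (Hti : tame pm (inversion phi)).

Let T := boundary_functional pm phi.
Let Tt := boundary_functional pm (inversion phi).
Let P := circle_functional pm (cayley phi).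

Lemma circle_limit_compact (A : R) (k : Rhat -> C) : (0 < A)%R ->
  smooth (chart0 k) -> (forall x, (A < Rabs x)%R -> chart0 k x = 0) ->
  circle_limit pm (cayley phi) (fun t => k (tan_half t))
    (- Ci * T (fun x => chart0 k x * RtoC (density x))).
Proof.
  intros HA Hk Hk0. destruct (line_circle_limit pm phi A k HA Ht Hk Hk0) as [L [H1 H2]].
  unfold T. now rewrite (boundary_functional_eq _ _ _ _ H1).
Qed.

(** The result at finite points, applied to the inversion of [phi] and rotated by pi. *)
Lemma circle_limit_compact_off_0 (A : R) (k : Rhat -> C) : (0 < A)%R ->
  smooth (chart1 k) -> (forall x, (A < Rabs x)%R -> chart1 k x = 0) ->
  circle_limit pm (cayley phi) (fun t => k (tan_half t))
    (- Ci * Tt (fun x => chart1 k x * RtoC (density x))).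
Proof.
  intros HA Hk Hk0.
  destruct (line_circle_limit pm (inversion phi) A (fun s => k (Rhat_inv s)) HA Hti Hk Hk0) as [L [H1 H2]].
  change (fun x => chart0 (fun s => k (Rhat_inv s)) x * RtoC (density x))
    with (fun x => chart1 k x * RtoC (density x)) in H1.
  unfold Tt. rewrite (boundary_functional_eq _ _ _ _ H1).
  pose proof (circle_limit_rotate pm phi (fun s => k (Rhat_inv s)) _ H2) as H3.
  revert H3. apply circle_limit_ext.
  intros t _. now rewrite Rhat_inv_involutive.
Qed.

(** The circle integrals do not mention [f1] and [f2], so uniqueness of their limit makes the value
    independent of the decomposition. *)
Lemma circle_limit_decomposition (f f1 f2 : Rhat -> C) : decomposition f f1 f2 ->
  circle_limit pm (cayley phi) (fun t => f (tan_half t))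
    (- Ci * (T (fun x => chart0 f1 x * RtoC (density x)) + Tt (fun x => chart1 f2 x * RtoC (density x)))).
Proof.
  intros [Hf [[S1 _] [[_ S2] [[_ [K1 [HK1 V1]]] [_ [K2 [HK2 V2]]]]]]].
  destruct (compact_interval K1 HK1) as [A1 [HA1 Z1]].
  destruct (compact_interval K2 HK2) as [A2 [HA2 Z2]].
  pose proof (circle_limit_compact A1 f1 HA1 S1 (Z1 _ V1)) as L1.
  pose proof (circle_limit_compact_off_0 A2 f2 HA2 S2 (Z2 _ V2)) as L2.
  pose proof (circle_limit_lin pm (cayley phi) 1 _ _ _ _ L1 L2) as L.
  rewrite Cmult_1_l, <- Cmult_plus_distr_l in L. revert L. apply circle_limit_ext.
  intros t _. rewrite Hf. ring.
Qed.

Definition cutoff_Rhat (s : Rhat) : R := match s with Some x => cutoff x | None => 0%R end.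

Lemma cutoff_Rhat_inv (s : Rhat) : cutoff_Rhat (Rhat_inv s) = (1 - cutoff_Rhat s)%R.
Proof.
  destruct s as [x|]; simpl.
  - destruct (Req_EM_T x 0) as [->|Hx]; simpl; [rewrite cutoff_0; ring|now apply cutoff_inv].
  - rewrite cutoff_0. ring.
Qed.

Let part1 (f : Rhat -> C) (s : Rhat) : C := f s * RtoC (cutoff_Rhat s).
Let part2 (f : Rhat -> C) (s : Rhat) : C := f s * RtoC (1 - cutoff_Rhat s).

Lemma smooth_cutoff (x : R) : smooth_at cutoff x.
Proof. intros n. apply Cn_cutoff. Qed.

Lemma smooth_one_minus_cutoff (x : R) : smooth_at (fun x => 1 - cutoff x)%R x.
Proof. intros n. apply (Cn_minus n (fun _ => 1%R)); [apply Cn_const|apply Cn_cutoff]. Qed.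

Lemma chart1_part1 f : chart1 (part1 f) = fun x => chart1 f x * RtoC (1 - cutoff x).
Proof.
  apply functional_extensionality. intros x. unfold chart1, part1. now rewrite cutoff_Rhat_inv.
Qed.

Lemma chart1_part2 f : chart1 (part2 f) = fun x => chart1 f x * RtoC (cutoff x).
Proof.
  apply functional_extensionality. intros x. unfold chart1, part2. rewrite cutoff_Rhat_inv.
  simpl. f_equal. f_equal. ring.
Qed.

Lemma compact_cutoff_interval : Rtopology.compact (fun x => (-2 <= x <= 2)%R).
Proof. apply compact_P3. Qed.

Lemma cutoff_vanishes_off (h : R -> C) : vanishes_off (fun x => (-2 <= x <= 2)%R) (fun x => h x * RtoC (cutoff x)).
Proof.
  intros x Hx. rewrite cutoff_support; [ring|]. apply Rnot_lt_le. intros Hl. apply Hx.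
  apply Rabs_def2 in Hl. lra.
Qed.

(** Since the inversion exchanges the cutoff and its complement, the second part read in the chart
    at infinity is again [cutoff] times a smooth function, supported in [[-2, 2]]. *)
Lemma decomposition_exists (f : Rhat -> C) : smooth_Rhat f -> decomposition f (part1 f) (part2 f).
Proof.
  intros [S0 S1]. split; [|split; [|split; [|split]]].
  - intros s. unfold part1, part2. rewrite RtoC_minus. ring.
  - split.
    + apply (smooth_mult_RtoC (chart0 f) cutoff); auto. apply smooth_cutoff.
    + rewrite chart1_part1. apply (smooth_mult_RtoC (chart1 f) (fun x => 1 - cutoff x)%R); auto.
      apply smooth_one_minus_cutoff.
  - split.
    + apply (smooth_mult_RtoC (chart0 f) (fun x => 1 - cutoff x)%R); auto. apply smooth_one_minus_cutoff.
    + rewrite chart1_part2. apply (smooth_mult_RtoC (chart1 f) cutoff); auto. apply smooth_cutoff.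
  - split; [unfold part1; simpl; ring|].
    exists (fun x => (-2 <= x <= 2)%R). split; [apply compact_cutoff_interval|]. apply (cutoff_vanishes_off (chart0 f)).
  - split.
    + unfold part2. rewrite cutoff_Rhat_inv. simpl. replace (1 - (1 - 0))%R with 0%R by ring. ring.
    + exists (fun x => (-2 <= x <= 2)%R). split; [apply compact_cutoff_interval|].
      change (vanishes_off (fun x => (-2 <= x <= 2)%R) (chart1 (part2 f))).
      rewrite chart1_part2. apply (cutoff_vanishes_off (chart1 f)).
Qed.

(** By the symmetry of the cutoff, the same compactly supported weight multiplies [chart0 f] in [T]
    and [chart1 f] in [Tt]. *)
Let weight (x : R) : R := (cutoff x * density x)%R.

Lemma smooth_weight (x : R) : smooth_at weight x.
Proof. intros n. apply (Cn_mult n cutoff density); [apply Cn_cutoff|apply smooth_density]. Qed.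

Lemma weight_support (x : R) : (2 < Rabs x)%R -> weight x = 0%R.
Proof. intros Hx. unfold weight. rewrite cutoff_support by lra. ring. Qed.

Lemma circle_limit_weight (f : Rhat -> C) : smooth_Rhat f ->
  circle_limit pm (cayley phi) (fun t => f (tan_half t))
    (- Ci * (T (fun x => chart0 f x * RtoC (weight x)) + Tt (fun x => chart1 f x * RtoC (weight x)))).
Proof.
  intros Hf. pose proof (circle_limit_decomposition f _ _ (decomposition_exists f Hf)) as H.
  replace (fun x => chart0 f x * RtoC (weight x)) with
    (fun x => chart0 (part1 f) x * RtoC (density x)).
  - replace (fun x => chart1 f x * RtoC (weight x)) with
      (fun x => chart1 (part2 f) x * RtoC (density x)); [exact H|].
    rewrite chart1_part2. apply functional_extensionality. intros x. unfold weight.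
    rewrite RtoC_mult. ring.
  - apply functional_extensionality. intros x. unfold weight, part1, chart0. simpl.
    rewrite RtoC_mult. ring.
Qed.

(** The estimate from which the continuity of both the joined and the circle distribution is
    drawn. *)
Lemma circle_functional_bound : exists c, (0 <= c)%R /\ forall (f : Rhat -> C) (M : R), smooth_Rhat f ->
  (forall k x, (k <= 2)%nat -> (Cmod (Dn (fun x => chart0 f x * RtoC (weight x))%C k x) <= M)%R /\
                               (Cmod (Dn (fun x => chart1 f x * RtoC (weight x))%C k x) <= M)%R) ->
  (Cmod (P (fun t => f (tan_half t))) <= c * M)%R.
Proof.
  destruct (line_limit_exists pm phi 2 ltac:(lra) Ht) as [c1 [Hc1 H1]].
  destruct (line_limit_exists pm (inversion phi) 2 ltac:(lra) Hti) as [c2 [Hc2 H2]].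
  exists (c1 + c2)%R. split; [lra|]. intros f M Hf HM.
  unfold P. rewrite (circle_functional_eq _ _ _ _ (circle_limit_weight f Hf)).
  destruct Hf as [S0 S1].
  assert (HV : forall (h : R -> C) x, (2 < Rabs x)%R -> h x * RtoC (weight x) = 0).
  { intros h x Hx. rewrite weight_support by auto. ring. }
  destruct (H1 (fun x => chart0 f x * RtoC (weight x))) as [L1 [HL1 B1]].
  { apply smooth_mult_RtoC; auto. apply smooth_weight. } { apply HV. }
  destruct (H2 (fun x => chart1 f x * RtoC (weight x))) as [L2 [HL2 B2]].
  { apply smooth_mult_RtoC; auto. apply smooth_weight. } { apply HV. }
  unfold T, Tt. rewrite (boundary_functional_eq _ _ _ _ HL1), (boundary_functional_eq _ _ _ _ HL2).
  rewrite Cmod_mult, Cmod_opp, Cmod_Ci, Rmult_1_l.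
  eapply Rle_trans; [apply Cmod_triangle|]. rewrite Rmult_plus_distr_r.
  apply Rplus_le_compat; [apply B1|apply B2]; intros k x Hk; now apply HM.
Qed.

Lemma circle_functional_lin (a : C) (f g : Rhat -> C) : smooth_Rhat f -> smooth_Rhat g ->
  P (fun t => a * f (tan_half t) + g (tan_half t)) =
  a * P (fun t => f (tan_half t)) + P (fun t => g (tan_half t)).
Proof.
  intros Hf Hg. unfold P.
  rewrite (circle_functional_eq _ _ _ _ (circle_limit_weight f Hf)),
    (circle_functional_eq _ _ _ _ (circle_limit_weight g Hg)).
  apply circle_functional_eq.
  apply (circle_limit_lin pm (cayley phi) a (fun t => f (tan_half t)) (fun t => g (tan_half t)));
    now apply circle_limit_weight.
Qed.

(** Solves the relation of (iv) for the joined distribution, since [Ci] is the inverse of [- Ci]. *)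
Let J (f : Rhat -> C) : C := Ci * P (fun t => f (tan_half t)).

Lemma joined_distribution : is_joined_distribution T Tt J.
Proof.
  split; [split|].
  - intros a f g Hf Hg. unfold J. rewrite circle_functional_lin by auto. ring.
  - destruct circle_functional_bound as [c [Hc HB]].
    destruct (C2_bound weight (fun x => x) 2 smooth_weight) as [d [Hd HC]].
    { intros x n. apply Cn_id. } { apply weight_support. }
    exists 2%R, 2%nat, (c * d)%R. intros f M [S0 S1] HM. unfold J.
    assert (HM0 : (0 <= M)%R).
    { eapply Rle_trans; [apply Cmod_ge_0|]. apply (HM 0%nat 0%R); [lia|rewrite Rabs_R0; lra]. }
    rewrite Cmod_mult, Cmod_Ci, Rmult_1_l, Rmult_assoc. apply HB; [now split|].
    intros k x Hk. split; apply (HC _ M); auto; intros j y Hj Hy; now apply HM.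
  - intros f Hf. split.
    + exists (part1 f), (part2 f). now apply decomposition_exists.
    + intros f1 f2 Hd. unfold J, P.
      rewrite (circle_functional_eq _ _ _ _ (circle_limit_decomposition f f1 f2 Hd)).
      transitivity (- (Ci * Ci) * (T (fun x => chart0 f1 x * RtoC (density x)) +
        Tt (fun x => chart1 f2 x * RtoC (density x)))); [ring|].
      rewrite Ci_square. unfold density. ring.
Qed.

(** * Periodic functions as functions on the extended line *)

(** The inverse of composition with [tan_half] on periodic functions; infinity corresponds to the
    angle pi. *)
Definition lift (g : R -> C) (s : Rhat) : C :=
  match s with Some x => g (2 * atan x)%R | None => g PI end.

Lemma lift_tan_half (g : R -> C) (t : R) : (- PI < t < PI)%R -> lift g (tan_half t) = g t.
Proof.
  intros H. unfold tan_half. pose proof (cos_half_pos t H).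
  destruct (Req_EM_T (cos (t / 2)) 0); [lra|]. simpl. f_equal. rewrite atan_tan by lra. field.
Qed.

(** The angle 2 atan (-1/u) equals 2 atan u - pi for u > 0 and 2 atan u + pi for u < 0. Periodicity
    merges the two branches into one formula that is smooth across u = 0. *)
Lemma chart1_lift (g : R -> C) : (forall t, g (t + 2 * PI)%R = g t) ->
  forall u, chart1 (lift g) u = g (2 * atan u + PI)%R.
Proof.
  intros Hg u. unfold chart1. simpl. destruct (Req_EM_T u 0) as [->|Hu]; simpl.
  - f_equal. rewrite atan_0. ring.
  - rewrite atan_opp. destruct (Rlt_dec 0 u) as [Hp|Hn].
    + rewrite atan_inv by auto. rewrite <- Hg. f_equal. field.
    + replace (- atan (/ u))%R with (atan (/ - u))%R.
      * rewrite atan_inv by lra. rewrite atan_opp. f_equal. field.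
      * rewrite <- atan_opp. f_equal. field. auto.
Qed.

Lemma smooth_2atan (x : R) : smooth_at (fun x => 2 * atan x)%R x.
Proof. intros n. apply (Cn_mult n (fun _ => 2%R) atan); [apply Cn_const|apply Cn_atan]. Qed.

Lemma smooth_2atan_PI (x : R) : smooth_at (fun x => 2 * atan x + PI)%R x.
Proof. intros n. apply (Cn_plus n (fun x => 2 * atan x)%R); [apply smooth_2atan|apply Cn_const]. Qed.

Lemma smooth_comp (g : R -> C) (h : R -> R) : smooth g -> (forall x, smooth_at h x) ->
  smooth (fun x => g (h x)).
Proof. rewrite !smooth_iff. intros Hg Hh x. now apply csmooth_at_comp. Qed.

Lemma chart1_lift_fun (g : R -> C) : (forall t, g (t + 2 * PI)%R = g t) ->
  chart1 (lift g) = fun u => g (2 * atan u + PI)%R.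
Proof. intros Hg. apply functional_extensionality. now apply chart1_lift. Qed.

Lemma smooth_lift (g : R -> C) : periodic_test_function g -> smooth_Rhat (lift g).
Proof.
  intros [Hg Hp]. split.
  - apply (smooth_comp g (fun x => 2 * atan x)%R); auto. apply smooth_2atan.
  - rewrite chart1_lift_fun by auto.
    apply (smooth_comp g (fun x => 2 * atan x + PI)%R); auto. apply smooth_2atan_PI.
Qed.

Lemma circle_limit_lift (g : R -> C) : periodic_test_function g ->
  circle_limit pm (cayley phi) g (P (fun t => lift g (tan_half t))).
Proof.
  intros Hg. unfold P. pose proof (circle_limit_weight _ (smooth_lift g Hg)) as H.
  rewrite (circle_functional_eq _ _ _ _ H). revert H. apply circle_limit_ext. intros t Htt.
  now apply lift_tan_half.
Qed.

Lemma circle_functional_lift (g : R -> C) : periodic_test_function g ->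
  P g = P (fun t => lift g (tan_half t)).
Proof. intros Hg. apply circle_functional_eq. now apply circle_limit_lift. Qed.

Lemma circle_boundary_distribution : is_circle_boundary_distribution pm (cayley phi) P.
Proof.
  assert (HL : forall g, periodic_test_function g -> circle_limit pm (cayley phi) g (P g)).
  { intros g Hg. rewrite circle_functional_lift by auto. now apply circle_limit_lift. }
  split; [split|exact HL].
  - intros a f g Hf Hg. apply circle_functional_eq. apply circle_limit_lin; auto.
  - destruct circle_functional_bound as [c [Hc HB]].
    destruct (C2_bound weight (fun x => 2 * atan x)%R 2 smooth_weight smooth_2atan weight_support) as [d1 [Hd1 HC1]].
    destruct (C2_bound weight (fun x => 2 * atan x + PI)%R 2 smooth_weight smooth_2atan_PI weight_support) as [d2 [Hd2 HC2]].
    exists 2%nat, (c * (d1 + d2))%R. intros g M Hg HM.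
    assert (HM0 : (0 <= M)%R) by (eapply Rle_trans; [apply Cmod_ge_0|apply (HM 0%nat 0%R); lia]).
    rewrite circle_functional_lift, Rmult_assoc by auto. apply HB; [now apply smooth_lift|].
    destruct Hg as [Sg Pg]. rewrite chart1_lift_fun by auto.
    intros k x Hk. split.
    + eapply Rle_trans; [apply (HC1 g M); auto|nra].
    + eapply Rle_trans; [apply (HC2 g M); auto|nra].
Qed.

(** Near u = 0 the point -1/u lies outside the support of [f], so the composite is locally 0. At u =
    0 itself the convention [/ 0 = 0] makes its value [f 0], whence the condition on [f 0]. *)
Lemma smooth_neg_inv (f : R -> C) (A : R) : (0 < A)%R -> smooth f -> f 0%R = 0 ->
  (forall x, (A < Rabs x)%R -> f x = 0) -> smooth (fun u => f (- / u)%R).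
Proof.
  intros HA Hf Hf0 HfA. rewrite smooth_iff in *. intros u. destruct (Req_dec u 0) as [->|Hu].
  - apply csmooth_at_ext with (fun _ => RtoC 0); [|apply csmooth_at_const].
    exists (mkposreal _ (Rinv_0_lt_compat _ HA)). intros v Hv.
    change (Rabs (v - 0) < / A)%R in Hv. rewrite Rminus_0_r in Hv.
    destruct (Req_dec v 0) as [->|Hv0]; [now rewrite Rinv_0, Ropp_0|].
    symmetry. apply HfA. rewrite Rabs_Ropp, Rabs_inv. rewrite <- (Rinv_inv A).
    apply Rinv_lt_contravar; auto. apply Rmult_lt_0_compat; [now apply Rabs_pos_lt|now apply Rinv_0_lt_compat].
  - apply (csmooth_at_comp f (fun u => - / u)%R); auto.
    intros n. apply (Cn_opp n Rinv). now apply Cn_Rinv.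
Qed.

(** A function supported away from both 0 and infinity can be treated in either chart, and the two
    expressions are limits of the same circle integrals. *)
Lemma inversion_formula (f : R -> C) : test_function (fun x => x <> 0%R) f ->
  T (fun x => f x * RtoC (/ (1 + x ^ 2))) = Tt (fun x => f (- / x)%R * RtoC (/ (1 + x ^ 2))).
Proof.
  intros [Sf [K [HK [HK0 Hv]]]].
  destruct (compact_interval K HK) as [A [HA HA0]].
  assert (Hf0 : f 0%R = 0) by (apply Hv; intros Hk; now apply (HK0 0%R Hk)).
  (* The support keeps a distance [d] from 0, so in the inverted chart it lies in [[- / d, / d]]. *)
  destruct (compact_P2 K HK 0%R) as [d Hd]; [intros Hk; now apply (HK0 0%R Hk)|].
  pose proof (cond_pos d) as Hdp.
  (* The factor 1/2 cancels the numerator of [density]. *)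
  set (k := fun s : Rhat => match s with Some x => f x * RtoC (/ 2) | None => RtoC 0 end).
  assert (E1 : chart1 k = fun u => f (- / u)%R * RtoC (/ 2)).
  { apply functional_extensionality. intros u. unfold chart1, k. simpl.
    destruct (Req_EM_T u 0) as [->|Hu]; auto. rewrite Rinv_0, Ropp_0, Hf0. ring. }
  assert (L1 := circle_limit_compact A k HA).
  assert (L2 := circle_limit_compact_off_0 (/ d) k (Rinv_0_lt_compat _ Hdp)).
  assert (Hinv : forall x : R, (/ d < Rabs x)%R -> chart1 k x = 0).
  { intros x Hx. rewrite E1. rewrite (Hv (- / x)%R); [ring|]. apply Hd.
    unfold disc. rewrite Rminus_0_r, Rabs_Ropp, Rabs_inv, <- (Rinv_inv d).
    pose proof (Rinv_0_lt_compat _ Hdp).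
    apply Rinv_lt_contravar; auto. apply Rmult_lt_0_compat; lra. }
  specialize (L1 ltac:(apply (smooth_mult_RtoC f (fun _ => / 2)%R); auto; intros x n; apply Cn_const)).
  specialize (L1 ltac:(intros x Hx; unfold chart0, k; rewrite (HA0 f Hv) by auto; ring)).
  specialize (L2 ltac:(rewrite E1; apply (smooth_mult_RtoC (fun u => f (- / u)%R) (fun _ => / 2)%R);
    [now apply (smooth_neg_inv f A HA Sf Hf0), (HA0 f Hv)|intros x n; apply Cn_const]) Hinv).
  pose proof (circle_limit_unique _ _ _ _ _ L1 L2) as E. rewrite E1 in E.
  assert (Hw : forall h : R -> C, (fun x => h x * RtoC (/ 2) * RtoC (density x)) =
    (fun x => h x * RtoC (/ (1 + x ^ 2)))).
  { intros h. apply functional_extensionality. intros x.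
    replace (/ (1 + x ^ 2))%R with (/ 2 * density x)%R
      by (unfold density; field; apply one_plus_sqr_neq_0).
    rewrite RtoC_mult. ring. }
  change (fun x => chart0 k x * RtoC (density x)) with (fun x => f x * RtoC (/ 2) * RtoC (density x)) in E.
  rewrite (Hw f), (Hw (fun x => f (- / x)%R)) in E.
  apply (f_equal (Cmult Ci)) in E.
  assert (Q : forall z, Ci * (- Ci * z) = z).
  { intros z. transitivity (- (Ci * Ci) * z); [ring|rewrite Ci_square; ring]. }
  now rewrite !Q in E.
Qed.

Lemma circle_functional_joined (f : Rhat -> C) : P (fun t => f (tan_half t)) = - Ci * J f.
Proof.
  unfold J. transitivity (- (Ci * Ci) * P (fun t => f (tan_half t))); [rewrite Ci_square; ring|ring].
Qed.

End Joined.

Theorem theorem4p11 (pm : side) (D : C -> Prop) (phi : C -> C)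
    (hD : boundary_nbhd pm full D)
    (hol : holomorphic_on D phi)
    (simple : behaves_simply_on pm phi full) :
  (* (i) *)
  (boundary_nbhd pm full (fun w => D (- / w)) /\
   holomorphic_on (fun w => D (- / w)) (inversion phi) /\
   behaves_simply_on pm (inversion phi) full) /\
  exists T Tt : (R -> C) -> C,
    (* (ii) *)
    (is_boundary_distribution pm (fun _ => True) phi T /\
     is_boundary_distribution pm (fun _ => True) (inversion phi) Tt) /\
    (* (iii) *)
    (forall f : R -> C, test_function (fun x => x <> 0%R) f ->
       T (fun x => f x * RtoC (/ (1 + x ^ 2))) =
       Tt (fun x => f (- / x)%R * RtoC (/ (1 + x ^ 2)))) /\
    (* (iv) *)
    exists (P : (R -> C) -> C) (J : (Rhat -> C) -> C),
      is_circle_boundary_distribution pm (cayley phi) P /\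
      is_joined_distribution T Tt J /\
      forall f : Rhat -> C, smooth_Rhat f ->
        P (fun t => f (tan_half t)) = - Ci * J f.
Proof.
  pose proof (inversion_boundary_nbhd pm D hD) as hD'.
  pose proof (inversion_holomorphic pm D phi hD hol) as hol'.
  pose proof (inversion_simple pm phi simple) as simple'.
  pose proof (tame_of_simple pm D phi hD hol simple) as Ht.
  (* By (i) the inversion satisfies the hypotheses imposed on [phi], so the local analysis applies
     to it as well. *)
  pose proof (tame_of_simple pm _ _ hD' hol' simple') as Hti.
  split; [now split|].
  exists (boundary_functional pm phi), (boundary_functional pm (inversion phi)).
  split; [split; now apply boundary_functional_distribution|].
  split; [now apply inversion_formula|].
  exists (circle_functional pm (cayley phi)),
    (fun f => Ci * circle_functional pm (cayley phi) (fun t => f (tan_half t))).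
  split; [now apply circle_boundary_distribution|].
  split; [now apply joined_distribution|].
  intros f _. apply circle_functional_joined.
Qed.
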